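(* Let $\mu,\nu\in\mathcal{P}(\mathbb{T})$. The following are equivalent: - (1) $(\mu,\nu)$ is $\rhd_c$-infinitely divisible, $\mu\ne\omega$ and $\nu\ne\omega$. - (2) There exists a weakly continuous $\rhd_c$-convolution semigroup $\{(\mu_t,\nu_t)\}_{t\ge0}$ with $(\mu_0,\nu_0)=(\delta_1,\delta_1)$ and $(\mu_1,\nu_1)=(\mu,\nu)$.
   Context: $\mathbb{T}$ is the unit circle, $\mathbb{D}$ the open unit disc, $\mathcal{P}(\mathbb{T})$ the Borel probability measures on $\mathbb{T}$, $\omega$ the normalized Haar measure, and $\delta_1$ the Dirac mass at $1$. For $\mu\in\mathcal{P}(\mathbb{T})$ let $\psi_\mu(z)=\int\frac{z\zeta}{1-z\zeta}d\mu(\zeta)$ and $\eta_\mu=\psi_\mu/(1+\psi_\mu)$ on $\mathbb{D}$; $\eta_\mu$ determines $\mu$. The multiplicative conditionally monotone convolution is $(\mu_1,\nu_1)\rhd_c(\mu_2,\nu_2)=(\mu,\nu)$ with $\eta_\nu=\eta_{\nu_1}\circ\eta_{\nu_2}$ and $\eta_\mu(z)=\eta_{\mu_2}(z)\,h_{\mu_1}(\eta_{\nu_2}(z))$, where $h_{\mu_1}(w)=\eta_{\mu_1}(w)/w$ and $h_{\mu_1}(0)=\eta_{\mu_1}'(0)$. $(\mu,\nu)$ is $\rhd_c$-infinitely divisible if for every integer $n\ge2$ there is $(\mu_n,\nu_n)\in\mathcal{P}(\mathbb{T})^2$ whose $n$-fold $\rhd_c$-power equals $(\mu,\nu)$. A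 weakly continuous $\rhd_c$-convolution semigroup is a family $\{(\mu_t,\nu_t)\}_{t\ge0}$ with $(\mu_{s+t},\nu_{s+t})=(\mu_s,\nu_s)\rhd_c(\mu_t,\nu_t)$ for all $s,t\ge0$ and $t\mapsto\mu_t,\nu_t$ weakly continuous. *)

(* Defs.v *)
From HB Require Import structures.
From mathcomp Require Import all_boot all_order all_algebra.
From mathcomp Require Import all_classical all_reals all_analysis.
From mathcomp Require Import complex.
Set Implicit Arguments. Unset Strict Implicit. Unset Printing Implicit Defensive.
Import Order.TTheory GRing.Theory Num.Theory.
Import numFieldNormedType.Exports.
Local Open Scope classical_set_scope.
Local Open Scope ring_scope.

(* The unit circle T, viewed inside R^2 = R * R (point (x,y) <-> x + i y). *)
Definition circle (R : realType) : set (R * R)%type :=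
  [set p | p.1 ^+ 2 + p.2 ^+ 2 = 1].
Arguments circle R : clear implicits.

(* Borel probability measures on R^2; an element of P(T) is one with
   full mass on the circle. *)
Definition PM (R : realType) := probability (R * R)%type R.

Definition onT (R : realType) (mu : PM R) : Prop := mu (circle R) = 1%E.

Definition meq (R : realType) (mu nu : set (R * R)%type -> \bar R) : Prop :=
  forall A, measurable A -> mu A = nu A.

Definition zeta (R : realType) (p : (R * R)%type) : R[i] := (p.1 +i* p.2)%C.

Definition cint (R : realType) (mu : PM R) (g : (R * R)%type -> R[i]) : R[i] :=
  ((fine (\int[mu]_(p in circle R) (complex.Re (g p))%:E)) +i*
   (fine (\int[mu]_(p in circle R) (complex.Im (g p))%:E)))%C.

Definition psi (R : realType) (mu : PM R) (z : R[i]) : R[i] :=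
  cint mu (fun p => z * zeta p / (1 - z * zeta p)).

Definition eta (R : realType) (mu : PM R) (z : R[i]) : R[i] :=
  psi mu z / (1 + psi mu z).

(* h_mu(w) = eta_mu(w)/w, h_mu(0) = eta_mu'(0) = psi_mu'(0) = \int zeta dmu *)
Definition hfun (R : realType) (mu : PM R) (w : R[i]) : R[i] :=
  if w == 0 then cint mu (@zeta R) else eta mu w / w.

(* (mu1,nu1) |>_c (mu2,nu2) = (mu,nu), expressed through eta-transforms
   (which determine the measures) on the open unit disc. *)
Definition cmconv (R : realType) (mu1 nu1 mu2 nu2 mu nu : PM R) : Prop :=
  forall z : R[i], `|z| < 1 ->
    eta nu z = eta nu1 (eta nu2 z) /\
    eta mu z = eta mu2 z * hfun mu1 (eta nu2 z).

(* cpow k a b c d : the (k+1)-fold |>_c power of (a,b) equals (c,d),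
   with all intermediate powers in P(T)^2. *)
Fixpoint cpow (R : realType) (k : nat) (a b c d : PM R) : Prop :=
  match k with
  | 0 => meq c a /\ meq d b
  | k'.+1 => exists e f : PM R, onT e /\ onT f /\ cpow k' a b e f /\
                                cmconv e f a b c d
  end.

Definition cinf_div (R : realType) (mu nu : PM R) : Prop :=
  forall n : nat, (2 <= n)%N ->
    exists mun nun : PM R, onT mun /\ onT nun /\ cpow n.-1 mun nun mu nu.

Definition rot (R : realType) (a b : R) (p : (R * R)%type) : (R * R)%type :=
  (a * p.1 - b * p.2, b * p.1 + a * p.2).

Definition is_haar (R : realType) (mu : PM R) : Prop :=
  onT mu /\ forall a b : R, a ^+ 2 + b ^+ 2 = 1 ->
    meq (fun A => mu (rot a b @^-1` A)) mu.

Definition delta1 (R : realType) : set (R * R)%type -> \bar R :=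
  \d_((1, 0) : (R * R)%type).
Arguments delta1 R : clear implicits.

Definition weak_cont (R : realType) (m : R -> PM R) : Prop :=
  forall f : (R * R)%type -> R, {within circle R, continuous f} ->
    {within `[0, +oo[, continuous (fun t => fine (\int[m t]_(p in circle R) (f p)%:E))}.

Definition cm_semigroup (R : realType) (m n : R -> PM R) : Prop :=
  (forall t, 0 <= t -> onT (m t) /\ onT (n t)) /\
  (forall s t, 0 <= s -> 0 <= t ->
     cmconv (m s) (n s) (m t) (n t) (m (s + t)) (n (s + t))) /\
  weak_cont m /\ weak_cont n.

(* Main.v *)
(* A probability measure mu on the circle is encoded by the Schur function
   h_mu(z) = eta_mu(z)/z, and the convolution of pairs becomes
     (g1,h1)(g2,h2) = (g2(z) g1(z h2(z)), h2(z) h1(z h2(z))),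
   which is associative; by a Herglotz representation every holomorphic function
   bounded by 1 on the disc is some h_mu, and weak compactness of P(T) makes the
   Schur pairs a compact topological semigroup.
   If (mu,nu) is infinitely divisible and neither measure is Haar, the values at 0
   do not vanish, since otherwise h = O(z^n) for every n. Ultrafilter limits of
   powers of n!-th roots give a homomorphism from the nonnegative rationals to the
   Schur pairs whose value at 1 is (h_mu,h_nu), and whose values near 0 are
   close to rotations. If the rotation of the second component tends to 1, the
   first component can be multiplied by unimodular constants so that the family
   becomes continuous at 0, and then it extends to the reals. Otherwise (h_mu,h_nu)
   commutes with rotations b such that b^k stays away from 1, for every k, so all
   its nonconstant Taylor coefficients vanish and the constants embed trivially.
   Conversely h_{mu_t}(0) is multiplicative and continuous in t, hence nonzero. *)
From HB Require Import structures.
From mathcomp Require Import all_boot all_order all_algebra.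
From mathcomp Require Import all_classical all_reals all_analysis.
From mathcomp Require Import measurable_realfun complex ring lra.
Require Import Defs.
Set Implicit Arguments. Unset Strict Implicit. Unset Printing Implicit Defensive.
Import Order.TTheory GRing.Theory Num.Theory.
Import numFieldNormedType.Exports.
Local Open Scope classical_set_scope.
Local Open Scope ring_scope.

(** The obstacle is that roots of a pair are neither unique nor compatible with one another.
    Factorials are used because, for a fixed rational s, s n! is an integer for all large n, so that
    powers of n!-th roots add exactly. Multiplicativity at 0 forces the moduli of both components at
    0 to tend to 1 as s tends to 0. The integral of |zeta - lambda|^2, equal to 1 - |lambda|^2, then
    makes both components almost constant on compact subsets of the disc, so only their phases can
    be discontinuous. The phase of the first component may be corrected freely: a constant factor in
    g passes through the convolution, since only h enters the substitution z h(z). The phase of h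
    acts inside that substitution and cannot be corrected, hence the case distinction. Holomorphy is
    carried by uniform polynomial approximation on smaller discs, Taylor coefficients are read off
    moments, and integrals over circles are replaced by sums over roots of unity. *)

Local Notation normc := (@Normc.normc _).

(** * The real-valued modulus on the complex numbers *)

Section ComplexModulus.
Variable R : realType.
Local Notation C := R[i].
Implicit Types x y z : C.

Lemma normc_lt1 z : (`|z| < 1) = (normc z < 1).
Proof. by rewrite -(ltcR (normc z) 1). Qed.

Lemma normc_ge0 z : 0 <= normc z.
Proof. by case: z => a b; rewrite sqrtr_ge0. Qed.

Lemma normcD x y : normc (x + y) <= normc x + normc y.
Proof. exact: le_normcD. Qed.

Lemma normcN x : normc (- x) = normc x.
Proof. exact: complex.normcN. Qed.

Lemma normcB x y : normc (x - y) <= normc x + normc y.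
Proof. by rewrite -[leRHS]/(_ + _) -(normcN y) normcD. Qed.

Lemma normc_dist x y : normc (x - y) = normc (y - x).
Proof. by rewrite -normcN opprB. Qed.

Lemma normc_triangle x y z : normc (x - z) <= normc (x - y) + normc (y - z).
Proof. by apply: le_trans (normcD _ _); rewrite addrA subrK. Qed.

Lemma normc_sqr z : normc z ^+ 2 = complex.Re z ^+ 2 + complex.Im z ^+ 2.
Proof. by case: z => a b /=; rewrite sqr_sqrtr// addr_ge0// sqr_ge0. Qed.

Lemma normcR (a : R) : normc (a%:C)%C = `|a|.
Proof. by rewrite /= expr0n /= addr0 sqrtr_sqr. Qed.

Lemma normc1 : normc (1 : C) = 1.
Proof. exact: Normc.normc1. Qed.

Lemma normc0 : normc (0 : C) = 0.
Proof. exact: Normc.normc0. Qed.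

Lemma normcX z n : normc (z ^+ n) = normc z ^+ n.
Proof.
elim: n => [|n IH]; first by rewrite !expr0 normc1.
by rewrite !exprS Normc.normcM IH.
Qed.

Lemma normc_eq0 z : (normc z == 0) = (z == 0).
Proof.
apply/eqP/eqP => [|->]; first exact: Normc.eq0_normc.
exact: normc0.
Qed.

Lemma normc_gt0 z : (0 < normc z) = (z != 0).
Proof. by rewrite lt_def normc_ge0 andbT normc_eq0. Qed.

Lemma le_Re_normc z : `|complex.Re z| <= normc z.
Proof.
rewrite -(ler_pXn2r (n := 2)) ?nnegrE ?normr_ge0 ?normc_ge0//.
by rewrite normc_sqr real_normK ?num_real// lerDl sqr_ge0.
Qed.

Lemma le_Im_normc z : `|complex.Im z| <= normc z.
Proof.
rewrite -(ler_pXn2r (n := 2)) ?nnegrE ?normr_ge0 ?normc_ge0//.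
by rewrite normc_sqr real_normK ?num_real// lerDr sqr_ge0.
Qed.

Lemma Re_le_normc z : complex.Re z <= normc z.
Proof. exact: le_trans (ler_norm _) (le_Re_normc _). Qed.

Lemma normc_le_ReIm z : normc z <= `|complex.Re z| + `|complex.Im z|.
Proof.
rewrite -(ler_pXn2r (n := 2)) ?nnegrE ?addr_ge0 ?normr_ge0 ?normc_ge0//.
rewrite normc_sqr sqrrD !real_normK ?num_real// lerD2r lerDl.
by rewrite mulrn_wge0// mulr_ge0.
Qed.

Lemma normc_conj z : normc (conjc z) = normc z.
Proof. by case: z => a b /=; rewrite sqrrN. Qed.

Lemma mulc_conj z : z * conjc z = ((normc z ^+ 2)%:C)%C.
Proof.
rewrite normc_sqr; case: z => a b /=.
by apply/eqP; rewrite eq_complex /=; apply/andP; split; apply/eqP; ring.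
Qed.

Lemma ReD x y : complex.Re (x + y) = complex.Re x + complex.Re y.
Proof. by case: x; case: y. Qed.
Lemma ImD x y : complex.Im (x + y) = complex.Im x + complex.Im y.
Proof. by case: x; case: y. Qed.
Lemma ReN x : complex.Re (- x) = - complex.Re x.
Proof. by case: x. Qed.
Lemma ImN x : complex.Im (- x) = - complex.Im x.
Proof. by case: x. Qed.
Lemma ReM x y : complex.Re (x * y) =
  complex.Re x * complex.Re y - complex.Im x * complex.Im y.
Proof. by case: x; case: y. Qed.
Lemma ImM x y : complex.Im (x * y) =
  complex.Re x * complex.Im y + complex.Im x * complex.Re y.
Proof. by case: x; case: y. Qed.
Lemma ReV x : complex.Re x^-1 = complex.Re x / (complex.Re x ^+ 2 + complex.Im x ^+ 2).
Proof. by case: x. Qed.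
Lemma ImV x : complex.Im x^-1 = - (complex.Im x / (complex.Re x ^+ 2 + complex.Im x ^+ 2)).
Proof. by case: x. Qed.

Lemma normc_sub_ge x y : normc x - normc y <= normc (x - y).
Proof. by rewrite lerBlDr; apply: le_trans (normcD _ _); rewrite subrK. Qed.

Lemma normc_sum (I : Type) (s : seq I) (P : pred I) (F : I -> C) :
  normc (\sum_(i <- s | P i) F i) <= \sum_(i <- s | P i) normc (F i).
Proof.
elim/big_ind2 : _ => [|x1 x2 y1 y2 h1 h2|i _//]; first by rewrite normc0.
by apply: le_trans (normcD _ _) _; exact: lerD.
Qed.

Lemma sub1c_neq0 z : normc z < 1 -> 1 - z != 0.
Proof.
move=> z1; rewrite -normc_gt0; apply: lt_le_trans (normc_sub_ge _ _).
by rewrite normc1 subr_gt0.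
Qed.

Lemma normc_sub1 z (r : R) : normc z <= r -> 1 - r <= normc (1 - z).
Proof.
by move=> zr; apply: le_trans (normc_sub_ge _ _); rewrite normc1 lerB.
Qed.

(** The map 1/(1 - z) carries the unit disc onto the half-plane Re > 1/2. All lower bounds on 1 +
    psi come from this. *)
Lemma Re_inv_sub1 z : normc z < 1 -> 1 / 2 <= complex.Re (1 - z)^-1.
Proof.
move=> z1; have n0 := sub1c_neq0 z1.
have n2 : normc z ^+ 2 < 1 by rewrite expr_lt1 ?normc_ge0.
have n3 : 0 < normc (1 - z) ^+ 2 by rewrite exprn_gt0 ?normc_gt0.
rewrite ReV; move: n2 n3; rewrite !normc_sqr ReD ImD ReN ImN/=.
set a := complex.Re z; set b := complex.Im z => n2 n3.
by rewrite ler_pdivlMr//; nra.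
Qed.
End ComplexModulus.

(** * An algebraic parametrization of the circle; compactness and uniform continuity *)

Section CircleParametrization.
Variable R : realType.

Lemma measurable_circle : measurable (circle R).
Proof.
have -> : circle R = (fun p : R * R => p.1 ^+ 2 + p.2 ^+ 2) @^-1` [set 1].
  by [].
rewrite -[X in measurable X]setTI.
have m : measurable_fun [set: R * R] (fun p : R * R => p.1 ^+ 2 + p.2 ^+ 2).
  by apply: measurable_funD; apply: measurable_funX;
    [exact: measurable_fst|exact: measurable_snd].
by apply: m => //; exact: measurable_set1.
Qed.

(** The upper half circle is traversed for t in [0, 1/2], the lower half for t in [1/2, 1]. Each
    square root vanishes outside its own half because [Num.sqrt] is 0 on negative numbers. The speed
    is irrelevant: only continuity and surjectivity matter. *)
Definition cpt (t : R) : R * R :=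
  (`|4 * t - 2| - 1,
   Num.sqrt (1 - (4 * t - 1) ^+ 2) - Num.sqrt (1 - (4 * t - 3) ^+ 2)).

(** A Borel right inverse of [cpt] on the circle. Its values lie in [0, 1), so the arc below
    parameter 1 is the whole circle. *)
Definition carc (p : R * R) : R :=
  if 0 <= p.2 then (1 - p.1) / 4 else (3 + p.1) / 4.

Lemma cpt_circle t : 0 <= t <= 1 -> circle R (cpt t).
Proof.
move=> /andP[t0 t1]; rewrite /circle /cpt /=.
have [t2|t2] := leP t (1 / 2).
  rewrite (_ : Num.sqrt (1 - (4 * t - 3) ^+ 2) = 0); last first.
    by apply: ler0_sqrtr; nra.
  rewrite subr0 sqr_sqrtr; last by nra.
  by rewrite ler0_norm; [ring|lra].
rewrite (_ : Num.sqrt (1 - (4 * t - 1) ^+ 2) = 0); last first.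
  by apply: ler0_sqrtr; nra.
rewrite sub0r sqrrN sqr_sqrtr; last by nra.
by rewrite ger0_norm; [ring|lra].
Qed.

Lemma circle_bound p : circle R p -> `|p.1| <= 1 /\ `|p.2| <= 1.
Proof.
case: p => x y /=; rewrite /circle /= => xy.
by split; rewrite ler_norml; apply/andP; split; nra.
Qed.

Lemma carc_itv p : circle R p -> 0 <= carc p < 1.
Proof.
move=> pc; have [] := circle_bound pc.
move: pc; case: p => x y; rewrite /circle /carc /= !ler_norml => xy.
case: (leP 0 y) => /= y0 /andP[x1 x2] _; first by apply/andP; split; lra.
have {}x2 : x < 1 by nra.
by apply/andP; split; lra.
Qed.

Lemma carcK p : circle R p -> cpt (carc p) = p.
Proof.
move=> pc; have [] := circle_bound pc.
move: pc; case: p => x y; rewrite /circle /carc /cpt /= !ler_norml => xy.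
have y2 : y ^+ 2 = 1 - x ^+ 2 by rewrite -xy addrC addKr.
case: (leP 0 y) => /= y0 /andP[x1 x2] _; congr pair.
- by rewrite ler0_norm; lra.
- rewrite (_ : Num.sqrt (1 - (_ - 3) ^+ 2) = 0); last by apply: ler0_sqrtr; nra.
  rewrite (_ : 1 - _ = y ^+ 2); last by rewrite y2; field.
  by rewrite subr0 sqrtr_sqr ger0_norm.
- by rewrite ger0_norm; lra.
- rewrite (_ : Num.sqrt (1 - (_ - 1) ^+ 2) = 0); last by apply: ler0_sqrtr; nra.
  rewrite (_ : 1 - _ = y ^+ 2); last by rewrite y2; field.
  by rewrite sub0r sqrtr_sqr ltr0_norm// opprK.
Qed.

Lemma measurable_carc : measurable_fun [set: R * R] carc.
Proof.
apply: measurable_fun_ifT.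
- by apply: measurable_fun_ler => //; exact: measurable_snd.
- by apply: measurable_funM => //; apply: measurable_funB => //; exact: measurable_fst.
- by apply: measurable_funM => //; apply: measurable_funD => //; exact: measurable_fst.
Qed.

Lemma continuous_cpt : continuous cpt.
Proof.
have ca (a b : R) : continuous (fun t : R => a * t - b : R).
  move=> t; apply: continuousB; last exact: cst_continuous.
  by apply: continuousM; [exact: cst_continuous|move=> ?].
have cs (a b : R) : continuous (fun t : R => Num.sqrt (1 - (a * t - b) ^+ 2)).
  move=> t; apply: (@continuous_comp _ _ _ (fun t => 1 - (a * t - b) ^+ 2)); last exact: sqrt_continuous.
  apply: continuousB; first exact: cst_continuous.
  by apply: continuousM; apply: ca.
have c1 : continuous (fun t : R => `|4 * t - 2| - 1).
  have cn : continuous (fun t : R => `|4 * t - 2| : R).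
    by move=> t; exact: (cvg_norm (ca 4 2 t)).
  by move=> t; exact: (continuousB (cn t) (@cst_continuous _ _ _ _)).
have c2 : continuous (fun t : R =>
    Num.sqrt (1 - (4 * t - 1) ^+ 2) - Num.sqrt (1 - (4 * t - 3) ^+ 2)).
  by move=> t; exact: (continuousB (cs 4 1 t) (cs 4 3 t)).
by move=> t; exact: (cvg_pair (c1 t) (c2 t)).
Qed.

Lemma circle_image : circle R = cpt @` `[0, 1].
Proof.
apply/seteqP; split => [p pc|_ [t /= t01 <-]].
  exists (carc p); last exact: carcK.
  by have /andP[a b] := carc_itv pc; rewrite /= in_itv/= a ltW.
by apply: cpt_circle; rewrite in_itv/= in t01.
Qed.

Lemma compact_circle : compact (circle R).
Proof.
rewrite circle_image; apply: continuous_compact (@segment_compact _ _ _).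
by apply: continuous_subspaceT; exact: continuous_cpt.
Qed.

Definition tcont (f : R * R -> R) := {within circle R, continuous f}.

Lemma tcont_cpt f : tcont f -> {within `[0, 1], continuous (f \o cpt)}.
Proof.
move=> /subspace_continuousP cf; apply/subspace_continuousP => t t01.
have tc : circle R (cpt t) by apply: cpt_circle; rewrite /= in_itv/= in t01.
apply: cvg_comp (cf _ tc) => /= A wA.
have H := continuous_cpt wA.
apply: (@filterS _ (nbhs t) _ _ _ _ H) => s /= As s01; apply: As.
by apply: cpt_circle; rewrite in_itv/= in s01.
Qed.

(** Nothing is known of f off the circle, so measurability is read off the factorization of f
    through the interval [0, 1] by [carc] and [cpt]. *)
Lemma measurable_tcont f : tcont f -> measurable_fun (circle R) f.
Proof.
move=> cf; apply: (eq_measurable_fun ((f \o cpt) \o carc)).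
  by move=> p /set_mem pc /=; rewrite carcK.
apply: (@measurable_comp _ _ _ _ _ _ (`[0, 1]%classic : set R) (f \o cpt)) => //.
- by move=> _ [p pc <-]; have /andP[a b] := carc_itv pc; rewrite /= in_itv/= a ltW.
- apply: subspace_continuous_measurable_fun => //; exact: tcont_cpt.
- by apply: measurable_funS measurable_carc.
Qed.

Lemma tcont_bounded f : tcont f -> exists M, forall p, circle R p -> `|f p| <= M.
Proof.
move=> cf; have := continuous_compact cf compact_circle.
move=> /compact_bounded [M [_ HM]]; exists (M + 1) => p pc.
by apply: HM; [rewrite ltrDl|exists p].
Qed.

(** Heine-Cantor by near-covering compactness, the radius itself being the parameter that tends to 0
    from the right. *)
Lemma unif_continuous_within (T : pseudoMetricType R) (K : set T) (f : T -> R) :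
  compact K -> {within K, continuous f} -> forall e, 0 < e ->
  exists2 d, 0 < d & forall x y, K x -> K y -> ball x d y -> `|f x - f y| < e.
Proof.
move=> /compact_near_coveringP cK /subspace_continuousP cf e e0.
have := cK _ (0^'+) (fun d x => forall y, K x -> K y -> ball x d y -> `|f x - f y| < e).
case.
  move=> x Kx; have e2 : 0 < e / 2 by rewrite divr_gt0.
  have := cf x Kx; move=> /cvgrPdist_lt /(_ _ e2); rewrite near_withinE.
  move=> /nbhs_ballP[d /= d0 Hd].
  exists (ball x (d / 2), [set t | 0 < t < d / 2]) => /=.
    split; first by apply: nbhsx_ballx; rewrite divr_gt0.
    by near=> t; apply/andP; split; near: t; [exact: nbhs_right_gt|
      apply: nbhs_right_lt; rewrite divr_gt0].
  move=> [x' t] /= [bx /andP[t0 td]] y Kx' Ky b.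
  have h1 : `|f x - f x'| < e / 2 by apply: Hd => //; apply: le_ball bx; lra.
  have h2 : `|f x - f y| < e / 2.
    apply: Hd => //; rewrite [d]splitr; apply: ball_triangle bx _.
    by apply: le_ball b; lra.
  by move: h1 h2; rewrite !ltr_norml => /andP[? ?] /andP[? ?]; lra.
move=> d /= d0 Hd; exists (d / 2); first by rewrite divr_gt0.
move=> x y Kx Ky b; apply: (Hd (d / 2)) => //=; last by rewrite divr_gt0.
by rewrite /= sub0r normrN gtr0_norm ?divr_gt0//; lra.
Unshelve. all: by end_near. Qed.
End CircleParametrization.

(** * Continuous functions on the circle and their real and complex integrals *)

Section CircleIntegral.
Variable R : realType.
Local Notation C := R[i].
Implicit Types (mu : PM R) (f : R * R -> R) (g : R * R -> C).

Lemma tcontD f1 f2 : tcont f1 -> tcont f2 -> tcont (fun p => f1 p + f2 p).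
Proof. by move=> h1 h2 x; exact: (continuousD (h1 x) (h2 x)). Qed.

Lemma tcontM f1 f2 : tcont f1 -> tcont f2 -> tcont (fun p => f1 p * f2 p).
Proof. by move=> h1 h2 x; exact: (continuousM (h1 x) (h2 x)). Qed.

Lemma tcontN f : tcont f -> tcont (fun p => - f p).
Proof. by move=> h1 x; exact: (continuousN (h1 x)). Qed.

Lemma tcontB f1 f2 : tcont f1 -> tcont f2 -> tcont (fun p => f1 p - f2 p).
Proof. by move=> h1 h2; apply: tcontD => //; exact: tcontN. Qed.

Lemma tcont_cst (c : R) : tcont (fun _ : R * R => c).
Proof. by move=> x; exact: cst_continuous. Qed.
Arguments tcont_cst : clear implicits.

Lemma tcontV f : (forall p, circle R p -> f p != 0) -> tcont f ->
  tcont (fun p => (f p)^-1).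
Proof.
move=> f0 /subspace_continuousP cf; apply/subspace_continuousP => p pc.
by apply: cvgV; [exact: f0|exact: cf].
Qed.

Lemma tcont_fst : tcont (fun p : R * R => p.1).
Proof. by apply: continuous_subspaceT => p; exact: cvg_fst. Qed.

Lemma tcont_snd : tcont (fun p : R * R => p.2).
Proof. by apply: continuous_subspaceT => p; exact: cvg_snd. Qed.

Lemma tcont_norm f : tcont f -> tcont (fun p => `|f p|).
Proof.
move=> /subspace_continuousP cf; apply/subspace_continuousP => p pc.
by apply: cvg_norm; exact: cf.
Qed.

Lemma eq_tcont f1 f2 : (forall p, circle R p -> f1 p = f2 p) ->
  tcont f1 -> tcont f2.
Proof.
move=> f12 /subspace_continuousP cf; apply/subspace_continuousP => p pc.
have := cf _ pc; rewrite /from_subspace (f12 p pc); apply: cvg_trans; apply: near_eq_cvg.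
by rewrite near_withinE; apply: nearW => q qc; rewrite f12.
Qed.

Lemma tcont_comp (phi : R -> R) f : continuous phi -> tcont f ->
  tcont (fun p => phi (f p)).
Proof. by move=> cphi cf x; apply: continuous_comp (cf x) (cphi _). Qed.

Definition ccont g := tcont (fun p => complex.Re (g p)) /\ tcont (fun p => complex.Im (g p)).

Lemma eq_ccont g1 g2 : (forall p, circle R p -> g1 p = g2 p) ->
  ccont g1 -> ccont g2.
Proof.
move=> g12 [r i]; split.
  by apply: eq_tcont r => p pc; rewrite g12.
by apply: eq_tcont i => p pc; rewrite g12.
Qed.

Lemma ccontD g1 g2 : ccont g1 -> ccont g2 -> ccont (fun p => g1 p + g2 p).
Proof.
move=> [r1 i1] [r2 i2]; split.
  by apply: eq_tcont (tcontD r1 r2) => p _; rewrite ReD.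
by apply: eq_tcont (tcontD i1 i2) => p _; rewrite ImD.
Qed.

Lemma ccontN g : ccont g -> ccont (fun p => - g p).
Proof.
move=> [r1 i1]; split.
  by apply: eq_tcont (tcontN r1) => p _; rewrite ReN.
by apply: eq_tcont (tcontN i1) => p _; rewrite ImN.
Qed.

Lemma ccontB g1 g2 : ccont g1 -> ccont g2 -> ccont (fun p => g1 p - g2 p).
Proof. by move=> h1 h2; apply: ccontD => //; exact: ccontN. Qed.

Lemma ccontM g1 g2 : ccont g1 -> ccont g2 -> ccont (fun p => g1 p * g2 p).
Proof.
move=> [r1 i1] [r2 i2]; split.
  by apply: eq_tcont (tcontB (tcontM r1 r2) (tcontM i1 i2)) => p _; rewrite ReM.
by apply: eq_tcont (tcontD (tcontM r1 i2) (tcontM i1 r2)) => p _; rewrite ImM.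
Qed.

Lemma ccont_cst (c : C) : ccont (fun=> c).
Proof. by split; exact: tcont_cst. Qed.

Lemma ccontX g n : ccont g -> ccont (fun p => g p ^+ n).
Proof.
move=> cg; elim: n => [|n IH].
  by apply: eq_ccont (ccont_cst 1) => p _; rewrite expr0.
by apply: eq_ccont (ccontM cg IH) => p _; rewrite exprS.
Qed.

Lemma ccontV g : (forall p, circle R p -> g p != 0) -> ccont g ->
  ccont (fun p => (g p)^-1).
Proof.
move=> g0 [r i].
have n : tcont (fun p => (complex.Re (g p) ^+ 2 + complex.Im (g p) ^+ 2)^-1).
  apply: tcontV => [p pc|]; last by apply: tcontD; apply: tcontM.
  by rewrite -normc_sqr expf_neq0// normc_eq0 g0.
split.
  by apply: eq_tcont (tcontM r n) => p _; rewrite ReV.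
by apply: eq_tcont (tcontN (tcontM i n)) => p _; rewrite ImV.
Qed.

Lemma ccont_zeta : ccont (@zeta R).
Proof. by split; [exact: tcont_fst|exact: tcont_snd]. Qed.

Lemma ccont_conj g : ccont g -> ccont (fun p => conjc (g p)).
Proof.
move=> [r i]; split.
  by apply: eq_tcont r => p _; case: (g p).
by apply: eq_tcont (tcontN i) => p _; case: (g p).
Qed.

Lemma ccont_sum (I : Type) (s : seq I) (F : I -> R * R -> C) :
  (forall i, ccont (F i)) -> ccont (fun p => \sum_(i <- s) F i p).
Proof.
move=> cF; elim: s => [|i s IH].
  by apply: eq_ccont (ccont_cst 0) => p _; rewrite big_nil.
by apply: eq_ccont (ccontD (cF i) IH) => p _; rewrite big_cons.
Qed.

Lemma normc_zeta p : circle R p -> normc (zeta p) = 1.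
Proof. by case: p => x y; rewrite /circle /zeta /= => ->; rewrite sqrtr1. Qed.

Definition tint mu f : R := \int[mu]_(p in circle R) f p.

Lemma tint_integrable mu f : tcont f ->
  mu.-integrable (circle R) (EFin \o f).
Proof.
move=> cf; apply: measurable_bounded_integrable.
- exact: measurable_circle.
- by rewrite (le_lt_trans (probability_le1 _ _)) ?ltry//; exact: measurable_circle.
- exact: measurable_tcont.
- have [M HM] := tcont_bounded cf.
  exists M; split; first exact: num_real.
  by move=> y My p pc; exact: le_trans (HM _ pc) (ltW My).
Qed.

Lemma eq_tint mu f1 f2 : (forall p, circle R p -> f1 p = f2 p) ->
  tint mu f1 = tint mu f2.
Proof. by move=> h; apply: eq_Rintegral => p /set_mem/h. Qed.

Lemma tintD mu f1 f2 : tcont f1 -> tcont f2 ->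
  tint mu (fun p => f1 p + f2 p) = tint mu f1 + tint mu f2.
Proof.
move=> h1 h2; apply: RintegralD; first exact: measurable_circle.
  exact: tint_integrable.
exact: tint_integrable.
Qed.

Lemma tintB mu f1 f2 : tcont f1 -> tcont f2 ->
  tint mu (fun p => f1 p - f2 p) = tint mu f1 - tint mu f2.
Proof.
move=> h1 h2; apply: RintegralB; first exact: measurable_circle.
  exact: tint_integrable.
exact: tint_integrable.
Qed.

Lemma tintZ mu (c : R) f : tcont f -> tint mu (fun p => c * f p) = c * tint mu f.
Proof.
move=> h; apply: RintegralZl; first exact: measurable_circle.
exact: tint_integrable.
Qed.

Lemma tintN mu f : tcont f -> tint mu (fun p => - f p) = - tint mu f.
Proof.
by move=> h; rewrite -mulN1r -tintZ//; apply: eq_tint => p _; rewrite mulN1r.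
Qed.

Lemma tint_cst mu (c : R) : onT mu -> tint mu (fun=> c) = c.
Proof.
move=> m1; rewrite /tint Rintegral_cst; last exact: measurable_circle.
by rewrite [X in fine X]m1 /= mulr1.
Qed.

Lemma le_tint mu f1 f2 : tcont f1 -> tcont f2 ->
  (forall p, circle R p -> f1 p <= f2 p) -> tint mu f1 <= tint mu f2.
Proof.
move=> h1 h2 h; apply: le_Rintegral => //; first exact: measurable_circle.
  exact: tint_integrable.
exact: tint_integrable.
Qed.

Lemma tint_norm mu f : tcont f -> `|tint mu f| <= tint mu (fun p => `|f p|).
Proof.
move=> cf; apply: le_normr_Rintegral; first exact: measurable_circle.
exact: tint_integrable.
Qed.

Lemma eq_cint mu g1 g2 : (forall p, circle R p -> g1 p = g2 p) ->
  cint mu g1 = cint mu g2.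
Proof.
move=> h; rewrite /cint; congr Complex.
  by apply: (eq_tint mu (f1 := fun p => complex.Re _)) => p /h ->.
by apply: (eq_tint mu (f1 := fun p => complex.Im _)) => p /h ->.
Qed.

Lemma Re_cint mu g : complex.Re (cint mu g) = tint mu (fun p => complex.Re (g p)).
Proof. by []. Qed.

Lemma Im_cint mu g : complex.Im (cint mu g) = tint mu (fun p => complex.Im (g p)).
Proof. by []. Qed.

Lemma complex_ext (x y : C) : complex.Re x = complex.Re y ->
  complex.Im x = complex.Im y -> x = y.
Proof. by case: x => a b; case: y => c d /= -> ->. Qed.

Lemma cintD mu g1 g2 : ccont g1 -> ccont g2 ->
  cint mu (fun p => g1 p + g2 p) = cint mu g1 + cint mu g2.
Proof.
move=> [r1 i1] [r2 i2]; apply: complex_ext.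
  by rewrite ReD !Re_cint -tintD//; apply: eq_tint => p _; rewrite ReD.
by rewrite ImD !Im_cint -tintD//; apply: eq_tint => p _; rewrite ImD.
Qed.

Lemma cintZ mu (c : C) g : ccont g ->
  cint mu (fun p => c * g p) = c * cint mu g.
Proof.
move=> [r i]; have rZ a := tcontM (tcont_cst a) r.
have iZ a := tcontM (tcont_cst a) i.
apply: complex_ext.
  rewrite ReM !Re_cint Im_cint -!tintZ// -tintB//.
  by apply: eq_tint => p _; rewrite ReM.
rewrite ImM !Im_cint Re_cint -!tintZ// -tintD//.
by apply: eq_tint => p _; rewrite ImM.
Qed.

Lemma cintB mu g1 g2 : ccont g1 -> ccont g2 ->
  cint mu (fun p => g1 p - g2 p) = cint mu g1 - cint mu g2.
Proof.
move=> h1 h2; rewrite cintD//; last exact: ccontN.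
congr (_ + _); rewrite -mulN1r -cintZ//.
by apply: eq_cint => p _; rewrite mulN1r.
Qed.

Lemma cint_cst mu (c : C) : onT mu -> cint mu (fun=> c) = c.
Proof.
by move=> m1; apply: complex_ext; rewrite ?Re_cint ?Im_cint tint_cst.
Qed.

Lemma cint_sum mu (I : Type) (s : seq I) (F : I -> R * R -> C) :
  (forall i, ccont (F i)) ->
  cint mu (fun p => \sum_(i <- s) F i p) = \sum_(i <- s) cint mu (F i).
Proof.
move=> cF; elim: s => [|i s IH].
  rewrite big_nil; transitivity (cint mu (fun _ : R * R => 0 * 0)).
    by apply: eq_cint => p _; rewrite big_nil mul0r.
  by rewrite (cintZ mu 0 (ccont_cst 0)) mul0r.
rewrite big_cons -IH -cintD//; last exact: ccont_sum.
by apply: eq_cint => p _; rewrite big_cons.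
Qed.

(* Rotating the integral onto the positive axis reduces the bound to a real one. *)
Lemma normc_cint mu g f : ccont g -> tcont f ->
  (forall p, circle R p -> normc (g p) <= f p) -> normc (cint mu g) <= tint mu f.
Proof.
move=> cg cf gf; set G := cint mu g.
have [G0|G0] := eqVneq G 0.
  rewrite G0 normc0 -[leLHS](mul0r (tint mu f)) -tintZ//; apply: le_tint => //.
    exact: tcontM (tcont_cst 0) cf.
  by move=> p pc; rewrite mul0r; apply: le_trans (gf _ pc); exact: normc_ge0.
have nG : normc G != 0 by rewrite normc_eq0.
pose u := conjc G * (((normc G)^-1)%:C)%C.
have u1 : normc u = 1.
  by rewrite Normc.normcM normc_conj normcR normfV ger0_norm ?normc_ge0 ?divff.
have -> : normc G = complex.Re (u * G).
  rewrite /u mulrAC [conjc _ * _]mulrC mulc_conj -rmorphM /= expr2 mulfK//.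
have [ug _] := ccontM (ccont_cst u) cg.
rewrite -cintZ// Re_cint; apply: le_tint => // p pc.
by apply: le_trans (Re_le_normc _) _; rewrite Normc.normcM u1 mul1r gf.
Qed.

Lemma normc_cint_le mu g (B : R) : onT mu -> ccont g ->
  (forall p, circle R p -> normc (g p) <= B) -> normc (cint mu g) <= B.
Proof.
move=> m1 cg gB; rewrite -(tint_cst B m1); apply: normc_cint => //.
exact: tcont_cst.
Qed.

Lemma cint_Re_ge mu g (b : R) : onT mu -> ccont g ->
  (forall p, circle R p -> b <= complex.Re (g p)) -> b <= complex.Re (cint mu g).
Proof.
move=> m1 [rg _] gb; rewrite -(tint_cst b m1) Re_cint; apply: le_tint => //.
exact: tcont_cst.
Qed.

Lemma cint_conj mu g : ccont g -> cint mu (fun p => conjc (g p)) = conjc (cint mu g).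
Proof.
move=> [r i]; apply: complex_ext.
  by rewrite Re_cint; apply: eq_tint => p _; case: (g p).
rewrite Im_cint; transitivity (- tint mu (fun p => complex.Im (g p))); last by [].
by rewrite -tintN//; apply: eq_tint => p _; case: (g p).
Qed.

End CircleIntegral.
Arguments tcontD {R f1 f2} _ _.
Arguments tcontB {R f1 f2} _ _.
Arguments tcontM {R f1 f2} _ _.
Arguments tcontN {R f} _.
Arguments tcontV {R f} _ _.
Arguments tcont_norm {R f} _.
Arguments tcont_cst {R} c.
Arguments eq_tcont {R f1 f2} _ _.
Arguments tcont_comp {R phi f} _ _.

(** * Bounds on psi, eta and h; the convolution in terms of h *)

Section EtaTransform.
Variable R : realType.
Local Notation C := R[i].
Implicit Types (mu nu : PM R) (z w : C).

(** For W = 1 + psi the left side is the Schur bound |psi| <= r |1 + psi|. The right side is affine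
    in W inside the modulus, so it survives integration against a probability measure. It also
    supplies the Neumann series behind [pan_hfun]. *)
Lemma apollonius (W : C) (r : R) : 0 <= r < 1 ->
  (normc (W - 1) <= r * normc W) = (normc (1 - ((1 - r ^+ 2)%:C)%C * W) <= r).
Proof.
move=> /andP[r0 r1].
rewrite -(ler_pXn2r (n := 2)) ?nnegrE ?mulr_ge0 ?normc_ge0//.
rewrite -[RHS](ler_pXn2r (n := 2)) ?nnegrE ?mulr_ge0 ?normc_ge0//.
rewrite exprMn !normc_sqr !ReD !ImD !ReN !ImN ReM ImM /=.
set a := complex.Re W; set b := complex.Im W.
have r2 : 0 < 1 - r ^+ 2 by nra.
rewrite -subr_ge0 -[in RHS]subr_ge0.
rewrite [X in _ = (0 <= X)](_ : _ = (1 - r ^+ 2) *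
  (r ^+ 2 * (a ^+ 2 + b ^+ 2) - ((a - 1) ^+ 2 + (b - 0) ^+ 2))); last by ring.
by rewrite pmulr_rge0// subr0.
Qed.

Lemma kernel_neq0 z p : normc z < 1 -> circle R p -> 1 - z * zeta p != 0.
Proof. by move=> z1 pc; apply: sub1c_neq0; rewrite Normc.normcM normc_zeta// mulr1. Qed.

Lemma kernel_ge z p (r : R) : normc z <= r -> circle R p -> 1 - r <= normc (1 - z * zeta p).
Proof. by move=> z1 pc; apply: normc_sub1; rewrite Normc.normcM normc_zeta// mulr1. Qed.

Lemma normc_kernelV z p (r : R) : normc z <= r -> r < 1 -> circle R p ->
  normc (1 - z * zeta p)^-1 <= (1 - r)^-1.
Proof.
move=> zr r1 pc; rewrite Normc.normcV lef_pV2 ?posrE; first exact: kernel_ge.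
  by apply: lt_le_trans (kernel_ge zr pc); rewrite subr_gt0.
by rewrite subr_gt0.
Qed.

Lemma ccont_kernel z : normc z < 1 -> ccont (fun p => (1 - z * zeta p)^-1).
Proof.
move=> z1; apply: ccontV => [p pc|]; first exact: kernel_neq0.
apply: ccontB (ccont_cst _) _.
exact: ccontM (ccont_cst _) (ccont_zeta _).
Qed.

Lemma ccont_zkernel z : normc z < 1 -> ccont (fun p => zeta p / (1 - z * zeta p)).
Proof. by move=> z1; exact: ccontM (ccont_zeta _) (ccont_kernel z1). Qed.

(** This is psi_mu(z)/z with the singularity at 0 removed; it gives a formula for [hfun] valid at 0
    as well. *)
Definition Kf mu z : C := cint mu (fun p => zeta p / (1 - z * zeta p)).

Lemma psiE mu z : normc z < 1 -> psi mu z = z * Kf mu z.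
Proof.
move=> z1; rewrite /psi /Kf -cintZ; last exact: ccont_zkernel.
by apply: eq_cint => p _; rewrite mulrA.
Qed.

Lemma one_psiE mu z : onT mu -> normc z < 1 ->
  1 + z * Kf mu z = cint mu (fun p => (1 - z * zeta p)^-1).
Proof.
move=> m1 z1; rewrite /Kf -cintZ; last exact: ccont_zkernel.
rewrite -[X in X + _](cint_cst 1 m1) -cintD.
- apply: eq_cint => p pc; have := kernel_neq0 z1 pc => k0.
  by field.
- exact: ccont_cst.
- exact: ccontM (ccont_cst _) (ccont_zkernel z1).
Qed.

Lemma one_psi_Re mu z : onT mu -> normc z < 1 -> 1 / 2 <= complex.Re (1 + z * Kf mu z).
Proof.
move=> m1 z1; rewrite one_psiE//; apply: cint_Re_ge => //; first exact: ccont_kernel.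
by move=> p pc; apply: Re_inv_sub1; rewrite Normc.normcM normc_zeta// mulr1.
Qed.

Lemma one_psi_ge mu z : onT mu -> normc z < 1 -> 1 / 2 <= normc (1 + z * Kf mu z).
Proof. by move=> m1 z1; apply: le_trans (one_psi_Re m1 z1) (Re_le_normc _). Qed.

Lemma one_psi_neq0 mu z : onT mu -> normc z < 1 -> 1 + z * Kf mu z != 0.
Proof.
by move=> m1 z1; rewrite -normc_gt0; apply: lt_le_trans (one_psi_ge m1 z1); lra.
Qed.

Lemma one_psiV mu z : onT mu -> normc z < 1 -> normc (1 + z * Kf mu z)^-1 <= 2.
Proof.
move=> m1 z1; rewrite Normc.normcV invf_ple ?posrE//; last first.
  by rewrite normc_gt0; exact: one_psi_neq0.
by have := one_psi_ge m1 z1; rewrite mul1r.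
Qed.

Lemma hfunE mu z : onT mu -> normc z < 1 -> hfun mu z = Kf mu z / (1 + z * Kf mu z).
Proof.
move=> m1 z1; rewrite /hfun; have [->|z0] := eqVneq z 0.
  rewrite mul0r addr0 divr1; apply: eq_cint => p _.
  by rewrite mul0r subr0 divr1.
have n0 := one_psi_neq0 m1 z1.
by rewrite /eta psiE//; field; rewrite n0 z0.
Qed.

Lemma etaE mu z : onT mu -> normc z < 1 -> eta mu z = z * hfun mu z.
Proof. by move=> m1 z1; rewrite hfunE// /eta psiE// mulrA. Qed.

(* The values of the kernel 1/(1 - z zeta) lie on the boundary of an Apollonius disc. *)
Lemma psi_le mu z : onT mu -> normc z < 1 ->
  normc (z * Kf mu z) <= normc z * normc (1 + z * Kf mu z).
Proof.
move=> m1 z1; have r01 : 0 <= normc z < 1 by rewrite normc_ge0.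
rewrite -[X in normc X <= _](addrK 1) [_ + 1]addrC apollonius// one_psiE//.
rewrite -[X in X - _](cint_cst 1 m1) -cintZ; last exact: ccont_kernel.
have ck := ccontM (ccont_cst (((1 - normc z ^+ 2)%:C)%C)) (ccont_kernel z1).
rewrite -cintB//; last exact: ccont_cst.
apply: normc_cint_le => //.
  by apply: ccontB ck; exact: ccont_cst.
move=> p pc; rewrite -apollonius//.
have k0 := kernel_neq0 z1 pc.
rewrite (_ : _ - 1 = z * zeta p * (1 - z * zeta p)^-1); last by field.
by rewrite 2!Normc.normcM normc_zeta// mulr1.
Qed.

Lemma normc_hfun mu z : onT mu -> normc z < 1 -> normc (hfun mu z) <= 1.
Proof.
move=> m1 z1; have [->|z0] := eqVneq z 0.
  rewrite /hfun eqxx; apply: normc_cint_le => //; first exact: ccont_zeta.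
  by move=> p pc; rewrite normc_zeta.
rewrite hfunE// -(ler_pM2l (x := normc z)) ?normc_gt0// mulr1 -Normc.normcM mulrA.
rewrite Normc.normcM Normc.normcV ler_pdivrMr ?normc_gt0 ?one_psi_neq0//.
exact: psi_le.
Qed.

Lemma normc_zhfun mu z : onT mu -> normc z < 1 -> normc (z * hfun mu z) <= normc z.
Proof.
by move=> m1 z1; rewrite Normc.normcM ler_piMr ?normc_ge0 ?normc_hfun.
Qed.

Lemma normc_Kf mu z (r : R) : onT mu -> normc z <= r -> r < 1 ->
  normc (Kf mu z) <= (1 - r)^-1.
Proof.
move=> m1 zr r1; apply: normc_cint_le => //; first exact/ccont_zkernel/(le_lt_trans zr).
by move=> p pc; rewrite Normc.normcM normc_zeta// mul1r normc_kernelV.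
Qed.

Lemma Kf_lip mu z w (r : R) : onT mu -> normc z <= r -> normc w <= r -> r < 1 ->
  normc (Kf mu z - Kf mu w) <= ((1 - r) ^+ 2)^-1 * normc (z - w).
Proof.
move=> m1 zr wr r1; have z1 := le_lt_trans zr r1; have w1 := le_lt_trans wr r1.
rewrite -cintB; try exact: ccont_zkernel.
apply: normc_cint_le => //.
  by apply: ccontB; exact: ccont_zkernel.
move=> p pc; have kz := kernel_neq0 z1 pc; have kw := kernel_neq0 w1 pc.
rewrite (_ : _ - _ = zeta p * zeta p * (z - w) *
  ((1 - z * zeta p)^-1 * (1 - w * zeta p)^-1)); last by field; rewrite kz kw.
rewrite !Normc.normcM normc_zeta// !mul1r mulrC ler_wpM2r ?normc_ge0//.
rewrite expr2 invfM ler_pM ?normc_ge0//; exact: normc_kernelV.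
Qed.

(** The bound does not depend on the measure: all the h_mu are equicontinuous on |z| <= r, which
    later permits limits inside compositions. In the difference of the two fractions the numerator
    has two terms of the same size and each inverse denominator is at most 2, whence 8. *)
Lemma hfun_lip mu z w (r : R) : onT mu -> normc z <= r -> normc w <= r -> r < 1 ->
  normc (hfun mu z - hfun mu w) <= 8 * ((1 - r) ^+ 2)^-1 * normc (z - w).
Proof.
move=> m1 zr wr r1; have z1 := le_lt_trans zr r1; have w1 := le_lt_trans wr r1.
have nz := one_psi_neq0 m1 z1; have nw := one_psi_neq0 m1 w1.
have Az := one_psiV m1 z1; have Aw := one_psiV m1 w1.
have Kz := normc_Kf m1 zr r1; have Kw := normc_Kf m1 wr r1.
have KL := Kf_lip m1 zr wr r1.
rewrite !hfunE//; set K := Kf mu z in nz Az Kz KL *; set L := Kf mu w in nw Aw Kw KL *.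
rewrite (_ : _ - _ = (K - L + (w - z) * (K * L)) *
  ((1 + z * K)^-1 * (1 + w * L)^-1)); last by field; rewrite nz nw.
rewrite !Normc.normcM.
rewrite (_ : 8 * _ * _ = 2 * (((1 - r) ^+ 2)^-1 * normc (z - w)) * (2 * 2)); last by ring.
apply: ler_pM; rewrite ?mulr_ge0 ?normc_ge0//; last by apply: ler_pM; rewrite ?normc_ge0.
rewrite mulr_natl mulr2n; apply: le_trans (normcD _ _) _; apply: lerD => //.
rewrite !Normc.normcM normc_dist mulrC ler_wpM2r ?normc_ge0//.
by rewrite expr2 invfM ler_pM ?normc_ge0.
Qed.

Lemma hfun_cst_lip mu z (r : R) : onT mu -> normc z <= r -> r < 1 ->
  normc (hfun mu z - hfun mu 0) <= 8 * ((1 - r) ^+ 2)^-1 * normc z.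
Proof.
move=> m1 zr r1; have := @hfun_lip mu z 0 r m1 zr; rewrite subr0; apply => //.
by rewrite normc0 (le_trans (normc_ge0 _) zr).
Qed.

Lemma hfun0 mu : hfun mu 0 = cint mu (@zeta R).
Proof. by rewrite /hfun eqxx. Qed.

(* Variance bound: the integral of |zeta - lambda|^2 is 1 - |lambda|^2. *)
Lemma hfun_near_rotation mu z (r e : R) : onT mu -> normc z <= r -> r < 1 -> 0 < e ->
  normc (hfun mu z - hfun mu 0) <=
  4 * ((1 - r) ^+ 2)^-1 * (e + (1 - normc (hfun mu 0) ^+ 2) / e).
Proof.
move=> m1 zr r1 e0; have z1 := le_lt_trans zr r1.
have l1 : normc (hfun mu 0) <= 1 by apply: normc_hfun; rewrite ?normc0.
set l := hfun mu 0 in l1 *.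
have zl1 : normc (z * l) <= r.
  by rewrite Normc.normcM; apply: le_trans zr; rewrite ler_piMr ?normc_ge0.
have zl : 1 - z * l != 0 by apply: sub1c_neq0; exact: le_lt_trans zl1 r1.
have nz := one_psi_neq0 m1 z1; have Az := one_psiV m1 z1.
rewrite hfunE//; set K := Kf mu z in nz Az *.
(* The comparison value l / (1 - z l) is the K whose h is the constant l. *)
rewrite (_ : K / _ - l = (K - l / (1 - z * l)) * ((1 + z * K)^-1 * (1 - z * l))); last first.
  by field; rewrite nz zl.
have r0 : 0 < 1 - r by rewrite subr_gt0.
have b2 : normc (1 - z * l) <= 2.
  by apply: le_trans (normcB _ _) _; rewrite normc1; lra.
have cl : ccont (fun p => zeta p - l) by apply: ccontB (ccont_zeta _) (ccont_cst _).
have clk : ccont (fun p => (zeta p - l) * ((1 - z * zeta p)^-1 * (1 - z * l)^-1)).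
  by apply: ccontM cl (ccontM (ccont_kernel z1) (ccont_cst _)).
have cf : tcont (fun p => e + complex.Re ((zeta p - l) * conjc (zeta p - l)) / e).
  have [c1 _] := ccontM cl (ccont_conj cl).
  exact: (tcontD (tcont_cst e) (tcontM c1 (tcont_cst e^-1))).
have main : normc (K - l / (1 - z * l)) <=
    ((1 - r) ^+ 2)^-1 * (e + (1 - normc l ^+ 2) / e).
  rewrite /K /Kf -(cint_cst (l / _) m1) -cintB; last exact: ccont_cst; last exact: ccont_zkernel.
  rewrite (@eq_cint _ mu _ (fun p => (zeta p - l) * ((1 - z * zeta p)^-1 * (1 - z * l)^-1)));
    last first.
    by move=> p pc; have k0 := kernel_neq0 z1 pc; field; rewrite zl k0.
  apply: (@le_trans _ _ (tint mu (fun p => ((1 - r) ^+ 2)^-1 *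
      (e + complex.Re ((zeta p - l) * conjc (zeta p - l)) / e)))).
    apply: normc_cint => //; first exact: (tcontM (tcont_cst _) cf).
    move=> p pc; rewrite !Normc.normcM mulrC expr2 invfM ler_pM ?mulr_ge0 ?normc_ge0//.
      rewrite ler_pM ?normc_ge0//; first exact: normc_kernelV.
      rewrite Normc.normcV lef_pV2 ?posrE//; last exact: lt_le_trans (normc_sub1 zl1).
      exact: normc_sub1.
    (* The linear deviation is traded for the quadratic one by n <= e + n^2 / e; the integral of the
       square is then computed exactly. *)
    rewrite mulc_conj /=; set n := normc _; have n0 : 0 <= n := normc_ge0 _.
    rewrite -(ler_pM2r e0) mulrDl divfK ?gt_eqF//.
    nra.
  rewrite tintZ// ler_wpM2l ?invr_ge0 ?sqr_ge0//.
  have cR : tcont (fun p => complex.Re (conjc l * zeta p)).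
    by have [] := ccontM (ccont_cst (conjc l)) (ccont_zeta R).
  rewrite (@eq_tint _ mu _ (fun p => (e + (1 + normc l ^+ 2) / e) -
      (2 / e) * complex.Re (conjc l * zeta p))); last first.
    move=> p pc; rewrite mulc_conj /= normc_sqr ReD ImD ReN ImN.
    have := normc_sqr (zeta p); rewrite normc_zeta// expr1n normc_sqr ReM.
    case: (l) => a b /= E; rewrite [X in X + (a ^+ 2 + _)]E; field; exact: lt0r_neq0.
  rewrite tintB; [|exact: tcont_cst|exact: (tcontM (tcont_cst _) cR)].
  rewrite tint_cst// tintZ// -Re_cint cintZ; last exact: ccont_zeta.
  by rewrite -hfun0 -/l [conjc l * _]mulrC mulc_conj /=; lra.
rewrite !Normc.normcM [X in _ <= X](_ : _ =
  ((1 - r) ^+ 2)^-1 * (e + (1 - normc l ^+ 2) / e) * (2 * 2)); last by ring.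
apply: ler_pM; rewrite ?mulr_ge0 ?normc_ge0//.
by apply: ler_pM; rewrite ?normc_ge0.
Qed.

(** Restores the point 0 in identities obtained by dividing relations between eta-transforms by
    z. *)
Lemma eq_at0 (F G : C -> C) (L : R) : 0 <= L ->
  (forall z, normc z <= 1 / 2 -> normc (F z - F 0) <= L * normc z) ->
  (forall z, normc z <= 1 / 2 -> normc (G z - G 0) <= L * normc z) ->
  (forall z, normc z <= 1 / 2 -> z != 0 -> F z = G z) -> F 0 = G 0.
Proof.
move=> L0 hF hG FG; apply/eqP; rewrite -subr_eq0 -normc_eq0 eq_le normc_ge0 andbT.
apply/ler_addgt0Pl => e e0; rewrite addr0.
pose t := Num.min (1 / 2) (e / (2 * (L + 1))).
have t0 : 0 < t by rewrite lt_min !divr_gt0//; lra.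
have nt : normc (t%:C)%C = t by rewrite normcR gtr0_norm.
have t1 : normc (t%:C)%C <= 1 / 2 by rewrite nt ge_min lexx.
have tz : (t%:C)%C != 0 :> C by rewrite -normc_gt0 nt.
apply: le_trans (normc_triangle _ (F (t%:C)%C) _) _.
rewrite normc_dist {2}(FG _ t1 tz).
apply: le_trans (lerD (hF _ t1) (hG _ t1)) _; rewrite nt.
have : t <= e / (2 * (L + 1)) by rewrite ge_min lexx orbT.
rewrite ler_pdivlMr; last by lra.
nra.
Qed.

(** Here and below, 32 is the Lipschitz constant 8 / (1 - r)^2 at r = 1/2. *)
Lemma comp_eta_lip mu nu z : onT mu -> onT nu -> normc z <= 1 / 2 ->
  normc (hfun mu (z * hfun nu z) - hfun mu 0) <= 32 * normc z.
Proof.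
move=> m1 n1 z2; have z1 : normc z < 1 by lra.
have zh := normc_zhfun n1 z1.
have h2 : (1 / 2 : R) < 1 by lra.
apply: le_trans (hfun_cst_lip m1 (le_trans zh z2) h2) _.
rewrite (_ : 8 * _ = 32); last by field.
by rewrite ler_pM2l.
Qed.

Lemma hfun_half_lip mu z : onT mu -> normc z <= 1 / 2 ->
  normc (hfun mu z - hfun mu 0) <= 32 * normc z.
Proof.
move=> m1 z2; have h2 : (1 / 2 : R) < 1 by lra.
apply: le_trans (hfun_cst_lip m1 z2 h2) _.
by rewrite (_ : 8 * _ = 32)//; field.
Qed.

(** Away from 0 the two forms differ by a factor z. At 0 both sides of the h-form are Lipschitz (64
    = 32 + 32 for a product of two factors bounded by 1), so [eq_at0] applies. *)
Lemma cmconv_hfunP (mu1 nu1 mu2 nu2 mu nu : PM R) :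
  onT mu1 -> onT nu1 -> onT mu2 -> onT nu2 -> onT mu -> onT nu ->
  cmconv mu1 nu1 mu2 nu2 mu nu <->
  forall z, normc z < 1 ->
    hfun nu z = hfun nu2 z * hfun nu1 (z * hfun nu2 z) /\ hfun mu z = hfun mu2 z * hfun mu1 (z * hfun nu2 z).
Proof.
move=> a1 b1 a2 b2 a b; split => [H|H z]; last first.
  rewrite normc_lt1 => z1; have [h1 h2] := H z z1.
  have zh := le_lt_trans (normc_zhfun b2 z1) z1.
  by rewrite !etaE// h1 h2 !mulrA.
have prod_lip m1 m2 z : onT m1 -> onT m2 -> normc z <= 1 / 2 ->
    normc (hfun m2 z * hfun m1 (z * hfun nu2 z) -
           hfun m2 0 * hfun m1 (0 * hfun nu2 0)) <= 64 * normc z.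
  move=> t1 t2 z2; rewrite mul0r; have z1 : normc z < 1 by lra.
  have E (x y x' y' : C) : x * y - x' * y' = (x - x') * y + x' * (y - y') by ring.
  rewrite E; apply: le_trans (normcD _ _) _; rewrite !Normc.normcM.
  have -> : 64 * normc z = 32 * normc z * 1 + 1 * (32 * normc z) by ring.
  apply: lerD; apply: ler_pM; rewrite ?normc_ge0//.
  - exact: hfun_half_lip.
  - by apply: normc_hfun => //; exact: le_lt_trans (normc_zhfun b2 z1) z1.
  - by apply: normc_hfun; rewrite ?normc0.
  - exact: comp_eta_lip.
have half_lip m1 z : onT m1 -> normc z <= 1 / 2 ->
    normc (hfun m1 z - hfun m1 0) <= 64 * normc z.
  move=> t1 z2; apply: le_trans (hfun_half_lip t1 z2) _.
  by rewrite ler_wpM2r ?normc_ge0//; lra.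
have off0 z : normc z < 1 -> z != 0 ->
    hfun nu z = hfun nu2 z * hfun nu1 (z * hfun nu2 z) /\ hfun mu z = hfun mu2 z * hfun mu1 (z * hfun nu2 z).
  move=> z1 z0; have zl : `|z| < 1 by rewrite normc_lt1.
  have [] := H z zl; have zh := le_lt_trans (normc_zhfun b2 z1) z1.
  rewrite !etaE// -!mulrA => h1 h2; split; exact: (mulfI z0).
have h2 z : normc z <= 1 / 2 -> normc z < 1 by lra.
move=> z z1; have [->|z0] := eqVneq z 0; last exact: off0.
split; apply: (@eq_at0 (fun z => hfun _ z) (fun z => hfun _ z * hfun _ (z * hfun nu2 z)) 64) => //.
- by move=> ? ?; exact: half_lip.
- by move=> ? ?; exact: prod_lip.
- by move=> w w2 w0; have [] := off0 w (h2 _ w2) w0.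
- by move=> ? ?; exact: half_lip.
- by move=> ? ?; exact: prod_lip.
- by move=> w w2 w0; have [] := off0 w (h2 _ w2) w0.
Qed.
End EtaTransform.

(** * Moments as Taylor coefficients; rigidity and the first nonconstant term of h *)

Section Moments.
Variable R : realType.
Local Notation C := R[i].
Implicit Types (mu nu : PM R) (z w : C).

Lemma geometric_le0 (x B r : R) : 0 <= r < 1 -> (forall k, x <= B * r ^+ k) -> x <= 0.
Proof.
move=> /andP[r0 r1] H; apply/ler_addgt0Pl => e e0; rewrite addr0.
have : (fun k => B * r ^+ k) @ \oo --> B * 0.
  by apply: cvgMl_tmp; apply: cvg_expr; rewrite ger0_norm.
rewrite mulr0 => /cvgrPdist_lt /(_ _ e0)[k _ /(_ k (leqnn _))] /=.
rewrite sub0r normrN => hk; apply: le_trans (H k) _.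
exact: le_trans (ler_norm _) (ltW hk).
Qed.

Definition moment mu n : C := cint mu (fun p => zeta p ^+ n).

Lemma moment1 mu : moment mu 1 = hfun mu 0.
Proof. by rewrite hfun0; apply: eq_cint => p _; rewrite expr1. Qed.

Lemma geometric_kernel (a z : C) k : 1 - z * a != 0 ->
  a / (1 - z * a) = \sum_(j < k) a ^+ j.+1 * z ^+ j + z ^+ k * (a ^+ k.+1 / (1 - z * a)).
Proof.
move=> n0; elim: k => [|k IH]; first by rewrite big_ord0 add0r expr0 mul1r expr1.
rewrite big_ord_recr /= IH -addrA; congr (_ + _).
by rewrite ![_ ^+ k.+2]exprS ![z ^+ k.+1]exprS; field.
Qed.

Lemma Kf_expansion mu z (r : R) k : onT mu -> normc z <= r -> r < 1 ->
  normc (Kf mu z - \sum_(j < k) moment mu j.+1 * z ^+ j) <= (1 - r)^-1 * normc z ^+ k.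
Proof.
move=> m1 zr r1; have z1 := le_lt_trans zr r1.
have cz j : ccont (fun p => zeta p ^+ j.+1 * z ^+ j).
  exact: ccontM (ccontX _ (ccont_zeta _)) (ccont_cst _).
rewrite (_ : \sum_(j < k) _ = cint mu (fun p => \sum_(j < k) zeta p ^+ j.+1 * z ^+ j)); last first.
  rewrite cint_sum//; apply: eq_bigr => j _; rewrite mulrC /moment -cintZ.
    by apply: eq_cint => p _; rewrite mulrC.
  exact: ccontX (ccont_zeta _).
rewrite -cintB; [|exact: ccont_zkernel|exact: ccont_sum].
apply: normc_cint_le => //.
  by apply: ccontB; [exact: ccont_zkernel|exact: ccont_sum].
move=> p pc; rewrite (geometric_kernel k (kernel_neq0 z1 pc)) addrC addKr.
rewrite Normc.normcM normcX mulrC ler_wpM2r ?exprn_ge0 ?normc_ge0//.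
by rewrite Normc.normcM normcX normc_zeta// expr1n mul1r normc_kernelV.
Qed.

Lemma rotation_expansion (l z : C) (r : R) k : normc l <= 1 -> normc z <= r -> r < 1 ->
  normc (l / (1 - z * l) - \sum_(j < k) l ^+ j.+1 * z ^+ j) <= (1 - r)^-1 * normc z ^+ k.
Proof.
move=> l1 zr r1; have zl : normc (z * l) <= r.
  by rewrite Normc.normcM; apply: le_trans zr; rewrite ler_piMr ?normc_ge0.
have n0 : 1 - z * l != 0 by apply: sub1c_neq0; exact: le_lt_trans zl r1.
rewrite (geometric_kernel k n0) addrC addKr.
rewrite Normc.normcM normcX mulrC ler_wpM2r ?exprn_ge0 ?normc_ge0//.
rewrite Normc.normcM normcX Normc.normcV -[leRHS]mul1r.
have r0 : 0 < 1 - r by rewrite subr_gt0.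
have n1 := normc_sub1 zl.
by apply: ler_pM; rewrite ?exprn_ge0 ?invr_ge0 ?normc_ge0 ?exprn_ile1 ?normc_ge0//
  lef_pV2 ?posrE// (lt_le_trans r0).
Qed.

(** A Taylor expansion with an explicit remainder on the half disc. The constant 2 is the bound 1/(1
    - r) on the kernel at r = 1/2, and the form suffices to identify coefficients without
    differentiating. *)
Definition has_expansion (F : C -> C) (c : nat -> C) := forall z k,
  normc z <= 1 / 2 -> normc (F z - \sum_(j < k) c j * z ^+ j) <= 2 * normc z ^+ k.

Lemma half_inv : (1 - 1 / 2)^-1 = 2 :> R.
Proof. by field. Qed.

Lemma half_lt1 : 1 / 2 < 1 :> R.
Proof. by lra. Qed.

Lemma Kf_has_expansion mu : onT mu -> has_expansion (Kf mu) (fun j => moment mu j.+1).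
Proof. by move=> m1 z k z2; rewrite -half_inv; apply: Kf_expansion => //; exact: half_lt1. Qed.

Lemma rotation_has_expansion (l : C) : normc l <= 1 ->
  has_expansion (fun z => l / (1 - z * l)) (fun j => l ^+ j.+1).
Proof.
by move=> l1 z k z2; rewrite -half_inv; apply: rotation_expansion => //; exact: half_lt1.
Qed.

Lemma expansion_diff (F G : C -> C) (c d : nat -> C) k z :
  has_expansion F c -> has_expansion G d -> (forall j, (j < k)%N -> c j = d j) ->
  normc z <= 1 / 2 ->
  normc (F z - G z - (c k - d k) * z ^+ k) <= 4 * normc z ^+ k.+1.
Proof.
move=> hF hG cd z2; have := hF z k.+1 z2; have := hG z k.+1 z2.
rewrite !big_ord_recr /=.
have -> : \sum_(j < k) d j * z ^+ j = \sum_(j < k) c j * z ^+ j.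
  by apply: eq_bigr => j _; rewrite cd.
set S := \sum_(j < k) _ => hg hf.
rewrite (_ : _ - _ - _ = (F z - (S + c k * z ^+ k)) - (G z - (S + d k * z ^+ k))); last by ring.
by apply: le_trans (normcB _ _) _; apply: le_trans (lerD hf hg) _; rewrite -mulrDl; lra.
Qed.

Lemma small_neq0 (rho e : R) : 0 < rho -> 0 < e ->
  exists z : C, [/\ normc z <= rho, normc z <= e, normc z <= 1 / 2 & 0 < normc z].
Proof.
move=> r0 e0; pose t := Num.min (Num.min rho e) (1 / 2).
have t0 : 0 < t by rewrite !lt_min r0 e0/=; lra.
exists (t%:C)%C; rewrite normcR gtr0_norm//.
by split => //; rewrite !ge_min lexx ?orbT.
Qed.

Lemma monomial_bound (d : C) k (B rho : R) : 0 < rho -> 0 <= B ->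
  (forall z, normc z <= rho -> normc z <= 1 / 2 -> normc (d * z ^+ k) <= B * normc z ^+ k.+1) ->
  d = 0.
Proof.
move=> r0 B0 H; apply/eqP; apply: contraT => d0.
have nd : 0 < normc d by rewrite normc_gt0.
have B1 : 0 < B + 1 by lra.
have [z [zr ze z2 z0]] := small_neq0 r0 (divr_gt0 nd (addr_gt0 B1 B1)).
have := H z zr z2; rewrite Normc.normcM normcX exprS mulrA.
rewrite ler_pM2r ?exprn_gt0// => h.
move: ze; rewrite ler_pdivlMr; last by lra.
nra.
Qed.

Lemma expansion_uniq (F G : C -> C) (c d : nat -> C) (rho : R) :
  0 < rho -> has_expansion F c -> has_expansion G d ->
  (forall z, normc z <= rho -> normc z <= 1 / 2 -> F z = G z) -> forall k, c k = d k.
Proof.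
move=> r0 hF hG FG k; elim/ltn_ind: k => k IH.
apply/eqP; rewrite -subr_eq0; apply/eqP.
apply: (@monomial_bound _ k 4 rho) => // z zr z2.
have := expansion_diff hF hG IH z2.
by rewrite FG// subrr sub0r normcN.
Qed.

Lemma KfE mu z : onT mu -> normc z < 1 -> Kf mu z = hfun mu z / (1 - z * hfun mu z).
Proof.
move=> m1 z1; rewrite hfunE//; have n0 := one_psi_neq0 m1 z1.
set K := Kf mu z in n0 *.
have -> : 1 - z * (K / (1 + z * K)) = (1 + z * K)^-1 by field.
by rewrite invrK mulfVK.
Qed.

Lemma moment_uniq mu nu (rho : R) : onT mu -> onT nu -> 0 < rho ->
  (forall z, normc z <= rho -> normc z <= 1 / 2 -> hfun mu z = hfun nu z) ->
  forall n, moment mu n = moment nu n.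
Proof.
move=> m1 n1 r0 H [|n].
  have cst1 m : onT m -> moment m 0 = 1.
    move=> t1; rewrite -[RHS](cint_cst 1 t1).
    by apply: eq_cint => p _; rewrite expr0.
  by rewrite !cst1.
apply: (expansion_uniq r0 (Kf_has_expansion m1) (Kf_has_expansion n1)) => z zr z2.
have z1 := le_lt_trans z2 half_lt1.
by rewrite !KfE// H.
Qed.

(** Powers of l are the moments of the Poisson measure with mean l (a Dirac mass if |l| = 1). Its K
    is l / (1 - z l), which corresponds to a constant h. *)
Lemma hfun_rigid mu : onT mu -> (forall n, moment mu n.+1 = hfun mu 0 ^+ n.+1) ->
  forall z, normc z < 1 -> hfun mu z = hfun mu 0.
Proof.
move=> m1 H z z1; have l1 : normc (hfun mu 0) <= 1 by apply: normc_hfun; rewrite ?normc0.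
rewrite [LHS]hfunE//; have n0 := one_psi_neq0 m1 z1.
set l := hfun mu 0 in H l1 *.
have zl : 1 - z * l != 0.
  apply: sub1c_neq0; rewrite Normc.normcM; apply: le_lt_trans z1.
  by rewrite ler_piMr ?normc_ge0.
suff -> : Kf mu z = l / (1 - z * l).
  have -> : 1 + z * (l / (1 - z * l)) = (1 - z * l)^-1 by field.
  by rewrite invrK mulfVK.
apply/eqP; rewrite -subr_eq0 -normc_eq0 eq_le normc_ge0 andbT.
apply: (@geometric_le0 _ (2 * (1 - normc z)^-1) (normc z)) => [|k].
  by rewrite normc_ge0 z1.
apply: le_trans (normc_triangle _ (\sum_(j < k) moment mu j.+1 * z ^+ j) _) _.
rewrite -mulrA mulr_natl mulr2n; apply: lerD; first exact: Kf_expansion.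
rewrite normc_dist; under eq_bigr do rewrite H.
exact: rotation_expansion.
Qed.

(** Let d z^k be the first term in which K deviates from l / (1 - z l). Since h - l is that
    deviation times (1 - z l) / (1 + z K), a factor of the form 1 + O(z), the same d z^k is the
    leading term of h - l. *)
Lemma hfun_dichotomy mu : onT mu ->
  (forall n, moment mu n.+1 = hfun mu 0 ^+ n.+1) \/
  exists (k : nat) (d : C) (B : R), [/\ (0 < k)%N, d != 0, 0 <= B &
    forall z, normc z <= 1 / 2 ->
      normc (hfun mu z - hfun mu 0 - d * z ^+ k) <= B * normc z ^+ k.+1].
Proof.
move=> m1; set l := hfun mu 0.
have l1 : normc l <= 1 by apply: normc_hfun; rewrite ?normc0.
have [H|/existsNP[n0 /eqP n0P]] := pselect (forall n, moment mu n.+1 = l ^+ n.+1); first by left.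
right; have ex : exists n, moment mu n.+1 != l ^+ n.+1 by exists n0.
case: (ex_minnP ex) => k dk kmin.
(* The 6 bounds (l + K) / (1 + z K) by 3 times 2; the 16 is the remainder constant 4 of
   [expansion_diff] times the bound 4 on (1 - z l) / (1 + z K). *)
exists k, (moment mu k.+1 - l ^+ k.+1), (6 * normc (moment mu k.+1 - l ^+ k.+1) + 16).
set d := moment mu k.+1 - _ in dk *.
split.
(* The order k is positive because the first moment is h(0) itself. *)
- by case: k dk kmin @d => // + _ => /negP h _; case: h; rewrite moment1 expr1.
- by rewrite subr_eq0.
- by rewrite addr_ge0// mulr_ge0 ?normc_ge0.
move=> z z2; have z1 := le_lt_trans z2 half_lt1.
have lt_k j : (j < k)%N -> moment mu j.+1 = l ^+ j.+1.
  by move=> jk; apply/eqP; apply: contraTT jk => /kmin; rewrite -leqNgt.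
have Ed := expansion_diff (Kf_has_expansion m1) (rotation_has_expansion l1) lt_k z2.
rewrite -/d in Ed.
have n0' := one_psi_neq0 m1 z1; have Az := one_psiV m1 z1.
have Kz : normc (Kf mu z) <= 2 by rewrite -half_inv normc_Kf// half_lt1.
have zl1 : normc (z * l) <= 1 / 2.
  by rewrite Normc.normcM; apply: le_trans z2; rewrite ler_piMr ?normc_ge0.
have zl : 1 - z * l != 0 by apply: sub1c_neq0; apply: le_lt_trans zl1 half_lt1.
rewrite hfunE//; set K := Kf mu z in Ed n0' Az Kz *.
set E := K - _ - _ in Ed.
rewrite (_ : K / _ - l - d * z ^+ k =
    - (d * z ^+ k * (z * ((l + K) * (1 + z * K)^-1))) +
    E * ((1 + z * K)^-1 * (1 - z * l))); last first.
  by rewrite /E; field; rewrite n0' zl.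
apply: le_trans (normcD _ _) _; rewrite normcN !Normc.normcM normcX exprS.
have b1 : normc (l + K) <= 3.
  by apply: le_trans (normcD _ _) _; rewrite (_ : 3 = 1 + 2)//; apply: lerD.
have b2 : normc (1 - z * l) <= 2.
  by apply: le_trans (normcB _ _) _; rewrite normc1; lra.
have b3 : normc (l + K) * normc (1 + z * K)^-1 <= 3 * 2 by apply: ler_pM; rewrite ?normc_ge0.
have b4 : normc (1 + z * K)^-1 * normc (1 - z * l) <= 2 * 2 by apply: ler_pM; rewrite ?normc_ge0.
have zk : 0 <= normc z * normc z ^+ k by rewrite mulr_ge0 ?exprn_ge0 ?normc_ge0.
rewrite exprS in Ed.
have -> : (6 * normc d + 16) * (normc z * normc z ^+ k) =
  normc d * normc z ^+ k * (normc z * (3 * 2)) + 4 * (normc z * normc z ^+ k) * (2 * 2).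
  by ring.
apply: lerD; last by apply: ler_pM; rewrite ?mulr_ge0 ?normc_ge0.
by rewrite ler_wpM2l ?mulr_ge0 ?exprn_ge0 ?normc_ge0// ler_wpM2l ?normc_ge0.
Qed.

Lemma moment_eq0 mu (rho : R) : onT mu -> 0 < rho ->
  (forall z, normc z <= rho -> normc z <= 1 / 2 -> hfun mu z = 0) ->
  forall n, moment mu n.+1 = 0.
Proof.
move=> m1 r0 H; apply: (expansion_uniq r0 (Kf_has_expansion m1) (G := fun=> 0)).
  move=> z k z2; rewrite big1; last by move=> i _; rewrite mul0r.
  by rewrite subrr normc0 mulr_ge0 ?exprn_ge0 ?normc_ge0.
move=> z zr z2; have z1 := le_lt_trans z2 half_lt1.
by rewrite KfE// H// mul0r.
Qed.
End Moments.

#[local] Arguments conjc : simpl never.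

(** * Roots of unity and their discrete orthogonality *)

Section RootsOfUnity.
Variable R : realType.
Local Notation C := R[i].

Definition cis (t : R) : C := (cos t +i* sin t)%C.

Lemma cisD s t : cis (s + t) = cis s * cis t.
Proof. by rewrite /cis cosD sinD; apply: complex_ext; rewrite /= // addrC. Qed.

Lemma cis0 : cis 0 = 1.
Proof. by rewrite /cis cos0 sin0. Qed.

Lemma normc_cis t : normc (cis t) = 1.
Proof. by rewrite /cis /= cos2Dsin2 sqrtr1. Qed.

Lemma cisX t n : cis t ^+ n = cis (n%:R * t).
Proof.
elim: n => [|n IH]; first by rewrite expr0 mul0r cis0.
by rewrite exprS IH -cisD -natr1; congr cis; ring.
Qed.

Lemma cis_arg (z : C) : normc z = 1 -> exists t, z = cis t.
Proof.
move=> z1; have := normc_sqr z; rewrite z1 expr1n; case: z z1 => a b _ /= ab.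
have a1 : -1 <= a <= 1 by apply/andP; split; nra.
have b2 : 1 - a ^+ 2 = b ^+ 2 by rewrite ab addrC addKr.
have [b0|b0] := leP 0 b.
  exists (acos a); rewrite /cis acosK; last by rewrite in_itv.
  by rewrite sin_acos// b2 sqrtr_sqr ger0_norm.
exists (- acos a); rewrite /cis cosN sinN acosK; last by rewrite in_itv.
by rewrite sin_acos// b2 sqrtr_sqr ltr0_norm// opprK.
Qed.

(** A primitive M-th root of unity, not the Haar measure of the statement. *)
Definition omega M : C := cis (pi *+ 2 / M%:R).

#[local] Arguments omega : simpl never.

Lemma normc_omega M : normc (omega M) = 1.
Proof. exact: normc_cis. Qed.

Lemma omegaX M : (0 < M)%N -> omega M ^+ M = 1.
Proof.
move=> M0; rewrite /omega cisX mulrC divfK ?pnatr_eq0 -?lt0n//.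
by rewrite /cis cos2pi sin2pi.
Qed.

(** If cos 2x = 1 then sin x = 0, which is impossible for x = k pi / M strictly between 0 and pi. *)
Lemma omegaX_neq1 M k : (0 < k < M)%N -> omega M ^+ k != 1.
Proof.
move=> /andP[k0 kM]; rewrite /omega cisX; apply/eqP => -[c1 _].
have Mp : 0 < M%:R :> R by rewrite ltr0n (leq_trans _ kM).
set x : R := k%:R * (pi / M%:R).
have xE : k%:R * (pi *+ 2 / M%:R) = x *+ 2 :> R by rewrite /x; ring.
have x0 : 0 < x < pi.
  have kR : k%:R < M%:R :> R by rewrite ltr_nat.
  apply/andP; split; first by rewrite /x mulr_gt0 ?ltr0n// divr_gt0 ?pi_gt0.
  rewrite /x mulrA ltr_pdivrMr// mulrC.
  by rewrite ltr_pM2l// pi_gt0.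
have := sin_gt0_pi x0; rewrite xE cos_mulr2n in c1.
move=> s0; have := sin2cos2 x.
have : cos x ^+ 2 = 1 by move: c1; lra.
by move=> ->; rewrite subrr => /eqP; rewrite sqrf_eq0 gt_eqF.
Qed.

Lemma sum_unity (x : C) M : x ^+ M = 1 -> x != 1 -> \sum_(l < M) x ^+ l = 0.
Proof.
move=> xM x1; have := subrX1 x M; rewrite xM subrr.
by move/esym/eqP; rewrite mulf_eq0 subr_eq0 (negPf x1) => /eqP.
Qed.

Lemma conjc_unit (x : C) : normc x = 1 -> x * conjc x = 1.
Proof. by move=> x1; rewrite mulc_conj x1 expr1n. Qed.

Lemma omega_orthogonal M j k : (j < M)%N -> (k < M)%N ->
  \sum_(l < M) (omega M ^+ l) ^+ j * conjc (omega M ^+ l) ^+ k =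
  if j == k then M%:R else 0.
Proof.
move=> jM kM; have M0 : (0 < M)%N by exact: leq_trans jM.
have wl l : omega M ^+ l * conjc (omega M ^+ l) = 1.
  by apply: conjc_unit; rewrite normcX normc_omega expr1n.
have diff a b : (b < a < M)%N ->
    \sum_(l < M) (omega M ^+ l) ^+ a * conjc (omega M ^+ l) ^+ b = 0.
  move=> /andP[ba aM].
  rewrite -[RHS](sum_unity (x := omega M ^+ (a - b)) (M := M)).
  - apply: eq_bigr => l _; rewrite -{1}(subnK (ltnW ba)) exprD -mulrA -exprMn wl.
    by rewrite expr1n mulr1 -!exprM mulnC.
  - by rewrite -exprM mulnC exprM omegaX// expr1n.
  - by apply: omegaX_neq1; rewrite subn_gt0 ba/= (leq_ltn_trans (leq_subr _ _)).
have [jk|kj|->] := ltngtP j k.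
- rewrite -[LHS]conjcK rmorph_sum /= -[RHS](conjc0 R); congr conjc.
  rewrite -[RHS](diff k j); last by rewrite jk.
  by apply: eq_bigr => l _; rewrite rmorphM !rmorphXn /= conjcK mulrC.
- by apply: diff; rewrite kj.
- under eq_bigr do rewrite -exprMn wl expr1n.
  by rewrite sumr_const card_ord.
Qed.
End RootsOfUnity.

(** * Moments determine integrals of continuous functions on the circle *)

Section CosineKernel.
Variable R : realType.
Local Notation C := R[i].
Implicit Types (mu nu : PM R).

(** With theta the angle between zeta and xi this is ((1 + cos theta)/2)^n, that is
    cos(theta/2)^(2n): the unnormalized de la Vallee-Poussin kernel. *)
Definition ckernel n (p : R * R) (xi : C) : R := (1 - normc (zeta p - xi) ^+ 2 / 4) ^+ n.

Lemma ckernelE n p (xi : C) : circle R p -> normc xi = 1 ->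
  ((ckernel n p xi)%:C)%C = (4 ^+ n)^-1 * \sum_(j < n.*2.+1)
    'C(n.*2, j)%:R * ((zeta p * conjc xi) ^+ j * conjc (zeta p * conjc xi) ^+ n).
Proof.
move=> pc x1; set t := zeta p * conjc xi.
have t1 : t * conjc t = 1.
  by apply: conjc_unit; rewrite Normc.normcM normc_conj x1 normc_zeta// mulr1.
have -> : \sum_(j < n.*2.+1) 'C(n.*2, j)%:R * (t ^+ j * conjc t ^+ n) =
    (1 + t) ^+ n.*2 * conjc t ^+ n.
  rewrite exprDn mulr_suml; apply: eq_bigr => j _.
  by rewrite expr1n mul1r mulr_natl mulrnAl.
rewrite -muln2 mulnC exprM -exprMn -exprVn -exprMn /ckernel rmorphXn /=; congr (_ ^+ n).
have E : ((normc (zeta p - xi) ^+ 2)%:C)%C = 2 - t - conjc t.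
  rewrite -mulc_conj rmorphB /= mulrBl !mulrBr (conjc_unit x1).
  rewrite conjc_unit ?normc_zeta// /t rmorphM /= conjcK; ring.
rewrite rmorphB rmorph1 rmorphM /= E fmorphV rmorph_nat.
have -> : (1 + t) ^+ 2 * conjc t = conjc t + 2 * (t * conjc t) + t * (t * conjc t) by ring.
by rewrite t1; field.
Qed.

Lemma ckernel_ge0 n p (xi : C) : circle R p -> normc xi = 1 -> 0 <= ckernel n p xi.
Proof.
move=> pc x1; rewrite exprn_ge0//.
have : normc (zeta p - xi) <= 2.
  by apply: le_trans (normcB _ _) _; rewrite normc_zeta// x1.
by have := normc_ge0 (zeta p - xi); nra.
Qed.

(** The kernel is a trigonometric polynomial with frequencies from -n to n. Summing over 2n + 1
    equidistant nodes kills every frequency but 0, so the sum does not depend on the point. *)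
Lemma ckernel_sum n p : circle R p ->
  ((\sum_(l < n.*2.+1) ckernel n p (omega R n.*2.+1 ^+ l))%:C)%C =
  (4 ^+ n)^-1 * ('C(n.*2, n)%:R * (n.*2.+1)%:R).
Proof.
move=> pc; set M := n.*2.+1; set w := omega R M.
have w1 l : normc (w ^+ l) = 1 by rewrite normcX normc_omega expr1n.
rewrite rmorph_sum /=; under eq_bigr do rewrite ckernelE//.
rewrite -mulr_sumr exchange_big /=; congr (_ * _).
have nM : (n < M)%N by rewrite ltnS -addnn leq_addr.
have term (j : 'I_M) : \sum_(l < M) 'C(n.*2, j)%:R *
    ((zeta p * conjc (w ^+ l)) ^+ j * conjc (zeta p * conjc (w ^+ l)) ^+ n) =
    'C(n.*2, j)%:R * (zeta p ^+ j * conjc (zeta p) ^+ n * (if n == j then M%:R else 0)).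
  rewrite -(omega_orthogonal R nM (ltn_ord j)) !mulr_sumr; apply: eq_bigr => l _.
  by rewrite rmorphM /= conjcK !exprMn; ring.
rewrite (eq_bigr _ (fun j _ => term j)) (bigD1 (Ordinal nM)) //= eqxx.
rewrite big1 ?addr0; last first.
  by move=> j jn; rewrite ifN ?mulr0// eq_sym.
by rewrite -exprMn conjc_unit ?normc_zeta// expr1n mul1r.
Qed.

(** The constant sum, evaluated at the point 1, where the node 1 contributes exactly 1; this makes
    it real and at least 1. *)
Definition ckernel_mass n : R := \sum_(l < n.*2.+1) ckernel n (1, 0) (omega R n.*2.+1 ^+ l).

Lemma circle10 : circle R (1, 0).
Proof. by rewrite /circle /= expr1n expr0n addr0. Qed.

Lemma ckernel_massE n p : circle R p ->
  \sum_(l < n.*2.+1) ckernel n p (omega R n.*2.+1 ^+ l) = ckernel_mass n.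
Proof.
move=> pc; apply: (@complexI R); rewrite ckernel_sum// /ckernel_mass ckernel_sum//.
exact: circle10.
Qed.

Lemma ckernel_mass_ge1 n : 1 <= ckernel_mass n.
Proof.
have E : ckernel n (1, 0) (1 : C) = 1.
  have -> : ckernel n (1, 0) (1 : C) = (1 - normc (0 : C) ^+ 2 / 4) ^+ n.
    by rewrite -(subrr (1 : C)).
  by rewrite normc0 expr0n mul0r subr0 expr1n.
rewrite /ckernel_mass big_ord_recl expr0 E lerDl; apply: sumr_ge0 => l _.
by apply: ckernel_ge0; [exact: circle10|rewrite normcX normc_omega expr1n].
Qed.

Lemma tcont_ckernel n (xi : C) : normc xi = 1 -> tcont (fun p => ckernel n p xi).
Proof.
move=> x1; have c : ccont (fun p => ((ckernel n p xi)%:C)%C).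
  apply: eq_ccont (fun p pc => esym (ckernelE n pc x1)) _.
  apply: ccontM (ccont_cst _) _; apply: ccont_sum => j.
  have ct : ccont (fun p => zeta p * conjc xi) := ccontM (ccont_zeta _) (ccont_cst _).
  exact: ccontM (ccont_cst _) (ccontM (ccontX _ ct) (ccontX _ (ccont_conj ct))).
by have [] := c.
Qed.

Arguments tcont_ckernel n {xi} _.

(** On the circle conjugation is inversion, so mixed moments reduce to moments or their
    conjugates. *)
Lemma mixed_moment mu nu j k : (forall n, moment mu n = moment nu n) ->
  cint mu (fun p => zeta p ^+ j * conjc (zeta p) ^+ k) =
  cint nu (fun p => zeta p ^+ j * conjc (zeta p) ^+ k).
Proof.
move=> H.
have [jk|kj] := leqP j k.
  have E m : cint m (fun p => zeta p ^+ j * conjc (zeta p) ^+ k) = conjc (moment m (k - j)).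
    rewrite /moment -cint_conj; last exact: ccontX (ccont_zeta _).
    apply: eq_cint => p pc; rewrite -{1}(subnKC jk) exprD mulrA -exprMn.
    by rewrite conjc_unit ?normc_zeta// expr1n mul1r rmorphXn.
  by rewrite !E H.
have E m : cint m (fun p => zeta p ^+ j * conjc (zeta p) ^+ k) = moment m (j - k).
  apply: eq_cint => p pc; rewrite -{1}(subnK (ltnW kj)) exprD -mulrA -exprMn.
  by rewrite conjc_unit ?normc_zeta// expr1n mulr1.
by rewrite !E H.
Qed.

Lemma tint_ckernel mu nu n (xi : C) : normc xi = 1 ->
  (forall n, moment mu n = moment nu n) ->
  tint mu (fun p => ckernel n p xi) = tint nu (fun p => ckernel n p xi).
Proof.
move=> x1 H.
suff E : cint mu (fun p => ((ckernel n p xi)%:C)%C) = cint nu (fun p => ((ckernel n p xi)%:C)%C).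
  by move/(congr1 (@complex.Re R)) : E.
have cz j k : ccont (fun p => zeta p ^+ j * conjc (zeta p) ^+ k).
  exact: ccontM (ccontX _ (ccont_zeta _)) (ccontX _ (ccont_conj (ccont_zeta _))).
have ct j : ccont (fun p => (4 ^+ n)^-1 * ('C(n.*2, j)%:R * (conjc xi ^+ j * xi ^+ n)) *
    (zeta p ^+ j * conjc (zeta p) ^+ n)) by apply: ccontM; [exact: ccont_cst|exact: cz].
have E m : cint m (fun p => ((ckernel n p xi)%:C)%C) =
    \sum_(j < n.*2.+1) (4 ^+ n)^-1 * ('C(n.*2, j)%:R * (conjc xi ^+ j * xi ^+ n)) *
      cint m (fun p => zeta p ^+ j * conjc (zeta p) ^+ n).
  under eq_bigr do rewrite -cintZ//.
  rewrite -cint_sum//; apply: eq_cint => p pc; rewrite ckernelE// mulr_sumr.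
  by apply: eq_bigr => j _; rewrite rmorphM /= conjcK !exprMn; ring.
by rewrite !E; apply: eq_bigr => j _; rewrite (mixed_moment _ _ H).
Qed.

Definition ptc (z : C) : R * R := (complex.Re z, complex.Im z).

Lemma ptc_circle (z : C) : normc z = 1 -> circle R (ptc z).
Proof. by move=> z1; rewrite /circle /= -normc_sqr z1 expr1n. Qed.

Lemma zeta_ptc (z : C) : zeta (ptc z) = z.
Proof. by case: z. Qed.

Lemma zeta_ball p (z : C) (d : R) : normc (zeta p - z) < d -> ball p d (ptc z).
Proof.
move=> h; split; rewrite /= /ball /=.
  by apply: le_lt_trans h; have := le_Re_normc (zeta p - z); rewrite ReD ReN.
by apply: le_lt_trans h; have := le_Im_normc (zeta p - z); rewrite ImD ImN.
Qed.

(* Positive kernels with exact total mass along the roots of unity: a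
   discrete version of the de la Vallee-Poussin approximation. *)
Lemma ckernel_approx (f : R * R -> R) (e : R) : tcont f -> 0 < e ->
  exists (B s : R), [/\ 0 <= s < 1, 0 <= B & forall n p, circle R p ->
    `|f p - (ckernel_mass n)^-1 * \sum_(l < n.*2.+1)
       f (ptc (omega R n.*2.+1 ^+ l)) * ckernel n p (omega R n.*2.+1 ^+ l)| <= e + B * s ^+ n].
Proof.
move=> cf e0; have [B0 HB] := tcont_bounded cf.
have B0p : 0 <= B0 by apply: le_trans (HB _ circle10).
have [d0 d0p Hd] := unif_continuous_within (@compact_circle R) cf e0.
pose d := Num.min d0 1; have dp : 0 < d by rewrite lt_min d0p ltr01.
have d1 : d <= 1 by rewrite ge_min lexx orbT.
pose y := d ^+ 2 / 4; have yp : 0 < y by rewrite divr_gt0// exprn_gt0.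
have y1 : y <= 1 / 4 by rewrite /y; nra.
(* Nodes farther than d contribute at most (1 - y)^n each, and there are 2n + 1 of them. Since (1 -
   y)^n <= (1 - y/2)^(2n), one factor (1 - y/2)^n is spent, through Bernoulli, on the bound 2n + 1
   <= (4/y + 1)(1 + n y/2); the other is the remaining decay. *)
exists (2 * B0 * (4 / y + 1)), (1 - y / 2); split.
- by apply/andP; split; lra.
- by rewrite !mulr_ge0// addr_ge0// divr_ge0// ltW.
move=> n p pc; set M := n.*2.+1; set w := omega R M.
have w1 l : normc (w ^+ l) = 1 by rewrite normcX normc_omega expr1n.
set c := ckernel_mass n; have c1 : 1 <= c := ckernel_mass_ge1 n.
have cp : 0 < c by lra.
have -> : f p - c^-1 * \sum_(l < M) f (ptc (w ^+ l)) * ckernel n p (w ^+ l) =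
    c^-1 * \sum_(l < M) (f p - f (ptc (w ^+ l))) * ckernel n p (w ^+ l).
  under [in RHS]eq_bigr do rewrite mulrBl.
  by rewrite sumrB -mulr_sumr ckernel_massE// mulrBr mulrCA mulVf ?gt_eqF// mulr1.
have cV0 : 0 <= c^-1 by rewrite invr_ge0 ltW.
rewrite normrM (ger0_norm cV0) ler_pdivrMl//.
apply: le_trans (ler_norm_sum _ _ _) _.
have term (l : 'I_M) : `|(f p - f (ptc (w ^+ l))) * ckernel n p (w ^+ l)| <=
    e * ckernel n p (w ^+ l) + 2 * B0 * (1 - y) ^+ n.
  rewrite normrM [X in _ * X]ger0_norm; last exact: ckernel_ge0.
  have k0 := ckernel_ge0 n pc (w1 l).
  have y0 : 0 <= (1 - y) ^+ n by rewrite exprn_ge0//; lra.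
  have [near|far] := ltP (normc (zeta p - w ^+ l)) d.
    have h : `|f p - f (ptc (w ^+ l))| < e.
      apply: Hd => //; first exact: ptc_circle.
      by apply: zeta_ball; apply: lt_le_trans near _; rewrite ge_min lexx.
    apply: le_trans (ler_wpM2r k0 (ltW h)) _.
    by rewrite lerDl !mulr_ge0.
  have h : `|f p - f (ptc (w ^+ l))| <= 2 * B0.
    apply: le_trans (ler_normB _ _) _; rewrite mulr_natl mulr2n.
    by apply: lerD; apply: HB => //; exact: ptc_circle.
  have hk : ckernel n p (w ^+ l) <= (1 - y) ^+ n.
    apply: lerXn2r; rewrite ?nnegrE; try lra.
      have : normc (zeta p - w ^+ l) <= 2.
        by apply: le_trans (normcB _ _) _; rewrite normc_zeta// w1.
      by have := normc_ge0 (zeta p - w ^+ l); nra.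
    by rewrite lerD2l lerN2 /y ler_pM2r ?invr_gt0// lerXn2r ?nnegrE ?normc_ge0// ltW.
  apply: le_trans (ler_pM _ k0 h hk) _ => //.
  by rewrite lerDr mulr_ge0// ltW.
apply: le_trans (ler_sum _ (fun l _ => term l)) _.
rewrite big_split /= -mulr_sumr ckernel_massE// sumr_const card_ord -/c mulrDr.
rewrite [c * e]mulrC lerD2l.
have bern (x : R) k : 0 <= x -> 1 + k%:R * x <= (1 + x) ^+ k.
  move=> x0; elim: k => [|k IH]; first by rewrite mul0r addr0 expr0.
  rewrite exprS -natr1; have := ler_wpM2l (addr_ge0 ler01 x0) IH.
  have : 0 <= k%:R * x * x by rewrite !mulr_ge0 ?ler0n.
  by nra.
have s0 : 0 <= 1 - y / 2 by lra.
have key : M%:R * (1 - y) ^+ n <= (4 / y + 1) * (1 - y / 2) ^+ n.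
  have q : (1 - y) ^+ n <= (1 - y / 2) ^+ n * (1 - y / 2) ^+ n.
    by rewrite -exprMn; apply: lerXn2r; rewrite ?nnegrE; nra.
  have b1 : (1 + n%:R * (y / 2)) * (1 - y / 2) ^+ n <= 1.
    have y20 : 0 <= y / 2 by lra.
    apply: le_trans (ler_wpM2r (exprn_ge0 n s0) (bern _ n y20)) _.
    by rewrite -exprMn exprn_ile1//; nra.
  have b2 : M%:R <= (4 / y + 1) * (1 + n%:R * (y / 2)).
    rewrite /M -addn1 -muln2 natrD natrM.
    have -> : (4 / y + 1) * (1 + n%:R * (y / 2)) = n%:R * 2 + 1 + 4 / y + n%:R * (y / 2).
      by field; rewrite gt_eqF.
    by rewrite -addrA lerDl addr_ge0// ?divr_ge0 ?mulr_ge0 ?ler0n ?ltW// divr_gt0.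
  have sn := exprn_ge0 n s0.
  apply: le_trans (ler_wpM2l (ler0n _ _) q) _.
  apply: le_trans (ler_wpM2r (mulr_ge0 sn sn) b2) _.
  have [P PE] : exists P, P = 4 / y + 1 by exists (4 / y + 1).
  have P0 : 0 <= P by rewrite PE addr_ge0// divr_ge0// ltW.
  rewrite -PE (_ : P * _ * _ = P * ((1 - y / 2) ^+ n *
    ((1 + n%:R * (y / 2)) * (1 - y / 2) ^+ n))); last by ring.
  by rewrite ler_wpM2l// ler_piMr.
rewrite -[X in X <= _]mulr_natl mulrCA.
apply: (@le_trans _ _ (2 * B0 * ((4 / y + 1) * (1 - y / 2) ^+ n))).
  by rewrite ler_wpM2l ?mulr_ge0.
rewrite [2 * B0 * (_ * _)]mulrA ler_peMl//.
by rewrite !mulr_ge0 ?exprn_ge0// addr_ge0// divr_ge0// ltW.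
Qed.

(** Both integrals of f are within e/2 + B s^n of the integral of its kernel approximation, which
    moments determine. Letting n grow and then e shrink gives equality. *)
Lemma tint_uniq mu nu f : onT mu -> onT nu -> (forall n, moment mu n = moment nu n) ->
  tcont f -> tint mu f = tint nu f.
Proof.
move=> m1 n1 H cf; apply/eqP; rewrite -subr_eq0 -normr_le0.
apply/ler_addgt0Pl => e e0; rewrite addr0.
have e2 : 0 < e / 2 by rewrite divr_gt0.
have [B [s [s01 B0 HB]]] := ckernel_approx cf e2.
rewrite -subr_le0; apply: (@geometric_le0 _ _ (2 * B) s s01) => n.
pose fn p := (ckernel_mass n)^-1 * \sum_(l < n.*2.+1)
       f (ptc (omega R n.*2.+1 ^+ l)) * ckernel n p (omega R n.*2.+1 ^+ l).
have w1 l : normc (omega R n.*2.+1 ^+ l) = 1 by rewrite normcX normc_omega expr1n.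
have ck l : tcont (fun p => f (ptc (omega R n.*2.+1 ^+ l)) * ckernel n p (omega R n.*2.+1 ^+ l)).
  exact: (tcontM (tcont_cst _) (tcont_ckernel n (w1 l))).
have csum (s' : seq 'I_n.*2.+1) : tcont (fun p => \sum_(l <- s')
       f (ptc (omega R n.*2.+1 ^+ l)) * ckernel n p (omega R n.*2.+1 ^+ l)) /\
    forall m, tint m (fun p => \sum_(l <- s')
       f (ptc (omega R n.*2.+1 ^+ l)) * ckernel n p (omega R n.*2.+1 ^+ l)) =
     \sum_(l <- s') f (ptc (omega R n.*2.+1 ^+ l)) * tint m (fun p => ckernel n p (omega R n.*2.+1 ^+ l)).
  elim: s' => [|l s' [c IH]].
    split=> [|m]; first by apply: eq_tcont (tcont_cst 0) => p _; rewrite big_nil.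
    rewrite big_nil; transitivity (tint m (fun _ => 0 * 0)).
      by apply: eq_tint => p _; rewrite big_nil mul0r.
    by rewrite (tintZ m 0 (tcont_cst 0)) mul0r.
  split=> [|m]; first by apply: eq_tcont (tcontD (ck l) c) => p _; rewrite big_cons.
  rewrite big_cons -IH -(tintZ m _ (tcont_ckernel n (w1 l))) -tintD//.
  by apply: eq_tint => p _; rewrite big_cons.
have [cs Es] := csum (index_enum _).
have cfn : tcont fn := tcontM (tcont_cst _) cs.
have Efn : tint mu fn = tint nu fn.
  rewrite /fn !(tintZ _ _ cs) !Es; congr (_ * _); apply: eq_bigr => l _.
  by rewrite (tint_ckernel _ (w1 l) H).
have close m : onT m -> `|tint m f - tint m fn| <= e / 2 + B * s ^+ n.
  move=> t1; rewrite -tintB//; apply: le_trans (tint_norm _ (tcontB cf cfn)) _.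
  rewrite -(tint_cst (e / 2 + B * s ^+ n) t1); apply: le_tint.
  - exact: (tcont_norm (tcontB cf cfn)).
  - exact: tcont_cst.
  - by move=> p pc; exact: HB.
have := close _ m1; have := close _ n1; rewrite Efn.
set a := tint mu f; set b := tint nu f; set c := tint nu fn.
have : `|a - b| <= `|a - c| + `|b - c|.
  by rewrite [`|b - c|]distrC; apply: le_trans (ler_normD _ _); rewrite addrA subrK.
lra.
Qed.
End CosineKernel.

(** * Integrals of continuous functions determine the measure *)

Section MeasureUniqueness.
Variable R : realType.
Local Notation C := R[i].
Implicit Types (mu nu : PM R).

(** Chosen to be stable under intersection and suited to dominated convergence: products of such
    sets form a pi-system whose measures are limits of integrals of continuous functions. *)
Definition approximable (A : set R) := measurable A /\
  exists phi : nat -> R -> R, [/\ forall k, continuous (phi k),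
    forall k x, 0 <= phi k x <= 1 & forall x, phi k x @[k --> \oo] --> (\1_A x : R)].

Lemma approximableT : approximable setT.
Proof.
split; first exact: measurableT.
exists (fun _ _ => 1); split => [k x|k x|x].
- exact: cst_continuous.
- by rewrite ler01 lexx.
- by rewrite indicE in_setT; exact: cvg_cst.
Qed.

(** With q twice the positive part of x - a, the function 1 - 1/(1 + k q) is 0 for x <= a and tends
    to 1 for x > a. *)
Lemma approximable_ray (a : R) : approximable `]a, +oo[.
Proof.
split; first exact: measurable_itv.
have cc (c : R) : continuous (fun _ : R => c) by move=> x; exact: cst_continuous.
pose q (x : R) := x - a + `|x - a|.
have q0 x : 0 <= q x.
  by rewrite /q; have := ler_norm (- (x - a)); rewrite normrN; lra.
have cq : continuous q.
  have c1 : continuous (fun x : R => x - a).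
    by move=> x; apply: continuousB; [move=> ?|exact: cst_continuous].
  have c2 : continuous (fun x : R => `|x - a|) by move=> x; exact: (cvg_norm (c1 x)).
  by move=> x; exact: (continuousD (c1 x) (c2 x)).
have pos k x : 1 <= 1 + k%:R * q x by rewrite lerDl mulr_ge0 ?ler0n.
exists (fun k x => 1 - (1 + k%:R * q x)^-1); split => [k|k x|x].
- have c3 : continuous (fun x => 1 + k%:R * q x).
    by move=> x; exact: (continuousD (cc 1 x) (continuousM (cc k%:R x) (cq x))).
  have c4 : continuous (fun x => (1 + k%:R * q x)^-1).
    by move=> x; apply: continuousV (c3 x); rewrite gt_eqF// (lt_le_trans ltr01).
  by move=> x; exact: (continuousB (cc 1 x) (c4 x)).
- have p := pos k x; have h : 0 <= (1 + k%:R * q x)^-1 <= 1.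
    rewrite invr_ge0 (le_trans ler01 p)/=.
    by rewrite invf_le1// (lt_le_trans ltr01).
  by apply/andP; split; lra.
have [xa|ax] := leP x a.
  have -> : \1_(`]a, +oo[%classic) x = 0 :> R.
    by rewrite indicE memNset//= in_itv/= andbT; apply/negP; rewrite -leNgt.
  have -> : q x = 0 by rewrite /q ler0_norm; lra.
  by under eq_fun do rewrite mulr0 addr0 invr1 subrr; exact: cvg_cst.
have -> : \1_(`]a, +oo[%classic) x = 1 :> R.
  by rewrite indicE mem_set//= in_itv/= ax.
have qp : 0 < q x by rewrite /q gtr0_norm; lra.
apply/cvgrPdist_lt => e e0; near=> k.
rewrite opprB addrCA subrr addr0 ger0_norm; last by rewrite invr_ge0 (le_trans ler01).
rewrite invf_plt ?posrE// ?(lt_le_trans ltr01)//.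
have : e^-1 / q x < k%:R by near: k; exact: nbhs_infty_gtr.
by rewrite ltr_pdivrMr// => h; apply: lt_le_trans h _; rewrite lerDr.
Unshelve. all: by end_near. Qed.

Lemma approximableI A B : approximable A -> approximable B -> approximable (A `&` B).
Proof.
move=> [mA [f [cf f01 fA]]] [mB [g [cg g01 gB]]]; split; first exact: measurableI.
exists (fun k x => f k x * g k x); split => [k x|k x|x].
- by apply: continuousM; [exact: cf|exact: cg].
- have /andP[? ?] := f01 k x; have /andP[? ?] := g01 k x.
  by rewrite mulr_ge0//= mulr_ile1.
- by rewrite indicI; exact: cvgM (fA x) (gB x).
Qed.

Definition rectangles : set (set (R * R)) :=
  [set A `*` B | A in approximable & B in approximable].

Lemma rectangles_generate :
  @measurable _ (R * R)%type = <<s rectangles >>.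
Proof.
apply/seteqP; split; last first.
  apply: smallest_sub; first exact: sigma_algebra_measurable.
  by move=> _ [A [mA _] [B [mB _] <-]]; exact: measurableX.
apply: smallest_sub; first exact: smallest_sigma_algebra.
have key (f : R * R -> R) : (forall a, <<s rectangles >> (f @^-1` `]a, +oo[)) ->
    preimage_set_system setT f (@measurable _ R) `<=` <<s rectangles >>.
  move=> H; have -> : @measurable _ R = (@RGenOInfty.G R).-sigma.-measurable.
    exact: RGenOInfty.measurableE.
  rewrite -g_sigma_preimageE; apply: smallest_sub; first exact: smallest_sigma_algebra.
  by move=> _ [_ [a ->] <-]; rewrite setTI; exact: H.
rewrite subUset; split; apply: key => a; apply: sub_sigma_algebra.
  exists `]a, +oo[%classic; first exact: approximable_ray.
  exists setT; first exact: approximableT.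
  by apply/seteqP; split => [[x y] []|[x y]] //=.
exists setT; first exact: approximableT.
exists `]a, +oo[%classic; first exact: approximable_ray.
by apply/seteqP; split => [[x y] []|[x y]] //=.
Qed.

Lemma onT_setI mu A : onT mu -> measurable A -> mu (circle R `&` A) = mu A.
Proof.
move=> m1 mA; rewrite [RHS](_ : _ = mu ((circle R `&` A) `|` (~` circle R `&` A))); last first.
  by rewrite -setIUl setUv setTI.
have mC : measurable (~` circle R) by apply: measurableC; exact: measurable_circle.
rewrite measureU.
- rewrite [X in (_ + X)%E](_ : _ = 0%E) ?adde0//.
  apply/eqP; rewrite eq_le measure_ge0 andbT.
  apply: (@le_trans _ _ (mu (~` circle R))).
    by apply: le_measure; rewrite ?inE//; exact: measurableI.
  rewrite probability_setC; last exact: measurable_circle.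
  by rewrite [X in (_ - X)%E]m1 (@subee R).
- by apply: measurableI => //; exact: measurable_circle.
- exact: measurableI.
- by apply/seteqP; split => // p [[pc _] [pn _]].
Qed.

Lemma meq_tint mu nu : onT mu -> onT nu ->
  (forall f, tcont f -> tint mu f = tint nu f) -> meq mu nu.
Proof.
move=> m1 n1 H; apply: (measure_unique rectangles (fun=> setT)) => //.
- exact: rectangles_generate.
- move=> _ _ [A aA [B aB <-]] [A' aA' [B' aB' <-]].
  exists (A `&` A'); first exact: approximableI.
  exists (B `&` B'); first exact: approximableI.
  by rewrite setXI.
- move=> _; exists setT; first exact: approximableT.
  by exists setT; [exact: approximableT|rewrite setXTT].
- by rewrite bigcup_const.
- move=> _ [A [mA [f [cf f01 fA]]] [B [mB [g [cg g01 gB]]] <-]].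
  have mAB : measurable (A `*` B) by exact: measurableX.
  have cfg k : tcont (fun p => f k p.1 * g k p.2).
    apply: (tcontM (f1 := fun p => f k p.1) (f2 := fun p => g k p.2)).
      exact: (tcont_comp (cf k) (@tcont_fst R)).
    exact: (tcont_comp (cg k) (@tcont_snd R)).
  have lim (m : PM R) : onT m ->
      (tint m (fun p => f k p.1 * g k p.2))%:E @[k --> \oo] --> m (A `*` B).
    move=> t1; rewrite -(onT_setI t1 mAB) setIC -integral_indic//;
      last exact: measurable_circle.
    have := @dominated_cvg _ _ _ m (circle R) (@measurable_circle R)
      (fun k p => (f k p.1 * g k p.2)%:E) (fun p => (\1_(A `*` B) p)%:E) (fun=> 1%E).
    have fin k : (tint m (fun p => f k p.1 * g k p.2))%:E =
        (\int[m]_(p in circle R) (f k p.1 * g k p.2)%:E)%E.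
      rewrite fineK//; apply: (@integrable_fin_num _ _ _ m); first exact: measurable_circle.
      exact: tint_integrable.
    have -> : (fun k => (tint m (fun p => f k p.1 * g k p.2))%:E) =
        (fun k => (\int[m]_(p in circle R) (f k p.1 * g k p.2)%:E)%E) by exact/funext.
    apply.
    + by move=> k; apply/measurable_EFinP; exact: measurable_tcont.
    + move=> p pc; apply: cvg_EFin; first by apply: nearW.
      rewrite /comp/= (_ : \1_(A `*` B) p = \1_A p.1 * \1_B p.2).
        exact: cvgM (fA _) (gB _).
      by rewrite !indicE in_setX; case: (_ \in A); case: (_ \in B); rewrite /= ?mulr1 ?mulr0.
    + by move=> p _.
    + exact: (tint_integrable m (tcont_cst 1)).
    + move=> k p pc; rewrite /= lee_fin ger0_norm; last first.
        by have /andP[? _] := f01 k p.1; have /andP[? _] := g01 k p.2; exact: mulr_ge0.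
      by have /andP[? ?] := f01 k p.1; have /andP[? ?] := g01 k p.2; exact: mulr_ile1.
  have l1 := lim mu m1; have l2 := lim nu n1.
  have E : (fun k => (tint mu (fun p => f k p.1 * g k p.2))%:E) =
           (fun k => (tint nu (fun p => f k p.1 * g k p.2))%:E).
    by apply/funext => k; rewrite H.
  rewrite E in l1; exact: (cvg_unique _ l1 l2).
- by move=> _; rewrite (le_lt_trans (probability_le1 _ _))// ltry.
Qed.
End MeasureUniqueness.

(** * Ultrafilter limits and Stieltjes sums *)

Section WeakCompactness.
Variable R : realType.
Local Notation C := R[i].

(** One ultrafilter makes all bounded sequences converge at once, so distribution functions have
    limits at every point without extracting subsequences. *)
Lemma ultra_bounded_cvg (U : set_system nat) (FU : UltraFilter U) (u : nat -> R) (M : R) :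
  (forall n, `|u n| <= M) -> exists l : R, u @ U --> l.
Proof.
move=> uM; have PU : ProperFilter U := @ultra_proper _ _ FU.
have cK := @segment_compact R (- M) M.
have uK : (u @ U) `[- M, M]%classic.
  by apply: (@filterS _ U _ setT) => [n _|]; [rewrite /= in_itv/= -ler_norml uM|exact: filterT].
have [l [_ cl]] := cK _ (fmap_proper_filter u PU) uK.
exists l; apply/cvgrPdist_lt => e e0.
have [//|h] := in_ultra_setVsetC [set n | `|l - u n| < e] FU.
have bl : nbhs l (ball l e) by exact: nbhsx_ballx.
by have [x [/= hx /hx]] := cl (~` ball l e) _ h bl.
Qed.

(** Error of a Stieltjes sum along an increasing chain of sets. It is applied to arcs of the circle
    and to level intervals of the uniform law, so that integrals on different spaces are compared
    through sums in the distribution function alone. *)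
Lemma staircase_integral d (T : measurableType d) (P : probability T R) (f : T -> R)
    (A : nat -> set T) (c : nat -> R) (w : R) n :
  (forall l, measurable (A l)) -> (forall l, A l `<=` A l.+1) -> P (A 0%N) = 0%E ->
  P.-integrable (A n) (EFin \o f) ->
  (forall l x, (l < n)%N -> A l.+1 x -> ~ A l x -> `|f x - c l| <= w) ->
  `|\int[P]_(x in A n) f x - \sum_(l < n) c l * (fine (P (A l.+1)) - fine (P (A l)))|
    <= w * fine (P (A n)).
Proof.
move=> mA ndA A0; elim: n => [|n IH] fint fc.
  rewrite big_ord0 subr0 A0 /= mulr0.
  rewrite /Rintegral null_set_integral//; first by rewrite fine0 normr0.
  exact: (measurable_int P fint).
have fintn : P.-integrable (A n) (EFin \o f) by apply: integrableS fint.
have {}IH := IH fintn (fun l x ln => fc l x (ltnW ln)).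
have mB : measurable (A n.+1 `\` A n) by exact: measurableD.
have fintB : P.-integrable (A n.+1 `\` A n) (EFin \o f).
  by apply: integrableS fint => //; exact: subDsetl.
have AE : A n.+1 = A n `|` (A n.+1 `\` A n) by rewrite setDUK.
have PB : fine (P (A n.+1 `\` A n)) = fine (P (A n.+1)) - fine (P (A n)).
  rewrite {2}AE measureU//; last by rewrite setDIK.
  rewrite fineD ?fin_num_measure//; by rewrite addrC addKr.
have IE : \int[P]_(x in A n.+1) f x =
    \int[P]_(x in A n) f x + \int[P]_(x in A n.+1 `\` A n) f x.
  rewrite {1}AE Rintegral_setU//; first by rewrite -AE.
  by apply/disj_setPS; rewrite setDIK.
have cint' : P.-integrable (A n.+1 `\` A n) (EFin \o (fun=> c n)).
  exact: finite_measure_integrable_cst.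
have step : `|\int[P]_(x in A n.+1 `\` A n) f x - c n * fine (P (A n.+1 `\` A n))| <=
    w * fine (P (A n.+1 `\` A n)).
  rewrite -(Rintegral_cst P mB) -RintegralB//.
  apply: le_trans (le_normr_Rintegral _ _) _ => //.
    exact: (integrableB mB fintB cint').
  rewrite -(Rintegral_cst P mB); apply: le_Rintegral => //.
  - by have := integrable_abse (integrableB mB fintB cint'); apply: eq_integrable.
  - exact: finite_measure_integrable_cst.
  - by move=> x [x1 x2]; exact: fc.
rewrite big_ord_recr /= IE -PB.
have -> : forall a b s t : R, a + b - (s + t) = (a - s) + (b - t) by move=> *; ring.
apply: le_trans (ler_normD _ _) _; apply: le_trans (lerD IH step) _.
by rewrite -mulrDr PB addrC subrK.
Qed.
End WeakCompactness.

(** * Weak compactness of the probability measures on the circle *)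

Section WeakCompactnessCircle.
Variable R : realType.
Local Notation C := R[i].

Let L01 : {measure set (measurableTypeR R) -> \bar R} :=
  mrestr (@lebesgue_measure R) (measurable_itv `[0, 1[).

Definition unif01 : probability (measurableTypeR R) R := mnormalize L01 point.

Lemma unif01E (A : set R) : unif01 A = lebesgue_measure (A `&` `[0, 1[).
Proof.
rewrite /unif01 /= /mnormalize /L01 /= /mrestr setTI lebesgue_measure_itv /= lte_fin ltr01.
rewrite oppr0 adde0 /= onee_eq0 /= invr1.
by rewrite mule1.
Qed.

Lemma unif01_itv (a : R) : 0 <= a <= 1 -> unif01 `]-oo, a[%classic = a%:E.
Proof.
move=> /andP[a0 a1]; rewrite unif01E (_ : _ `&` _ = `[0, a[%classic); last first.
  apply/seteqP; split => x /=; rewrite !in_itv/=.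
    by move=> [xa /andP[x0 _]]; rewrite x0.
  by move=> /andP[x0 xa]; rewrite xa x0 (lt_le_trans xa a1).
rewrite lebesgue_measure_itv /= lte_fin.
have [_|a0'] := ltP 0 a; first by rewrite oppr0 adde0.
by congr EFin; apply/eqP; rewrite eq_le a0 a0'.
Qed.

Definition arcset (x : R) : set (R * R) := circle R `&` [set p | carc p < x].

Lemma measurable_arcset x : measurable (arcset x).
Proof.
apply: measurableI; first exact: measurable_circle.
rewrite -[X in measurable X]setTI.
have -> : [set p | carc p < x] = @carc R @^-1` `]-oo, x[.
  by apply/seteqP; split => p /=; rewrite in_itv.
by apply: (@measurable_carc R) => //; exact: measurable_itv.
Qed.

Lemma measurable_cpt : measurable_fun [set: R] (@cpt R).
Proof.
have c1 : continuous (fun t : R => (cpt t).1).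
  move=> t; exact: (cvg_comp _ _ (@continuous_cpt R t) (@cvg_fst _ _ _ _ _)).
have c2 : continuous (fun t : R => (cpt t).2).
  move=> t; exact: (cvg_comp _ _ (@continuous_cpt R t) (@cvg_snd _ _ _ _ _)).
apply/measurable_fun_pairP; split; exact: continuous_measurable_fun.
Qed.

(** F will be an ultrafilter limit of distribution functions, and no one-sided continuity is claimed
    for it. It is therefore not shown to be the distribution function of the limit measure; only
    [quantile_between] is needed. *)
Definition quantile (F : R -> R) (u : R) : R := sup [set x | 0 <= x <= 1 /\ F x <= u].

Section Quantile.
Variable F : R -> R.
Hypotheses (F0 : F 0 = 0) (F1 : F 1 = 1) (ndF : {homo F : x y / x <= y}).

Let S u := [set x | 0 <= x <= 1 /\ F x <= u].

Let ubS u : ubound (S u) 1.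
Proof. by move=> x [/andP[]]. Qed.

Let supS u : 0 <= u -> has_sup (S u).
Proof.
move=> u0; split; last by exists 1; exact: ubS.
by exists 0; split; rewrite ?lexx ?ler01// F0.
Qed.

Lemma quantile_itv u : 0 <= quantile F u <= 1.
Proof.
have [u0|u0] := leP 0 u.
  apply/andP; split.
    by apply: ub_le_sup; [exists 1; exact: ubS|split; rewrite ?lexx ?ler01// F0].
  by apply: ge_sup; [have [] := supS u0|exact: ubS].
(* For u < 0 the set is empty and its [sup] is 0 by default. *)
have -> : quantile F u = 0.
  rewrite /quantile (_ : [set x | _] = set0) ?sup0//; apply/seteqP; split => // x [/andP[x0 _]].
  by move=> Fx; have := ndF x0; rewrite F0 leNgt (le_lt_trans Fx u0).
by rewrite lexx ler01.
Qed.

Lemma quantile_nd : {homo quantile F : x y / x <= y}.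
Proof.
move=> u v uv; have [u0|u0] := leP 0 u.
  apply: ge_sup; first by have [] := supS u0.
  move=> x [x01 Fx]; apply: ub_le_sup; first by exists 1; exact: ubS.
  by split => //; exact: le_trans uv.
have -> : quantile F u = 0.
  rewrite /quantile (_ : [set x | _] = set0) ?sup0//; apply/seteqP; split => // x [/andP[x0 _]].
  by move=> Fx; have := ndF x0; rewrite F0 leNgt (le_lt_trans Fx u0).
by have /andP[] := quantile_itv v.
Qed.

Lemma quantile_between (x y u : R) : 0 <= x -> x <= y -> y <= 1 -> F x <= u -> u < F y ->
  x <= quantile F u <= y.
Proof.
move=> x0 xy y1 Fx Fy.
have x1 : x <= 1 by exact: le_trans xy y1.
apply/andP; split.
  by apply: ub_le_sup; [exists 1; exact: ubS|split => //; rewrite x0 x1].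
apply: ge_sup; first by exists x; split => //; rewrite x0 x1.
move=> z [_ Fz]; rewrite leNgt; apply/negP => yz.
by have := le_lt_trans Fz Fy; rewrite ltNge ndF// ltW.
Qed.
End Quantile.

(** Helly selection along an ultrafilter. The masses of arcs converge to F, and the limit measure is
    the image of the uniform law under [cpt \o quantile F]. Mass drifting towards parameter 1 is not
    lost, because [cpt 1] and [cpt 0] are the same point. *)
Theorem weak_compactness (U : set_system nat) (FU : UltraFilter U) (m : nat -> PM R) :
  (forall j, onT (m j)) ->
  exists mu : PM R, onT mu /\ forall f, tcont f -> (fun j => tint (m j) f) @ U --> tint mu f.
Proof.
move=> m1; have PU : ProperFilter U := @ultra_proper _ _ FU.
pose Fj (x : R) j := fine (m j (arcset x)).
have Fj01 x j : 0 <= Fj x j <= 1.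
  rewrite fine_ge0//= -lee_fin fineK ?fin_num_measure//; last exact: measurable_arcset.
  by apply: probability_le1; exact: measurable_arcset.
have exF x : exists l : R, Fj x @ U --> l.
  apply: (@ultra_bounded_cvg _ _ FU _ 1) => j.
  by have /andP[h0 h1] := Fj01 x j; rewrite ger0_norm.
have [F HF] := choice exF.
have ndFj x y j : x <= y -> Fj x j <= Fj y j.
  move=> xy; apply: fine_le; rewrite ?fin_num_measure//; try exact: measurable_arcset.
  apply: le_measure; rewrite ?inE; try exact: measurable_arcset.
  by move=> p [pc px]; split => //=; exact: lt_le_trans xy.
have ndF : {homo F : x y / x <= y}.
  move=> x y xy; apply: ler_cvg_to (HF x) (HF y) _.
  by apply: nearW => j; exact: ndFj.
have F0 : F 0 = 0.
  have E : Fj 0 = fun=> 0.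
    apply/funext => j; rewrite /Fj (_ : arcset 0 = set0) ?measure0//.
    apply/seteqP; split => // p [pc]; have /andP[h _] := carc_itv pc.
    by rewrite /= ltNge h.
  by have := HF 0; rewrite E => h; apply/esym/(cvg_unique _ (@cvg_cst _ _ _ _ _) h).
have F1 : F 1 = 1.
  have E : Fj 1 = fun=> 1.
    apply/funext => j; rewrite /Fj (_ : arcset 1 = circle R); first by rewrite m1.
    apply/seteqP; split => [p []//|p pc]; split => //=.
    by have /andP[_ h] := carc_itv pc.
  by have := HF 1; rewrite E => h; apply/esym/(cvg_unique _ (@cvg_cst _ _ _ _ _) h).
pose g := quantile F.
have g01 u : 0 <= g u <= 1 := quantile_itv F0 ndF u.
have mg : measurable_fun [set: R] g.
  by apply: nondecreasing_measurable => // x y xy; exact: quantile_nd.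
have mX : measurable_fun [set: measurableTypeR R] (@cpt R \o g).
  by apply: measurableT_comp => //; exact: measurable_cpt.
pose X : {mfun (measurableTypeR R) >-> (R * R)%type} :=
  @mfun_Sub _ _ (measurableTypeR R) (R * R)%type (@cpt R \o g) (mem_set mX).
pose mu : PM R := distribution unif01 X.
have XT A : circle R `<=` A -> X @^-1` A = setT.
  by move=> cA; apply/seteqP; split => // u _; apply: cA; exact: cpt_circle (g01 u).
have mu1 : onT mu.
  rewrite /onT /mu /= /distribution /pushforward XT//.
  exact: probability_setT.
exists mu; split => // f cf.
have fXint (D : set R) : measurable D -> unif01.-integrable D (EFin \o (f \o (@cpt R \o g))).
  move=> mD; apply: measurable_bounded_integrable => //.
  - by rewrite (le_lt_trans (probability_le1 _ _))// ltry.
  - apply: measurable_funTS.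
    apply: (@measurable_comp _ _ _ _ _ _ (circle R) f) => //; first exact: measurable_circle.
    + by move=> _ [u _ <-]; exact: cpt_circle (g01 u).
    + exact: measurable_tcont.
  - have [M HM] := tcont_bounded cf.
    exists M; split; first exact: num_real.
    by move=> y My u _; apply: le_trans (ltW My); apply: HM; exact: cpt_circle (g01 u).
(* The domain is cut to u < 1 because that is the top set of the chain of levels u < F(l/N), as F 1
   = 1. *)
have tintE : tint mu f = \int[unif01]_(u in `]-oo, 1[) f (cpt (g u)).
  have mfc : measurable_fun [set: R * R] (f \_ (circle R)).
    by apply/(measurable_restrictT _ (@measurable_circle R)); exact: measurable_tcont.
  have -> : tint mu f = tint mu (f \_ (circle R)).
    by apply: eq_tint => p pc; rewrite patchT// mem_set.
  have E2 u : (f \_ (circle R)) (cpt (g u)) = f (cpt (g u)).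
    by rewrite patchT// mem_set//; exact: cpt_circle (g01 u).
  rewrite /tint /Rintegral /mu /= /distribution integral_pushforward; first last.
  - exact: measurable_circle.
  - rewrite XT//.
    have := fXint setT measurableT; apply: eq_integrable => // u _ /=.
    by rewrite E2.
  - exact/measurable_EFinP.
  - exact: mX.
  rewrite XT// (@negligible_integral _ (measurableTypeR R) R unif01 _ (`[1, +oo[%classic : set R)) //=; last 2 first.
  - have := fXint setT measurableT; apply: eq_integrable => // u _ /=.
    by rewrite E2.
  - rewrite unif01E (_ : _ `&` _ = set0) ?measure0//.
    apply/seteqP; split => // x /= []; rewrite !in_itv/= andbT => x1 /andP[_].
    by rewrite ltNge x1.
  congr fine; rewrite setTD setCitvr.
  by apply: eq_integral => u _; rewrite /= E2.
apply/cvgrPdist_le => e e0.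
have e3 : 0 < e / 3 by rewrite divr_gt0.
have [d d0 Hd] := unif_continuous_within (@segment_compact R 0 1) (tcont_cpt cf) e3.
pose N := (Num.trunc d^-1).+1.
have Np : 0 < N%:R :> R by rewrite ltr0n.
have Nd : N%:R^-1 < d.
  by rewrite invf_plt ?posrE//; have := truncnS_gt (d^-1).
have xl1 l : (l <= N)%N -> 0 <= (l%:R / N%:R : R) <= 1.
  by move=> lN; rewrite divr_ge0//= ler_pdivrMr// mul1r ler_nat.
have xlS l : l.+1%:R / N%:R = l%:R / N%:R + N%:R^-1 :> R.
  by rewrite -natr1 mulrDl mul1r.
pose c l := f (cpt (l%:R / N%:R)).
have near_c l t : (l < N)%N -> l%:R / N%:R <= t <= l.+1%:R / N%:R -> `|f (cpt t) - c l| <= e / 3.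
  move=> lN /andP[t1 t2]; apply: ltW; apply: (Hd t (l%:R / N%:R)).
  - have /andP[h1 _] := xl1 l (ltnW lN); have /andP[_ h2] := xl1 l.+1 lN.
    by rewrite /= in_itv/= (le_trans h1 t1) (le_trans t2 h2).
  - by rewrite /= in_itv/= xl1// ltnW.
  - rewrite /ball /= ger0_norm ?subr_ge0//.
    by move: t2; rewrite xlS; move: Nd; lra.
have NN : N%:R / N%:R = 1 :> R by rewrite divff// gt_eqF.
(* For u between F(l/N) and F((l+1)/N) the quantile lies in [l/N, (l+1)/N], whose length is below d;
   so f varies by at most e/3 there. *)
have bmu : `|tint mu f - \sum_(l < N) c l * (F (l.+1%:R / N%:R) - F (l%:R / N%:R))| <= e / 3.
  have F01 x : 0 <= x <= 1 -> 0 <= F x <= 1.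
    by move=> /andP[x0 x1]; rewrite -{1}F0 -F1 !ndF.
  have PA l : (l <= N)%N -> fine (unif01 `]-oo, F (l%:R / N%:R)[%classic) = F (l%:R / N%:R).
    by move=> lN; rewrite unif01_itv//; apply: F01; exact: xl1.
  have := @staircase_integral R _ _ unif01 (f \o (@cpt R \o g))
    (fun l => `]-oo, F (l%:R / N%:R)[%classic) c (e / 3) N.
  have U1 : fine (unif01 `]-oo, 1[%classic) = 1 by rewrite unif01_itv// lexx ler01.
  rewrite NN F1 -tintE U1 mulr1.
  rewrite (eq_bigr (fun l : 'I_N => c l * (F (l.+1%:R / N%:R) - F (l%:R / N%:R)))); last first.
    by move=> l _; rewrite !PA// ltnW.
  apply.
  - by move=> l; exact: measurable_itv.
  - move=> l x /=; rewrite !in_itv/= => h; apply: lt_le_trans h _; apply: ndF.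
    by rewrite xlS lerDl invr_ge0.
  - by rewrite mul0r F0 unif01_itv// lexx ler01.
  - by apply: fXint; exact: measurable_itv.
  - move=> l u lN /=; rewrite !in_itv/= => u2 /negP; rewrite -leNgt => u1.
    apply: near_c => //; have /andP[h1 _] := xl1 l (ltnW lN); have /andP[_ h2] := xl1 l.+1 lN.
    by apply: quantile_between => //; rewrite xlS lerDl invr_ge0.
have bj j : `|tint (m j) f - \sum_(l < N) c l * (Fj (l.+1%:R / N%:R) j - Fj (l%:R / N%:R) j)| <= e / 3.
  have := @staircase_integral R _ _ (m j) f (fun l => arcset (l%:R / N%:R)) c (e / 3) N.
  have arc1 : arcset (N%:R / N%:R) = circle R.
    rewrite NN; apply/seteqP; split => [p []//|p pc]; split => //=.
    by have /andP[_ h] := carc_itv pc.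
  rewrite arc1 [X in fine X]m1 mulr1; apply.
  - by move=> l; exact: measurable_arcset.
  - move=> l p [pc /= h]; split => //=; apply: lt_le_trans h _.
    by rewrite xlS lerDl invr_ge0.
  - rewrite mul0r (_ : arcset 0 = set0) ?measure0//.
    apply/seteqP; split => // p [pc]; have /andP[h _] := carc_itv pc.
    by rewrite /= ltNge h.
  - exact: tint_integrable.
  - move=> l p lN [pc /= h2] h1; rewrite -[p in f p](carcK pc); apply: near_c => //.
    rewrite (ltW h2) andbT leNgt; apply/negP => h; apply: h1; split => //.
have cvS : (fun j => \sum_(l < N) c l * (Fj (l.+1%:R / N%:R) j - Fj (l%:R / N%:R) j)) @ U -->
    \sum_(l < N) c l * (F (l.+1%:R / N%:R) - F (l%:R / N%:R)).
  have cl (l : 'I_N) : (fun j => c l * (Fj (l.+1%:R / N%:R) j - Fj (l%:R / N%:R) j)) @ U -->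
      c l * (F (l.+1%:R / N%:R) - F (l%:R / N%:R)).
    by apply: cvgMl_tmp; apply: cvgB; exact: HF.
  elim: (index_enum _) => [|l s IH].
    by under eq_fun do rewrite big_nil; rewrite big_nil; exact: cvg_cst.
  under eq_fun do rewrite big_cons; rewrite big_cons; exact: cvgD (cl l) IH.
move/cvgrPdist_le : cvS => /(_ _ e3); apply: filterS => j hj.
have := bj j; move: hj bmu.
set a := \sum_(l < N) _; set b := \sum_(l < N) _.
rewrite !ler_norml => /andP[? ?] /andP[? ?] /andP[? ?]; apply/andP; split; lra.
Qed.
End WeakCompactnessCircle.

(** * Limits of complex functions along a filter *)

Section ComplexLimits.
Variable R : realType.
Local Notation C := R[i].
Context {T : Type}.
Variable F : set_system T.
Context (FF : ProperFilter F).
Implicit Types (u v : T -> C) (l : C).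

Definition clim u l := forall e, 0 < e -> F [set j | normc (u j - l) < e].

Lemma clim_cst l : clim (fun=> l) l.
Proof. by move=> e e0; apply: filterE => j /=; rewrite subrr normc0. Qed.

Lemma eq_clim u v l : F [set j | u j = v j] -> clim u l -> clim v l.
Proof.
by move=> uv cu e e0; apply: (filterS _ (filterI uv (cu e e0))) => j [/= ->].
Qed.

Lemma climD u v l l' : clim u l -> clim v l' -> clim (fun j => u j + v j) (l + l').
Proof.
move=> cu cv e e0; have e2 : 0 < e / 2 by rewrite divr_gt0.
apply: (filterS _ (filterI (cu _ e2) (cv _ e2))) => j [/= h1 h2].
rewrite (_ : _ - _ = (u j - l) + (v j - l')); last by ring.
by apply: le_lt_trans (normcD _ _) _; lra.
Qed.

Lemma climN u l : clim u l -> clim (fun j => - u j) (- l).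
Proof.
move=> cu e e0; apply: (filterS _ (cu e e0)) => j /=.
by rewrite -opprD normcN.
Qed.

Lemma climB u v l l' : clim u l -> clim v l' -> clim (fun j => u j - v j) (l - l').
Proof. by move=> cu cv; apply: climD cu (climN cv). Qed.

Lemma climM u v l l' : clim u l -> clim v l' -> clim (fun j => u j * v j) (l * l').
Proof.
move=> cu cv e e0.
pose B := normc l + normc l' + 1.
have Bp : 1 <= B by rewrite /B; have := normc_ge0 l; have := normc_ge0 l'; lra.
pose d := Num.min 1 (e / (2 * B)).
have d0 : 0 < d by rewrite lt_min ltr01 divr_gt0//; lra.
apply: (filterS _ (filterI (cu _ d0) (cv _ d0))) => j [/= h1 h2].
rewrite (_ : _ - _ = (u j - l) * (v j - l') + (l * (v j - l') + (u j - l) * l')); last by ring.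
apply: le_lt_trans (normcD _ _) _.
apply: le_lt_trans (lerD (lexx _) (normcD _ _)) _; rewrite !Normc.normcM.
have d1 : d <= 1 by rewrite ge_min lexx.
have dB : d * (2 * B) <= e.
  by rewrite -ler_pdivlMr; [rewrite ge_min lexx orbT|lra].
have n1 := normc_ge0 (u j - l); have n2 := normc_ge0 (v j - l').
have n3 := normc_ge0 l; have n4 := normc_ge0 l'.
have p1 : normc (u j - l) * normc (v j - l') <= normc (u j - l) by rewrite ler_piMr//; lra.
have p2 : normc l * normc (v j - l') <= normc l * d by rewrite ler_wpM2l// ltW.
have p3 : normc (u j - l) * normc l' <= d * normc l' by rewrite ler_wpM2r// ltW.
move: dB; rewrite /B; nra.
Qed.

Lemma climV u l : l != 0 -> clim u l -> clim (fun j => (u j)^-1) l^-1.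
Proof.
move=> l0 cu e e0; have nl : 0 < normc l by rewrite normc_gt0.
pose d := Num.min (normc l / 2) (e * normc l ^+ 2 / 2).
have d0 : 0 < d by rewrite lt_min divr_gt0//= divr_gt0// mulr_gt0// exprn_gt0.
apply: (filterS _ (cu _ d0)) => j /= h.
have h1 : normc (u j - l) < normc l / 2 by apply: lt_le_trans h _; rewrite ge_min lexx.
have h2 : normc (u j - l) < e * normc l ^+ 2 / 2.
  by apply: lt_le_trans h _; rewrite ge_min lexx orbT.
have nu : normc l / 2 <= normc (u j).
  have := normc_sub_ge l (u j); rewrite normc_dist; lra.
have u0 : u j != 0 by rewrite -normc_gt0; lra.
rewrite (_ : _ - _ = (l - u j) * ((u j)^-1 * l^-1)); last by field; rewrite u0 l0.
rewrite !Normc.normcM !Normc.normcV normc_dist -invfM ltr_pdivrMr; last first.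
  by rewrite mulr_gt0// normc_gt0.
apply: lt_le_trans h2 _; rewrite -mulrA ler_pM2l//; nra.
Qed.

Lemma clim_unique u l l' : clim u l -> clim u l' -> l = l'.
Proof.
move=> cl cl'; apply/eqP; rewrite -subr_eq0 -normc_eq0 eq_le normc_ge0 andbT.
apply/ler_addgt0Pl => e e0; rewrite addr0.
have e2 : 0 < e / 2 by rewrite divr_gt0.
have [j [/= h1 h2]] := filter_ex (filterI (cl _ e2) (cl' _ e2)).
apply: le_trans (normc_triangle _ (u j) _) _; rewrite normc_dist.
by rewrite [e]splitr ltW// ltrD.
Qed.

Lemma clim_le u l (B : R) : clim u l -> F [set j | normc (u j) <= B] -> normc l <= B.
Proof.
move=> cu uB; apply/ler_addgt0Pr => e e0.
have [j [/= h1 h2]] := filter_ex (filterI (cu _ e0) uB).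
have := normc_sub_ge l (u j); rewrite normc_dist; lra.
Qed.

Lemma clim_ReIm u l : (fun j => complex.Re (u j)) @ F --> complex.Re l ->
  (fun j => complex.Im (u j)) @ F --> complex.Im l -> clim u l.
Proof.
move=> /cvgrPdist_lt cr /cvgrPdist_lt ci e e0.
have e2 : 0 < e / 2 by rewrite divr_gt0.
apply: (filterS _ (filterI (cr _ e2) (ci _ e2))) => j [/= h1 h2].
apply: le_lt_trans (normc_le_ReIm _) _; rewrite ReD ImD ReN ImN.
by rewrite [e]splitr ltrD// distrC.
Qed.

Lemma clim_squeeze u l (b : T -> R) :
  F [set j | normc (u j - l) <= b j] -> b @ F --> 0 -> clim u l.
Proof.
move=> ub /cvgrPdist_lt cb e e0; apply: (filterS _ (filterI ub (cb e e0))) => j [/= h1].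
by rewrite sub0r normrN => h2; apply: le_lt_trans h1 _; apply: le_lt_trans (ler_norm _) h2.
Qed.

Lemma clim_poly (p : {poly C}) u l : clim u l -> clim (fun j => p.[u j]) p.[l].
Proof.
move=> cu; elim/poly_ind : p => [|p c IH].
  by apply: eq_clim (clim_cst _); apply: filterE => j /=; rewrite !horner0.
rewrite hornerMXaddC; apply: eq_clim (climD (climM IH cu) (clim_cst c)).
by apply: filterE => j /=; rewrite hornerMXaddC.
Qed.

Lemma hfun_clim (m : T -> PM R) (mu : PM R) :
  (forall j, onT (m j)) -> onT mu ->
  (forall f, tcont f -> (fun j => tint (m j) f) @ F --> tint mu f) ->
  forall z, normc z < 1 -> clim (fun j => hfun (m j) z) (hfun mu z).
Proof.
move=> m1 mu1 H z z1.
have cK : clim (fun j => Kf (m j) z) (Kf mu z).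
  have [cr ci] := ccont_zkernel z1.
  by apply: clim_ReIm; [exact: H cr|exact: H ci].
rewrite hfunE//.
have n0 := one_psi_neq0 mu1 z1.
apply: eq_clim (climM cK (climV n0 (climD (clim_cst 1) (climM (clim_cst z) cK)))).
by apply: filterE => j /=; rewrite hfunE.
Qed.

(** The Lipschitz constant of [hfun_lip] is uniform in the measure, so function and argument may
    vary together. *)
Lemma hfun_clim_comp (m : T -> PM R) (h : C -> C) (w : T -> C) (w0 : C) (r : R) :
  (forall j, onT (m j)) -> (forall z, normc z < 1 -> clim (fun j => hfun (m j) z) (h z)) ->
  r < 1 -> (forall j, normc (w j) <= r) -> normc w0 <= r -> clim w w0 ->
  clim (fun j => hfun (m j) (w j)) (h w0).
Proof.
move=> m1 mh r1 wr w0r cw.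
have w01 := le_lt_trans w0r r1.
have d : clim (fun j => hfun (m j) (w j) - hfun (m j) w0) 0.
  move=> e e0; have L0 : 0 < 8 * ((1 - r) ^+ 2)^-1.
    by rewrite mulr_gt0// invr_gt0 exprn_gt0// subr_gt0.
  apply: (filterS _ (cw (e / (8 * ((1 - r) ^+ 2)^-1)) (divr_gt0 e0 L0))) => j /=.
  rewrite subr0 ltr_pdivlMr// mulrC => h1.
  by apply: le_lt_trans h1; apply: hfun_lip.
rewrite -[h w0]add0r; apply: eq_clim (climD d (mh _ w01)).
by apply: filterE => j /=; rewrite subrK.
Qed.
End ComplexLimits.

(** * Holomorphy on the disc as polynomial approximability *)

Section PolynomialApproximation.
Variable R : realType.
Local Notation C := R[i].
Implicit Types (f g W : C -> C).

(** On the disc this is equivalent to holomorphy, by Taylor expansion and the Weierstrass theorem.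
    In this form closure under products, inverses, compositions and locally uniform limits is
    elementary. *)
Definition pan f := forall r e : R, r < 1 -> 0 < e ->
  exists p : {poly C}, forall z, normc z <= r -> normc (f z - p.[z]) <= e.

Lemma pan_poly (p : {poly C}) : pan (fun z => p.[z]).
Proof. by move=> r e r1 e0; exists p => z _; rewrite subrr normc0 ltW. Qed.

Lemma eq_pan f g : (forall z, normc z < 1 -> f z = g z) -> pan f -> pan g.
Proof.
move=> fg pf r e r1 e0; have [p Hp] := pf r e r1 e0; exists p => z zr.
by rewrite -fg ?Hp//; exact: le_lt_trans r1.
Qed.

Lemma pan_cst (c : C) : pan (fun=> c).
Proof. by apply: eq_pan (pan_poly c%:P) => z _; rewrite hornerC. Qed.

Lemma pan_id : pan id.
Proof. by apply: eq_pan (pan_poly 'X) => z _; rewrite hornerX. Qed.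

Lemma poly_bounded (p : {poly C}) (r : R) :
  exists2 B, 0 <= B & forall z, normc z <= r -> normc p.[z] <= B.
Proof.
elim/poly_ind : p => [|p c [B B0 HB]].
  by exists 0 => // z _; rewrite horner0 normc0.
exists (B * `|r| + normc c); first by rewrite addr_ge0 ?mulr_ge0 ?normc_ge0.
move=> z zr; rewrite hornerMXaddC; apply: le_trans (normcD _ _) _.
rewrite lerD2r Normc.normcM ler_pM ?normc_ge0 ?HB//.
by apply: le_trans zr (ler_norm _).
Qed.

Lemma pan_bounded f (r : R) : pan f -> r < 1 ->
  exists2 B, 0 <= B & forall z, normc z <= r -> normc (f z) <= B.
Proof.
move=> pf r1; have [p Hp] := pf r 1 r1 ltr01; have [B B0 HB] := poly_bounded p r.
exists (1 + B); first by rewrite addr_ge0.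
move=> z zr; rewrite -[f z](subrK p.[z]); apply: le_trans (normcD _ _) _.
by rewrite lerD ?Hp ?HB.
Qed.

Lemma panD f g : pan f -> pan g -> pan (fun z => f z + g z).
Proof.
move=> pf pg r e r1 e0; have e2 : 0 < e / 2 by rewrite divr_gt0.
have [p Hp] := pf r _ r1 e2; have [q Hq] := pg r _ r1 e2; exists (p + q) => z zr.
rewrite hornerD opprD addrACA [e]splitr; apply: le_trans (normcD _ _) _.
by rewrite lerD ?Hp ?Hq.
Qed.

Lemma panM f g : pan f -> pan g -> pan (fun z => f z * g z).
Proof.
move=> pf pg r e r1 e0.
have [B B0 HB] := pan_bounded pf r1; have [B' B'0 HB'] := pan_bounded pg r1.
have [p Hp] := pf r (e / (2 * (B' + 1))) r1 (divr_gt0 e0 (mulr_gt0 (ltr0n _ 2) (ltr_wpDl B'0 ltr01))).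
have [Bp Bp0 HBp] := poly_bounded p r.
have [q Hq] := pg r (e / (2 * (Bp + 1))) r1 (divr_gt0 e0 (mulr_gt0 (ltr0n _ 2) (ltr_wpDl Bp0 ltr01))).
exists (p * q) => z zr; rewrite hornerM.
rewrite (_ : _ - _ = (f z - p.[z]) * g z + p.[z] * (g z - q.[z])); last by ring.
apply: le_trans (normcD _ _) _; rewrite !Normc.normcM.
have h1 := Hp z zr; have h2 := Hq z zr; have h3 := HB' z zr; have h4 := HBp z zr.
rewrite [e]splitr; apply: lerD.
  apply: le_trans (ler_wpM2l (normc_ge0 _) h3) _.
  apply: le_trans (ler_wpM2r B'0 h1) _.
  rewrite -mulrA ler_pM2l// invfM -mulrA ler_piMr ?invr_ge0//.
  by rewrite mulrC ler_pdivrMr ?mul1r ?lerDl//; lra.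
apply: le_trans (ler_wpM2r (normc_ge0 _) h4) _.
apply: le_trans (ler_wpM2l Bp0 h2) _.
rewrite mulrCA ler_pM2l// invfM mulrCA ler_piMr ?invr_ge0//.
by rewrite ler_pdivrMr ?mul1r ?lerDl//; lra.
Qed.

Lemma panN f : pan f -> pan (fun z => - f z).
Proof. by move=> pf; apply: eq_pan (panM (pan_cst (-1)) pf) => z _; rewrite mulN1r. Qed.

Lemma panX f n : pan f -> pan (fun z => f z ^+ n).
Proof.
move=> pf; elim: n => [|n IH]; first by apply: eq_pan (pan_cst 1) => z _; rewrite expr0.
by apply: eq_pan (panM pf IH) => z _; rewrite exprS.
Qed.

Lemma pan_sum n (f : nat -> C -> C) : (forall i, pan (f i)) -> pan (fun z => \sum_(i < n) f i z).
Proof.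
move=> pf; elim: n => [|n IH]; first by apply: eq_pan (pan_cst 0) => z _; rewrite big_ord0.
by apply: eq_pan (panD IH (pf n)) => z _; rewrite big_ord_recr.
Qed.

Lemma pan_uniform f : (forall r e : R, r < 1 -> 0 < e ->
  exists2 g, pan g & forall z, normc z <= r -> normc (f z - g z) <= e) -> pan f.
Proof.
move=> H r e r1 e0; have e2 : 0 < e / 2 by rewrite divr_gt0.
have [g pg Hg] := H r _ r1 e2; have [p Hp] := pg r _ r1 e2; exists p => z zr.
apply: le_trans (normc_triangle _ (g z) _) _.
by rewrite [e]splitr lerD ?Hg ?Hp.
Qed.

Lemma pan_hornerc (p : {poly C}) f : pan f -> pan (fun z => p.[f z]).
Proof.
move=> pf; elim/poly_ind : p => [|p c IH].
  by apply: eq_pan (pan_cst 0) => z _; rewrite horner0.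
by apply: eq_pan (panD (panM IH pf) (pan_cst c)) => z _; rewrite hornerMXaddC.
Qed.

(** By the Schwarz-type bound on g the inner values stay in the same closed disc, so one polynomial
    for f at radius r is enough. *)
Lemma pan_comp f g : pan f -> pan g ->
  (forall z, normc z < 1 -> normc (g z) <= normc z) -> pan (fun z => f (g z)).
Proof.
move=> pf pg gz; apply: pan_uniform => r e r1 e0; have [p Hp] := pf r e r1 e0.
exists (fun z => p.[g z]); first exact: pan_hornerc.
by move=> z zr; apply: Hp; apply: le_trans (gz _ (le_lt_trans zr r1)) zr.
Qed.

Lemma geometric_small (B r e : R) : 0 <= r < 1 -> 0 < e -> exists k, B * r ^+ k <= e.
Proof.
move=> r01 e0; apply: contrapT => /forallNP H.
have : e <= 0; last by rewrite leNgt e0.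
by apply: (geometric_le0 r01 (B := B)) => k; rewrite leNgt; apply/negP => h; exact: (H k (ltW h)).
Qed.

(** On |z| <= r, a W stays in a disc around 1 of radius rho < 1, and 1/W is the uniform limit of the
    Neumann sums of a (1 - a W)^i. The scale a may change with r. *)
Lemma pan_inv W : pan W ->
  (forall r : R, 0 <= r < 1 -> exists (a : C) (rho : R), [/\ a != 0, 0 <= rho < 1 &
    forall z, normc z <= r -> normc (1 - a * W z) <= rho]) ->
  pan (fun z => (W z)^-1).
Proof.
move=> pW H; apply: pan_uniform => r e r1 e0.
have [r0|r0] := leP 0 r; last first.
  exists (fun=> 0); first exact: pan_cst.
  by move=> z zr; have := le_lt_trans (le_trans (normc_ge0 z) zr) r0; rewrite ltxx.
have r01 : 0 <= r < 1 by rewrite r0.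
have [a [rho [a0 rho01 Ha]]] := H r r01; have /andP[rho0 rho1] := rho01.
have [k Hk] := geometric_small (normc a * (1 - rho)^-1) rho01 e0.
exists (fun z => a * \sum_(i < k) (1 - a * W z) ^+ i).
  apply: panM (pan_cst _) _.
  apply: (pan_sum k (f := fun i z => (1 - a * W z) ^+ i)) => i; apply: panX.
  exact: panD (pan_cst _) (panN (panM (pan_cst _) pW)).
move=> z zr; set V := 1 - a * W z.
have V1 : normc V <= rho := Ha z zr.
have V0 : 1 - V != 0 by apply: sub1c_neq0; exact: le_lt_trans rho1.
have aW : a * W z = 1 - V by rewrite /V opprB addrCA subrr addr0.
have W0 : W z != 0 by apply: contra V0 => /eqP W0; rewrite -aW W0 mulr0.
have geo : \sum_(i < k) V ^+ i = (1 - V ^+ k) / (1 - V).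
  apply: (mulIf V0); rewrite mulfVK//.
  have := subrX1 V k; rewrite -(opprB 1 V) -(opprB 1 (V ^+ k)) mulNr => /oppr_inj ->.
  by rewrite mulrC.
rewrite geo (_ : _ - _ = a * (V ^+ k / (1 - V))); last first.
  by rewrite -aW; field; rewrite a0 W0.
apply: le_trans Hk; rewrite !Normc.normcM Normc.normcV normcX -mulrA ler_wpM2l ?normc_ge0//.
rewrite mulrC ler_pM ?invr_ge0 ?exprn_ge0 ?normc_ge0//.
  rewrite lef_pV2 ?posrE ?normc_gt0// ?subr_gt0//.
  exact: normc_sub1.
by apply: lerXn2r; rewrite ?nnegrE ?normc_ge0.
Qed.

Lemma pan_Kf (mu : PM R) : onT mu -> pan (Kf mu).
Proof.
move=> m1; apply: pan_uniform => r e r1 e0.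
have [r0|r0] := leP 0 r; last first.
  exists (fun=> 0); first exact: pan_cst.
  by move=> z zr; have := le_lt_trans (le_trans (normc_ge0 z) zr) r0; rewrite ltxx.
have r01 : 0 <= r < 1 by rewrite r0.
have [k Hk] := geometric_small ((1 - r)^-1) r01 e0.
exists (fun z => \sum_(j < k) moment mu j.+1 * z ^+ j).
  apply: (pan_sum k (f := fun j z => moment mu j.+1 * z ^+ j)) => j.
  by apply: panM (pan_cst _) _; apply: panX pan_id.
move=> z zr; apply: le_trans (Kf_expansion k m1 zr r1) _; apply: le_trans Hk.
rewrite ler_wpM2l ?invr_ge0 ?subr_ge0 ?(ltW r1)//.
by apply: lerXn2r; rewrite ?nnegrE ?normc_ge0.
Qed.

Lemma pan_hfun (mu : PM R) : onT mu -> pan (hfun mu).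
Proof.
move=> m1; apply: (@eq_pan (fun z => Kf mu z * (1 + z * Kf mu z)^-1)).
  by move=> z z1; rewrite hfunE.
have pK := pan_Kf m1; apply: (panM pK); apply: pan_inv.
  exact: panD (pan_cst 1) (panM pan_id pK).
move=> r r01; have /andP[r0 r1] := r01.
(* Scale and radius are those of [apollonius], applied to W = 1 + psi. *)
exists (((1 - r ^+ 2)%:C)%C), r; split => //.
  rewrite -normc_gt0 normcR gtr0_norm; nra.
move=> z zr; have z1 := le_lt_trans zr r1.
rewrite -apollonius// [_ - 1]addrAC subrr add0r.
apply: le_trans (psi_le m1 z1) _; rewrite ler_wpM2r ?normc_ge0//.
Qed.

Lemma pan_clim f (F : set_system nat) (FF : ProperFilter F) (u : nat -> C) (l : C) (r : R) :
  pan f -> r < 1 -> (forall j, normc (u j) <= r) -> normc l <= r ->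
  clim F u l -> clim F (fun j => f (u j)) (f l).
Proof.
move=> pf r1 ur lr cu e e0; have e3 : 0 < e / 3 by rewrite divr_gt0.
have [p Hp] := pf r _ r1 e3.
apply: (filterS _ (clim_poly FF p cu e3)) => j /= h.
have h1 := Hp _ (ur j); have h2 := Hp _ lr; rewrite normc_dist in h2.
rewrite (_ : _ - _ = (f (u j) - p.[u j]) + ((p.[u j] - p.[l]) + (p.[l] - f l))); last by ring.
apply: le_lt_trans (normcD _ _) _; apply: le_lt_trans (lerD (lexx _) (normcD _ _)) _; lra.
Qed.
End PolynomialApproximation.

(** * Atomic measures and the Schwarz formula over roots of unity *)

Section Herglotz.
Variable R : realType.
Local Notation C := R[i].

Lemma discrete_measure n (q : nat -> R) (x : nat -> R * R) :
  (forall l, 0 <= q l) -> (forall l, circle R (x l)) -> 0 < \sum_(l < n) q l ->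
  exists mu : PM R, onT mu /\ forall f, tcont f ->
    tint mu f = (\sum_(l < n) q l)^-1 * \sum_(l < n) q l * f (x l).
Proof.
move=> q0 xc; set Q := \sum_(l < n) q l => Qp.
have q'0 l : 0 <= q l / Q by rewrite divr_ge0// ltW.
pose D : {measure set (R * R) -> \bar R} :=
  msum (fun l => mscale (NngNum (q'0 l)) (dirac (x l))) n.
have D1 A : circle R `<=` A -> D A = 1%E.
  move=> cA; rewrite /D /= /msum (eq_bigr (fun l : 'I_n => (q l / Q)%:E)); last first.
    move=> l _; rewrite -[LHS]/((q l / Q)%:E * \d_(x l) A)%E diracE mem_set ?mule1//.
    exact/cA/xc.
  by rewrite sumEFin -mulr_suml divff// gt_eqF.
pose mu : PM R := mnormalize D point.
have muE A : mu A = D A.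
  by rewrite /mu /= /mnormalize D1// onee_eq0 /= invr1 mule1.
have mu1 : onT mu by rewrite /onT muE D1.
have tE f : tint mu f = fine (\int[D]_(p in circle R) (f p)%:E)%E.
  by congr fine; apply: eq_measure_integral => A _ _; rewrite -muE.
have pos f : tcont f -> (forall p, circle R p -> 0 <= f p) ->
    tint mu f = Q^-1 * \sum_(l < n) q l * f (x l).
  move=> cf f0; rewrite tE /D /=.
  have mf : measurable_fun (circle R) (fun p => (f p)%:E).
    by apply/measurable_EFinP; exact: measurable_tcont.
  rewrite ge0_integral_measure_sum//; last exact: measurable_circle.
  rewrite (eq_bigr (fun l : 'I_n => (q l / Q * f (x l))%:E)).
    rewrite sumEFin /= mulr_sumr; apply: eq_bigr => l _; ring.
  move=> l _; rewrite ge0_integral_mscale//; last exact: measurable_circle.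
  rewrite integral_dirac//; last exact: measurable_circle.
  by rewrite diracE mem_set//= mul1e.
exists mu; split => // f cf; have [B HB] := tcont_bounded cf.
(* Adding a bound reduces signed f to the nonnegative case; the constant integrates to itself
   because the total mass is 1. *)
have := pos (fun p => f p + B) (tcontD cf (tcont_cst B)).
rewrite tintD// ?tint_cst//; last exact: tcont_cst.
move=> /(_ _)/esym; under eq_bigr do rewrite mulrDr.
rewrite big_split /= -mulr_suml mulrDr mulrA mulVf ?gt_eqF// mul1r => H.
apply: (addIr B); rewrite H// => p pc.
by have := HB p pc; rewrite ler_norml => /andP[]; lra.
Qed.

Lemma unit_root_conj M (l j : nat) : (0 < M)%N -> (j <= M)%N ->
  conjc (omega R M ^+ l) ^+ j = (omega R M ^+ l) ^+ (M - j).
Proof.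
move=> M0 jM; set w := omega R M ^+ l.
have w1 : w * conjc w = 1 by apply: conjc_unit; rewrite normcX normc_omega expr1n.
have wM : w ^+ M = 1 by rewrite /w -exprM mulnC exprM omegaX// expr1n.
rewrite -[LHS]mul1r -wM -{1}(subnK jM) exprD -mulrA -exprMn w1.
by rewrite expr1n mulr1.
Qed.

(** As the nodes satisfy w^M = 1, the geometric series of 1/(1 - z conj w) folds modulo M into a
    finite sum times 1/(1 - z^M); orthogonality keeps the term of index j. *)
Lemma discrete_poisson M j (z : C) : (j < M)%N -> normc z < 1 ->
  M%:R^-1 * \sum_(l < M) (omega R M ^+ l) ^+ j * (1 - z * conjc (omega R M ^+ l))^-1 =
  z ^+ j / (1 - z ^+ M).
Proof.
move=> jM z1; have M0 : (0 < M)%N by exact: leq_trans jM.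
have zM : 1 - z ^+ M != 0.
  apply: sub1c_neq0; rewrite normcX; apply: (le_lt_trans _ z1).
  by rewrite -[leRHS]expr1 ler_wiXn2l ?normc_ge0 ?(ltW z1).
have geo l : (1 - z * conjc (omega R M ^+ l))^-1 =
    (1 - z ^+ M)^-1 * \sum_(i < M) z ^+ i * conjc (omega R M ^+ l) ^+ i.
  have y0 : 1 - z * conjc (omega R M ^+ l) != 0.
    by apply: sub1c_neq0; rewrite Normc.normcM normc_conj normcX normc_omega expr1n mulr1.
  apply: (mulfI y0); rewrite divff// mulrCA.
  have yM : (z * conjc (omega R M ^+ l)) ^+ M = z ^+ M.
    by rewrite exprMn unit_root_conj// subnn expr0 mulr1.
  have := subrX1 (z * conjc (omega R M ^+ l)) M; rewrite yM.
  rewrite -(opprB 1 (z ^+ M)) -(opprB 1 (z * _)) mulNr => /oppr_inj.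
  under eq_bigr do rewrite exprMn.
  by move=> <-; rewrite mulVf.
under eq_bigr do rewrite geo mulrCA.
rewrite -mulr_sumr; under eq_bigr do rewrite mulr_sumr.
rewrite exchange_big /=.
rewrite (eq_bigr (fun i : 'I_M => z ^+ i * (if j == i then M%:R else 0))); last first.
  move=> i _; rewrite -(omega_orthogonal R jM (ltn_ord i)) mulr_sumr.
  by apply: eq_bigr => l _; rewrite mulrCA.
rewrite (bigD1 (Ordinal jM)) //= eqxx big1 ?addr0; last first.
  by move=> i ij; rewrite ifN ?mulr0// eq_sym.
have MC : M%:R != 0 :> C by rewrite pnatr_eq0 -lt0n.
by field; rewrite MC zM.
Qed.

(** On the nodes conj w^j = w^(M - j). The index j = 0 is separate because M - 0 is not below M. *)
Lemma discrete_poisson_conj M j (z : C) : (j < M)%N -> normc z < 1 ->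
  M%:R^-1 * \sum_(l < M) conjc (omega R M ^+ l) ^+ j * (1 - z * conjc (omega R M ^+ l))^-1 =
  (if j == 0%N then 1 else z ^+ (M - j)) / (1 - z ^+ M).
Proof.
move=> jM z1; have M0 : (0 < M)%N by exact: leq_trans jM.
case: j jM => [|j] jM /=.
  by have := discrete_poisson jM z1; rewrite expr0; under eq_bigr do rewrite expr0.
under eq_bigr do rewrite unit_root_conj// ?(ltnW jM)//.
apply: discrete_poisson => //; rewrite ltn_subrL M0 //.
Qed.

(** The nodal data are 2 Re p - 1. Besides p(r z) the sum returns the aliased conjugate part: its
    term j = 0 is conj p_0, which offsets the -1 when p(0) is near 1, and the others carry z^(M -
    j), small once M is large compared with the degree. *)
Lemma discrete_schwarz M (p : {poly C}) (r : R) (z : C) : (size p <= M)%N -> (0 < M)%N ->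
  normc z < 1 ->
  M%:R^-1 * (\sum_(l < M) (p.[(r%:C)%C * omega R M ^+ l] +
     conjc p.[(r%:C)%C * omega R M ^+ l] - 1) * (1 - z * conjc (omega R M ^+ l))^-1) *
  (1 - z ^+ M) =
  p.[(r%:C)%C * z] +
  \sum_(j < M) conjc p`_j * (r%:C)%C ^+ j * (if j == 0%N :> nat then 1 else z ^+ (M - j)) - 1.
Proof.
move=> pM M0 z1; set w := fun l => omega R M ^+ l.
have zM : 1 - z ^+ M != 0.
  apply: sub1c_neq0; rewrite normcX; apply: (le_lt_trans _ z1).
  by rewrite -[leRHS]expr1 ler_wiXn2l ?normc_ge0 ?(ltW z1).
pose k l := (1 - z * conjc (w l))^-1.
have E1 : M%:R^-1 * \sum_(l < M) p.[(r%:C)%C * w l] * k l = p.[(r%:C)%C * z] / (1 - z ^+ M).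
  under eq_bigr do rewrite (horner_coef_wide _ pM) mulr_suml.
  rewrite exchange_big /= (horner_coef_wide _ pM) mulr_sumr mulr_suml; apply: eq_bigr => j _.
  rewrite exprMn mulrA -[RHS]mulrA -(discrete_poisson (ltn_ord j) z1) !mulr_sumr.
  by apply: eq_bigr => l _; rewrite exprMn /w /k; ring.
have E2 : M%:R^-1 * \sum_(l < M) conjc p.[(r%:C)%C * w l] * k l =
    (\sum_(j < M) conjc p`_j * (r%:C)%C ^+ j * (if j == 0%N :> nat then 1 else z ^+ (M - j)))
    / (1 - z ^+ M).
  have cp l : conjc p.[(r%:C)%C * w l] = \sum_(j < M) conjc p`_j * ((r%:C)%C ^+ j * conjc (w l) ^+ j).
    rewrite (horner_coef_wide _ pM) rmorph_sum; apply: eq_bigr => j _.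
    by rewrite rmorphM rmorphXn rmorphM /= exprMn conjc_real.
  under eq_bigr do rewrite cp mulr_suml.
  rewrite exchange_big /= mulr_sumr mulr_suml; apply: eq_bigr => j _.
  rewrite -[RHS]mulrA -(discrete_poisson_conj (ltn_ord j) z1) !mulr_sumr.
  by apply: eq_bigr => l _; rewrite /w /k; ring.
have E3 : M%:R^-1 * \sum_(l < M) k l = 1 / (1 - z ^+ M).
  have := discrete_poisson M0 z1; rewrite expr0 => <-.
  by congr (_ * _); apply: eq_bigr => l _; rewrite expr0 mul1r.
have -> : M%:R^-1 * (\sum_(l < M) (p.[(r%:C)%C * omega R M ^+ l] +
     conjc p.[(r%:C)%C * omega R M ^+ l] - 1) * (1 - z * conjc (omega R M ^+ l))^-1) =
  M%:R^-1 * (\sum_(l < M) p.[(r%:C)%C * w l] * k l) +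
  M%:R^-1 * (\sum_(l < M) conjc p.[(r%:C)%C * w l] * k l) - M%:R^-1 * \sum_(l < M) k l.
  rewrite -mulrDr -mulrBr -big_split -sumrB /=; congr (_ * _).
  by apply: eq_bigr => l _; rewrite /w /k; ring.
rewrite E1 E2 E3.
by rewrite -mulrDl -mulrBl divfK.
Qed.
End Herglotz.

(** * Every bounded holomorphic function is some h_mu *)

Section HerglotzRepresentation.
Variable R : realType.
Local Notation C := R[i].

(** For G = 1/(1 - z h) the weight equals (1 - |z h|^2) / |1 - z h|^2 at the node: the nonnegative
    Herglotz density on the circle of radius r. *)
Definition poisson_weight (G : C -> C) (r : R) M (l : nat) : R :=
  2 * complex.Re (G ((r%:C)%C * omega R M ^+ l)) - 1.

Definition poisson_sum (G : C -> C) (r : R) M (z : C) : C :=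
  M%:R^-1 * \sum_(l < M) ((poisson_weight G r M l)%:C)%C * (1 - z * conjc (omega R M ^+ l))^-1.

(** Approximating G by p costs 2e/(1 - |z|), doubled by the factor 1 - z^M; three further errors of
    size e come from p(r z), the aliases and p(0). Together they give 7. *)
Lemma poisson_step (G : C -> C) (r e : R) : pan G -> G 0 = 1 -> 0 < r < 1 -> 0 < e ->
  exists M, (0 < M)%N /\ forall z, normc z <= r ->
    normc (poisson_sum G r M z * (1 - z ^+ M) - G ((r%:C)%C * z)) <= 7 * e / (1 - normc z) /\
    normc (z ^+ M) <= e.
Proof.
move=> pG G0 /andP[r0 r1] e0; have [p Hp] := pG r e r1 e0.
pose Sp := \sum_(j < size p) normc p`_j.
have Sp0 : 0 <= Sp by apply: sumr_ge0 => j _; exact: normc_ge0.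
have r01 : 0 <= r < 1 by rewrite r1 ltW.
have [k Hk] := geometric_small (Sp + 1) r01 e0.
(* Every alias exponent M - j with j below [size p] is then at least k, and k was chosen to make (Sp
   + 1) r^k at most e. *)
exists (size p + k).+1; set M := (size p + k).+1; split => // z zr.
have rk0 : 0 <= r ^+ k by rewrite exprn_ge0 ?ltW.
have z1 := le_lt_trans zr r1.
have z0 := normc_ge0 z.
have zM : normc (z ^+ M) <= e.
  apply: le_trans Hk; rewrite normcX.
  apply: (@le_trans _ _ (r ^+ M)); first by apply: lerXn2r; rewrite ?nnegrE ?normc_ge0// ltW.
  apply: (@le_trans _ _ (r ^+ k)); last by rewrite ler_peMl// lerDr.
  by rewrite ler_wiXn2l ?(ltW r0) ?(ltW r1)// /M ltnW// ltnS leq_addl.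
split => //.
have sM : (size p <= M)%N by rewrite /M ltnW// ltnS leq_addr.
have M0 : (0 < M)%N by [].
have rz (y : C) : normc y <= 1 -> normc ((r%:C)%C * y) <= r.
  by move=> y1; rewrite Normc.normcM normcR (gtr0_norm r0) ler_piMr// ltW.
have w1 l : normc (omega R M ^+ l) = 1 by rewrite normcX normc_omega expr1n.
set S' := M%:R^-1 * (\sum_(l < M) (p.[(r%:C)%C * omega R M ^+ l] +
     conjc p.[(r%:C)%C * omega R M ^+ l] - 1) * (1 - z * conjc (omega R M ^+ l))^-1).
have dS : normc (poisson_sum G r M z - S') <= 2 * e / (1 - normc z).
  have Mp : 0 < M%:R :> R by rewrite ltr0n.
  rewrite /poisson_sum -mulrBr -sumrB Normc.normcM Normc.normcV.
  have -> : normc (M%:R : C) = M%:R.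
    by rewrite -(rmorph_nat (real_complex R)) normcR ger0_norm// ler0n.
  rewrite ler_pdivrMl//; apply: le_trans (normc_sum _ _ _) _.
  apply: (@le_trans _ _ (\sum_(l < M) (2 * e / (1 - normc z)))); last first.
    by rewrite sumr_const card_ord [M%:R * _]mulr_natl.
  apply: ler_sum => l _.
  have -> : ((poisson_weight G r M l)%:C)%C = G ((r%:C)%C * omega R M ^+ l) +
      conjc (G ((r%:C)%C * omega R M ^+ l)) - 1.
    by rewrite addcJ /poisson_weight rmorphB rmorph1 rmorphM rmorph_nat.
  rewrite -mulrBl Normc.normcM; apply: ler_pM; rewrite ?normc_ge0//.
    have h : normc (G ((r%:C)%C * omega R M ^+ l) - p.[(r%:C)%C * omega R M ^+ l]) <= e.
      by apply: Hp; apply: rz; rewrite w1.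
    set a := G _ in h *; set b := p.[_] in h *.
    have -> : a + conjc a - 1 - (b + conjc b - 1) = (a - b) + conjc (a - b).
      by rewrite rmorphB; ring.
    by apply: le_trans (normcD _ _) _; rewrite normc_conj mulr_natl mulr2n lerD.
  have zw : normc (z * conjc (omega R M ^+ l)) <= normc z.
    by rewrite Normc.normcM normc_conj w1 mulr1.
  rewrite Normc.normcV lef_pV2 ?posrE ?subr_gt0//; first exact: normc_sub1.
  by apply: lt_le_trans (normc_sub1 zw); rewrite subr_gt0.
have := discrete_schwarz r sM M0 z1; rewrite -/S' => S'E.
set tl := \sum_(j < M) _ in S'E.
have p0 : normc (conjc p`_0 - 1) <= e.
  have := Hp 0; rewrite normc0 => /(_ (ltW r0)); rewrite G0 horner_coef0 normc_dist.
  by rewrite -normc_conj rmorphB rmorph1.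
have jk (i : nat) : (i < size p)%N -> (i + k <= M)%N.
  by move=> ij; rewrite /M ltnW// ltnS leq_add2r ltnW.
have tl1 : normc (tl - conjc p`_0) <= e.
  rewrite /tl (bigD1 (ord0 : 'I_M)) //= expr0 !mulr1 addrAC subrr add0r.
  apply: le_trans (normc_sum _ _ _) _; apply: le_trans Hk.
  apply: (@le_trans _ _ (Sp * r ^+ k)); last by rewrite ler_wpM2r// lerDl.
  rewrite /Sp mulr_suml (big_ord_widen M (fun j => normc p`_j * r ^+ k) sM).
  rewrite big_mkcond [leRHS]big_mkcond /=; apply: ler_sum => j _.
  case: ifPn => [j0|_]; last first.
    by case: ifP => // _; rewrite mulr_ge0 ?normc_ge0.
  case: (ltnP j (size p)) => js; last by rewrite nth_default// conjc0 !mul0r normc0.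
  rewrite ifN; last first.
    by apply: contra j0 => /eqP j0; apply/eqP; exact: val_inj.
  rewrite !Normc.normcM normc_conj !normcX normcR (gtr0_norm r0) -mulrA ler_wpM2l ?normc_ge0//.
  apply: (@le_trans _ _ (1 * r ^+ k)); last by rewrite mul1r.
  apply: ler_pM; rewrite ?exprn_ge0 ?(ltW r0)//.
    by rewrite exprn_ile1 ?(ltW r0) ?(ltW r1).
  apply: (@le_trans _ _ (r ^+ (M - j))); first by apply: lerXn2r; rewrite ?nnegrE ?normc_ge0// ltW.
  rewrite ler_wiXn2l ?(ltW r0) ?(ltW r1)//.
  by have := leq_sub2r j (jk j js); rewrite addKn.
have prz : normc (p.[(r%:C)%C * z] - G ((r%:C)%C * z)) <= e.
  by rewrite normc_dist; apply: Hp; apply: rz; exact: ltW.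
have zM2 : normc (1 - z ^+ M) <= 2.
  apply: le_trans (normcB _ _) _; rewrite normc1 normcX.
  have zM1 : normc z ^+ M <= 1 by rewrite exprn_ile1// ltW.
  by lra.
have -> : poisson_sum G r M z * (1 - z ^+ M) - G ((r%:C)%C * z) =
    (poisson_sum G r M z - S') * (1 - z ^+ M) + ((p.[(r%:C)%C * z] - G ((r%:C)%C * z)) +
      ((tl - conjc p`_0) + (conjc p`_0 - 1))).
  rewrite mulrBl S'E; ring.
apply: le_trans (normcD _ _) _; rewrite Normc.normcM.
have b1 : normc (poisson_sum G r M z - S') * normc (1 - z ^+ M) <= 2 * e / (1 - normc z) * 2.
  by apply: ler_pM; rewrite ?normc_ge0.
have b2 : normc (p.[(r%:C)%C * z] - G ((r%:C)%C * z) +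
      (tl - conjc p`_0 + (conjc p`_0 - 1))) <= e + (e + e).
  by apply: le_trans (normcD _ _) _; apply: lerD => //; apply: le_trans (normcD _ _) _; apply: lerD.
have iv : 1 <= (1 - normc z)^-1 by rewrite invf_ge1 ?subr_gt0//; lra.
have e3 : e <= e / (1 - normc z) by rewrite ler_peMr// ltW.
move: b1 b2 e3; rewrite -!(mulrA _ e); set X := e / _; lra.
Qed.

Lemma cint_discrete (mu : PM R) n (q : nat -> R) (x : nat -> R * R) (Q : R) :
  (forall f, tcont f -> tint mu f = Q^-1 * \sum_(l < n) q l * f (x l)) ->
  forall g, ccont g -> cint mu g = ((Q^-1)%:C)%C * \sum_(l < n) ((q l)%:C)%C * g (x l).
Proof.
move=> H g [cr ci].
have ReZ (a : R) (b : C) : complex.Re ((a%:C)%C * b) = a * complex.Re b.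
  by rewrite ReM /= mul0r subr0.
have ImZ (a : R) (b : C) : complex.Im ((a%:C)%C * b) = a * complex.Im b.
  by rewrite ImM /= mul0r addr0.
have ReS (F : 'I_n -> C) : complex.Re (\sum_(l < n) F l) = \sum_(l < n) complex.Re (F l).
  by elim/big_ind2 : _ => // a b c d; rewrite ReD => -> ->.
have ImS (F : 'I_n -> C) : complex.Im (\sum_(l < n) F l) = \sum_(l < n) complex.Im (F l).
  by elim/big_ind2 : _ => // a b c d; rewrite ImD => -> ->.
apply: complex_ext.
  rewrite Re_cint H// ReZ ReS; congr (_ * _).
  by apply: eq_bigr => l _; rewrite ReZ.
rewrite Im_cint H// ImZ ImS; congr (_ * _).
by apply: eq_bigr => l _; rewrite ImZ.
Qed.

Lemma cvg_invS : (fun n : nat => n.+1%:R^-1 : R) @ \oo --> 0.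
Proof. exact: (@cvg_harmonic R). Qed.

(** G = 1/(1 - z h) must be 1 + psi of the measure sought. Its density is sampled on circles of
    radius r_n tending to 1, giving atomic probability measures whose kernel integrals converge to
    G; a weak ultrafilter limit of them is the measure. *)
Theorem herglotz (h : C -> C) : pan h -> (forall z, normc z < 1 -> normc (h z) <= 1) ->
  exists mu : PM R, onT mu /\ forall z, normc z < 1 -> h z = hfun mu z.
Proof.
move=> ph h1; pose G z := (1 - z * h z)^-1.
have zh z : normc z < 1 -> normc (z * h z) <= normc z.
  by move=> z1; rewrite Normc.normcM ler_piMr ?normc_ge0 ?h1.
have pG : pan G.
  apply: pan_inv; first exact: (panD (pan_cst 1) (panN (panM (@pan_id R) ph))).
  move=> r /andP[r0 r1]; exists 1, r; split; rewrite ?oner_eq0 ?r0//.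
  move=> z zr; rewrite mul1r opprB addrCA subrr addr0.
  exact: le_trans (zh _ (le_lt_trans zr r1)) zr.
have G0 : G 0 = 1 by rewrite /G mul0r subr0 invr1.
have ReG z : normc z < 1 -> 1 / 2 <= complex.Re (G z).
  by move=> z1; apply: Re_inv_sub1; apply: le_lt_trans (zh _ z1) z1.
pose r n : R := 1 - n.+2%:R^-1.
have rn n : 0 < r n < 1.
  have h2 : n.+2%:R^-1 < 1 :> R by rewrite invf_lt1 ?ltr1n ?ltr0n.
  have h3 : 0 < n.+2%:R^-1 :> R by rewrite invr_gt0 ltr0n.
  by rewrite /r subr_gt0 h2 gtrBl h3.
(* The factor 1/8 keeps the error 7 e_n below 1 at z = 0, where G = 1; hence the total weight cannot
   vanish and may be normalized. *)
pose e n : R := n.+1%:R^-1 / 8.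
have e0 n : 0 < e n by rewrite divr_gt0// invr_gt0 ltr0n.
have [M HM] := choice (fun n => poisson_step pG G0 (rn n) (e0 n)).
pose S n z := poisson_sum G (r n) (M n) z.
have q0 n l : 0 <= poisson_weight G (r n) (M n) l.
  rewrite /poisson_weight; have := ReG ((r n)%:C%C * omega R (M n) ^+ l).
  have /andP[r0 r1] := rn n.
  rewrite Normc.normcM normcX normc_omega expr1n mulr1 normcR (gtr0_norm r0) => /(_ r1).
  lra.
(* Atoms sit at the conjugate nodes, since the sum has kernel 1/(1 - z conj w) whereas psi uses 1/(1
   - z zeta). *)
pose x n l := ptc (conjc (omega R (M n) ^+ l)).
have xc n l : circle R (x n l).
  by apply: ptc_circle; rewrite normc_conj normcX normc_omega expr1n.
have S0E n : S n 0 = (((M n)%:R^-1 * \sum_(l < M n) poisson_weight G (r n) (M n) l)%:C)%C.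
  rewrite /S /poisson_sum rmorphM fmorphV rmorph_nat rmorph_sum; congr (_ * _).
  by apply: eq_bigr => l _; rewrite mul0r subr0 invr1 mulr1.
have Sp n : 0 < \sum_(l < M n) poisson_weight G (r n) (M n) l.
  rewrite lt_def sumr_ge0 ?andbT; last by move=> l _; exact: q0.
  apply/eqP => Q0; have [M0 /(_ 0)] := HM n; have /andP[r0 r1] := rn n.
  rewrite normc0 => /(_ (ltW r0))[]; rewrite -/(S n 0) S0E Q0 mulr0 mulr0 G0.
  rewrite mul0r sub0r normcN normc1 subr0 divr1 => h8 _; move: h8; apply/negP; rewrite -ltNge.
  have : n.+1%:R^-1 <= 1 :> R by rewrite invf_le1 ?ltr0n// ler1n.
  by rewrite /e; move: (n.+1%:R^-1) => y; lra.
have [m Hm] := choice (fun n => discrete_measure (q0 n) (xc n) (Sp n)).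
have m1 n : onT (m n) := (Hm n).1.
have mE n z : normc z < 1 -> cint (m n) (fun p => (1 - z * zeta p)^-1) = S n z / S n 0.
  move=> z1; rewrite (cint_discrete (Hm n).2); last exact: ccont_kernel.
  have [M0 _] := HM n; have MC : (M n)%:R != 0 :> C by rewrite pnatr_eq0 -lt0n.
  rewrite S0E /S /poisson_sum rmorphM !fmorphV rmorph_nat invfM invrK.
  rewrite mulrACA mulVf// mul1r mulrC; congr (_ * _).
  by apply: eq_bigr => l _; rewrite zeta_ptc.
have oo : ProperFilter (\oo : set_system nat) by exact: eventually_filter.
have cS z : normc z < 1 -> clim \oo (fun n => S n z) (G z).
  move=> z1.
  have rz n : normc (((r n)%:C)%C * z) <= normc z.
    have /andP[r0 r1] := rn n.
    by rewrite Normc.normcM normcR (gtr0_norm r0) ler_piMl ?normc_ge0// ltW.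
  have cr : clim \oo (fun n => ((r n)%:C)%C * z) z.
    apply: (clim_squeeze oo (b := fun n => n.+1%:R^-1)); last exact: cvg_invS.
    apply: filterE => n /=; rewrite -[X in _ - X]mul1r -mulrBl Normc.normcM.
    rewrite (_ : ((r n)%:C)%C - 1 = ((- n.+2%:R^-1)%:C)%C); last first.
      by rewrite /r rmorphB rmorph1 addrAC subrr add0r rmorphN.
    rewrite normcR normrN ger0_norm ?invr_ge0 ?ler0n//.
    apply: (@le_trans _ _ (n.+2%:R^-1)); first by rewrite ler_piMr ?invr_ge0 ?ler0n// ltW.
    by rewrite lef_pV2 ?posrE ?ltr0n// ler_nat.
  have cG := pan_clim oo pG z1 rz (lexx _) cr.
  have big : \oo [set n | normc z <= r n].
    have d0 : 0 < 1 - normc z by rewrite subr_gt0.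
    have /cvgrPdist_lt /(_ _ d0) := cvg_invS; apply: filterS => n /=.
    rewrite sub0r normrN ger0_norm ?invr_ge0 ?ler0n// => h'.
    have : n.+2%:R^-1 <= n.+1%:R^-1 :> R by rewrite lef_pV2 ?posrE ?ltr0n// ler_nat.
    by rewrite /r; move: h'; move: (n.+1%:R^-1) (n.+2%:R^-1) => a b; lra.
  have cA : clim \oo (fun n => S n z * (1 - z ^+ M n)) (G z).
    rewrite -[G z]add0r; apply: (eq_clim oo (u := fun n =>
      (S n z * (1 - z ^+ M n) - G (((r n)%:C)%C * z)) + G (((r n)%:C)%C * z))).
      by apply: filterE => n /=; rewrite subrK.
    apply: (climD oo) cG; apply: (clim_squeeze oo (b := fun n => n.+1%:R^-1 * (7 / 8 / (1 - normc z)))).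
      apply: (filterS _ big) => n /= zr; rewrite subr0.
      have [_ /(_ z zr)[h8 _]] := HM n; apply: le_trans h8 _.
      rewrite /e le_eqVlt; apply/orP; left; apply/eqP; by field; rewrite gt_eqF ?subr_gt0//= pnatr_eq0.
    rewrite -[0](mul0r (7 / 8 / (1 - normc z))).
    by apply: cvgM; [exact: cvg_invS|exact: cvg_cst].
  have cB : clim \oo (fun n => 1 - z ^+ M n) 1.
    apply: (clim_squeeze oo (b := fun n => n.+1%:R^-1)); last exact: cvg_invS.
    apply: (filterS _ big) => n /= zr; rewrite addrAC subrr add0r normcN.
    have [_ /(_ z zr)[_ h8]] := HM n; apply: le_trans h8 _.
    by rewrite /e ler_piMr ?invr_ge0 ?ler0n//; lra.
  rewrite -[G z]divr1; apply: (eq_clim oo) (climM oo cA (climV oo (oner_neq0 _) cB)).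
  apply: filterE => n /=; rewrite mulfK//; apply: sub1c_neq0; rewrite normcX.
  have [M0 _] := HM n; apply: (le_lt_trans _ z1).
  by rewrite -[leRHS]expr1 ler_wiXn2l ?normc_ge0 ?(ltW z1).
have [U [FU ooU]] := ultraFilterLemma oo.
have PU : ProperFilter U := @ultra_proper _ _ FU.
have [mu [mu1 Hmu]] := weak_compactness FU m1.
exists mu; split => //.
have GE z : normc z < 1 -> 1 + z * Kf mu z = G z.
  move=> z1; rewrite one_psiE//.
  apply: (@clim_unique R nat U PU (fun n => cint (m n) (fun p => (1 - z * zeta p)^-1))).
    have [cr ci] := ccont_kernel z1.
    by apply: clim_ReIm; [exact: Hmu cr|exact: Hmu ci].
  have c0 : normc (0 : C) < 1 by rewrite normc0.
  have cU u l : clim \oo u l -> clim U u l by move=> cu eps eps0; apply: ooU; exact: cu.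
  apply: cU; rewrite -[G z]divr1; apply: (eq_clim oo (u := fun n => S n z / S n 0)).
    by apply: filterE => n /=; rewrite mE.
  apply: (climM oo (cS z z1)); apply: (climV oo (oner_neq0 _)).
  by rewrite -G0; exact: cS.
have off0 z : normc z < 1 -> z != 0 -> h z = hfun mu z.
  move=> z1 z0; apply: (mulfI z0); rewrite hfunE// GE//.
  have zh0 : 1 - z * h z != 0 by apply: sub1c_neq0; exact: le_lt_trans (zh _ z1) z1.
  rewrite mulrA (_ : z * Kf mu z = G z - 1); last by rewrite -GE// addrAC subrr add0r.
  by rewrite /G; field.
move=> z z1; have [->|] := eqVneq z 0; last exact: off0.
(* Cancelling z lost the value at 0; it is recovered along nonzero points tending to 0, both
   functions being continuous there. *)
pose u n : C := ((n.+2%:R^-1)%:C)%C.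
have un n : normc (u n) <= 1 / 2.
  rewrite normcR ger0_norm ?invr_ge0 ?ler0n// mul1r lef_pV2 ?posrE ?ltr0n//.
  by rewrite ler_nat.
have cu : clim \oo u 0.
  apply: (clim_squeeze oo (b := fun n => n.+1%:R^-1)); last exact: cvg_invS.
  apply: filterE => n; rewrite /mkset subr0 normcR ger0_norm ?invr_ge0 ?ler0n//.
  by rewrite lef_pV2 ?posrE ?ltr0n// ler_nat.
have n0 : normc (0 : C) <= 1 / 2 by rewrite normc0; lra.
have l1 := pan_clim oo ph (@half_lt1 R) un n0 cu.
have l2 := pan_clim oo (pan_hfun mu1) (@half_lt1 R) un n0 cu.
apply: (clim_unique oo l1); apply: (eq_clim oo) l2; apply: filterE => n.
rewrite /mkset off0//; first exact: le_lt_trans (un n) (@half_lt1 R).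
by rewrite -normc_gt0 normcR gtr0_norm ?invr_gt0 ?ltr0n.
Qed.
End HerglotzRepresentation.

(** * Schur functions and the compact semigroup of Schur pairs *)

Section SchurClass.
Variable R : realType.
Local Notation C := R[i].
Implicit Types (h g : C -> C) (z w : C).

(** Membership is representability by a measure, so bounds and compactness transfer directly from
    measures; [herglotz] gives membership of products and compositions. *)
Definition schur h := exists mu : PM R, onT mu /\ forall z, normc z < 1 -> h z = hfun mu z.

Lemma schur_pan h : schur h -> pan h.
Proof. by move=> [mu [m1 H]]; apply: eq_pan (pan_hfun m1) => z /H. Qed.

Lemma schur_le1 h z : schur h -> normc z < 1 -> normc (h z) <= 1.
Proof. by move=> [mu [m1 H]] z1; rewrite H// normc_hfun. Qed.

Lemma schurM h g : schur h -> schur g -> schur (fun z => h z * g z).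
Proof.
move=> sh sg; apply: herglotz; first exact: panM (schur_pan sh) (schur_pan sg).
by move=> z z1; rewrite Normc.normcM mulr_ile1 ?normc_ge0 ?schur_le1.
Qed.

Lemma schur_zh h z : schur h -> normc z < 1 -> normc (z * h z) <= normc z.
Proof. by move=> sh z1; rewrite Normc.normcM ler_piMr ?normc_ge0 ?schur_le1. Qed.

Lemma schur_comp h g : schur h -> schur g -> schur (fun z => h (z * g z)).
Proof.
move=> sh sg; apply: herglotz.
  apply: (pan_comp (schur_pan sh) (panM (@pan_id R) (schur_pan sg))) => z z1.
  exact: schur_zh.
move=> z z1; apply: schur_le1 => //; exact: le_lt_trans (schur_zh sg z1) z1.
Qed.

Lemma schur_cst (c : C) : normc c <= 1 -> schur (fun=> c).
Proof. by move=> c1; apply: herglotz => //; exact: pan_cst. Qed.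

Lemma schur_lip h z w (r : R) : schur h -> normc z <= r -> normc w <= r -> r < 1 ->
  normc (h z - h w) <= 8 * ((1 - r) ^+ 2)^-1 * normc (z - w).
Proof.
move=> [mu [m1 H]] zr wr r1.
by rewrite !H; [exact: hfun_lip|exact: le_lt_trans wr r1|exact: le_lt_trans zr r1].
Qed.

(** In [hfun_near_rotation] the parameter a makes the bound L (a + (1 - |h(0)|^2)/a). With d = a^2/2
    one has 1 - |h(0)|^2 <= a^2, so the bound is 2 L a = e. *)
Lemma schur_near (r e : R) : r < 1 -> 0 < e -> exists2 d, 0 < d &
  forall h, schur h -> 1 - d < normc (h 0) ->
  forall z, normc z <= r -> normc (h z - h 0) <= e.
Proof.
move=> r1 e0; pose L := 4 * ((1 - r) ^+ 2)^-1.
have L0 : 0 < L by rewrite mulr_gt0// invr_gt0 exprn_gt0// subr_gt0.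
pose a := e / (2 * L); have a0 : 0 < a by rewrite divr_gt0// mulr_gt0.
exists (a ^+ 2 / 2); first by rewrite divr_gt0// exprn_gt0.
move=> h [mu [m1 H]] hd z zr; have n0 : normc (0 : C) < 1 by rewrite normc0.
have z1 := le_lt_trans zr r1.
have h01 : normc (h 0) <= 1 by rewrite H// normc_hfun.
have := hfun_near_rotation m1 zr r1 a0; rewrite -!H// => hh; apply: le_trans hh _.
rewrite -/L (_ : e = L * (a + a)); last by rewrite /a; field; rewrite gt_eqF.
rewrite ler_pM2l// lerD2l ler_pdivrMr// -expr2.
have := normc_ge0 (h 0); nra.
Qed.

Lemma schur_dichotomy h : schur h -> (forall z, normc z < 1 -> h z = h 0) \/
  exists (k : nat) (d : C) (B : R), [/\ (0 < k)%N, d != 0, 0 <= B &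
    forall z, normc z <= 1 / 2 -> normc (h z - h 0 - d * z ^+ k) <= B * normc z ^+ k.+1].
Proof.
move=> [mu [m1 H]]; have n0 : normc (0 : C) < 1 by rewrite normc0.
have [E|[k [d [B [k0 d0 B0 E]]]]] := hfun_dichotomy m1.
  by left => z z1; rewrite !H//; exact: hfun_rigid.
right; exists k, d, B; split => // z z2.
by rewrite !H//; [exact: E|exact: le_lt_trans z2 (@half_lt1 R)].
Qed.

Lemma schur_limit (U : set_system nat) (FU : UltraFilter U) (h : nat -> C -> C) :
  (forall j, schur (h j)) -> exists2 g, schur g &
    forall z, normc z < 1 -> clim U (fun j => h j z) (g z).
Proof.
move=> sh; have PU : ProperFilter U := @ultra_proper _ _ FU.
have [m Hm] := choice sh.
have m1 j : onT (m j) := (Hm j).1.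
have [mu [mu1 Hmu]] := weak_compactness FU m1.
exists (hfun mu); first by exists mu.
move=> z z1; apply: (eq_clim PU) (hfun_clim PU m1 mu1 Hmu z1).
by apply: filterE => j /=; rewrite (Hm j).2.
Qed.

Lemma schur_clim_comp (F : set_system nat) (FF : ProperFilter F) (h : nat -> C -> C) g
    (w : nat -> C) (w0 : C) (r : R) :
  (forall j, schur (h j)) -> (forall z, normc z < 1 -> clim F (fun j => h j z) (g z)) ->
  r < 1 -> (forall j, normc (w j) <= r) -> normc w0 <= r -> clim F w w0 ->
  clim F (fun j => h j (w j)) (g w0).
Proof.
move=> sh hg r1 wr w0r cw; have [m Hm] := choice sh.
have m1 j : onT (m j) := (Hm j).1.
apply: (eq_clim FF (u := fun j => hfun (m j) (w j))).
  by apply: filterE => j /=; rewrite (Hm j).2//; exact: le_lt_trans (wr j) r1.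
apply: (hfun_clim_comp FF m1 _ r1 wr w0r cw) => z z1.
by apply: (eq_clim FF) (hg z z1); apply: filterE => j /=; rewrite (Hm j).2.
Qed.

Definition cpair := ((C -> C) * (C -> C))%type.
Implicit Types (x y : cpair).

(* The convolution on the pairs (h_mu, h_nu); it is associative on the nose. *)
Definition conv x y : cpair :=
  (fun z => y.1 z * x.1 (z * y.2 z), fun z => y.2 z * x.2 (z * y.2 z)).
Definition cone : cpair := (fun=> 1, fun=> 1).
Fixpoint cpw x n : cpair := if n is n'.+1 then conv (cpw x n') x else cone.
(** Pairs are total functions, but only their values on the disc have meaning. *)
Definition eqD x y := forall z, normc z < 1 -> x.1 z = y.1 z /\ x.2 z = y.2 z.
Definition schur2 x := schur x.1 /\ schur x.2.

Lemma convA x y (w : cpair) : conv x (conv y w) = conv (conv x y) w.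
Proof. by rewrite /conv /=; congr pair; apply/funext => z; rewrite !mulrA. Qed.

Lemma conv1 x : conv x cone = x.
Proof. by case: x => g h; rewrite /conv /=; congr pair; apply/funext => z; rewrite !mulr1 mul1r. Qed.

Lemma cpwD x m n : cpw x (m + n) = conv (cpw x m) (cpw x n).
Proof.
elim: n => [|n IH]; first by rewrite addn0 conv1.
by rewrite addnS /= IH convA.
Qed.

Lemma schur2_conv x y : schur2 x -> schur2 y -> schur2 (conv x y).
Proof.
by move=> [x1 x2] [y1 y2]; split; apply: schurM => //; exact: schur_comp.
Qed.

Lemma schur2_one : schur2 cone.
Proof. by split; apply: schur_cst; rewrite normc1. Qed.

Lemma schur2_pw x n : schur2 x -> schur2 (cpw x n).
Proof.
by move=> sx; elim: n => [|n IH] /=; [exact: schur2_one|exact: schur2_conv].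
Qed.

Lemma eqD_sym x y : eqD x y -> eqD y x.
Proof. by move=> H z z1; have [-> ->] := H z z1. Qed.

Lemma eqD_trans x y (w : cpair) : eqD x y -> eqD y w -> eqD x w.
Proof. by move=> H K z z1; have [-> ->] := H z z1; exact: K. Qed.

Definition lim2 (F : set_system nat) (xs : nat -> cpair) x := forall z, normc z < 1 ->
  clim F (fun j => (xs j).1 z) (x.1 z) /\ clim F (fun j => (xs j).2 z) (x.2 z).

Lemma lim2_unique (F : set_system nat) (FF : ProperFilter F) xs x y :
  lim2 F xs x -> lim2 F xs y -> eqD x y.
Proof.
move=> lx ly z z1; have [a1 a2] := lx z z1; have [b1 b2] := ly z z1.
by split; [exact: clim_unique a1 b1|exact: clim_unique a2 b2].
Qed.

Lemma eq_lim2 (F : set_system nat) (FF : ProperFilter F) xs ys x :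
  F [set j | eqD (xs j) (ys j)] -> lim2 F xs x -> lim2 F ys x.
Proof.
move=> E lx z z1; have [a1 a2] := lx z z1.
split; [apply: (eq_clim FF) a1|apply: (eq_clim FF) a2];
  by apply: (filterS _ E) => j /= /(_ z z1)[].
Qed.

Lemma lim2_exists (U : set_system nat) (FU : UltraFilter U) xs :
  (forall j, schur2 (xs j)) -> exists2 x, schur2 x & lim2 U xs x.
Proof.
move=> sx.
have [g sg Hg] := schur_limit FU (fun j => (sx j).1).
have [h sh Hh] := schur_limit FU (fun j => (sx j).2).
by exists (g, h); [split|move=> z z1; split; [exact: Hg|exact: Hh]].
Qed.

(** Joint continuity of the product. The inner arguments z h_j(z) move with j but never leave the
    disc of radius |z|, where Schur functions are equicontinuous. *)
Lemma lim2_conv (F : set_system nat) (FF : ProperFilter F) xs ys x y :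
  (forall j, schur2 (xs j)) -> (forall j, schur2 (ys j)) -> schur2 y ->
  lim2 F xs x -> lim2 F ys y -> lim2 F (fun j => conv (xs j) (ys j)) (conv x y).
Proof.
move=> sx sy sy' lx ly z z1; have [b1 b2] := ly z z1.
have cw : clim F (fun j => z * (ys j).2 z) (z * y.2 z).
  exact: (climM FF (clim_cst FF z) b2).
have wj j : normc (z * (ys j).2 z) <= normc z := schur_zh (sy j).2 z1.
have w0 : normc (z * y.2 z) <= normc z := schur_zh sy'.2 z1.
split; apply: (climM FF) => //.
  by apply: (schur_clim_comp FF (fun j => (sx j).1) _ z1 wj w0 cw) => u /lx[].
by apply: (schur_clim_comp FF (fun j => (sx j).2) _ z1 wj w0 cw) => u /lx[].
Qed.

(** The index shifts by one: [cpow] starts from the pair itself, [cpw] from the unit. *)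
Lemma cpow_cpw k (a b c d : PM R) : onT a -> onT b -> onT c -> onT d ->
  cpow k a b c d -> eqD (hfun c, hfun d) (cpw (hfun a, hfun b) k.+1).
Proof.
move=> a1 b1; elim: k c d => [|k IH] c d c1 d1.
  move=> /= [ca db]; have hE (m m' : PM R) z : meq m m' -> hfun m z = hfun m' z.
    move=> mm; have cE (k : R * R -> C) : cint m k = cint m' k.
      rewrite /cint; congr Complex; congr fine; apply: eq_measure_integral => A mA _; exact: mm.
    by rewrite /hfun /Defs.eta /psi !cE.
  by move=> z _ /=; rewrite !mulr1; split; exact: hE.
move=> [e [f [e1 [f1 [/(IH e f e1 f1) H /cmconv_hfunP K]]]]] z z1.
have [K2 K1] := K e1 f1 a1 b1 c1 d1 z z1.
have zb := le_lt_trans (normc_zhfun b1 z1) z1.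
have [E1 E2] := H _ zb; split.
  by transitivity (hfun a z * hfun e (z * hfun b z)); [exact: K1|congr (_ * _)].
by transitivity (hfun b z * hfun f (z * hfun b z)); [exact: K2|congr (_ * _)].
Qed.
End SchurClass.

(** * Semigroups over the nonnegative rationals and their extension to the reals *)

Section RationalSemigroups.
Variable R : realType.
Local Notation C := R[i].
Local Notation cpair := (cpair R).

Definition qnn (s : R) := exists a b : nat, s = a%:R / b.+1%:R.

Lemma qnn_ge0 s : qnn s -> 0 <= s.
Proof. by move=> [a [b ->]]; rewrite divr_ge0 ?ler0n. Qed.

Lemma qnn_nat n : qnn n%:R.
Proof. by exists n, 0%N; rewrite divr1. Qed.

Lemma qnn0 : qnn 0. Proof. exact: (qnn_nat 0). Qed.
Lemma qnn1 : qnn 1. Proof. exact: (qnn_nat 1). Qed.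

Lemma qnn_div s k : qnn s -> qnn (s / k.+1%:R).
Proof.
move=> [a [b ->]]; exists a, (b.+1 * k.+1).-1; rewrite prednK ?muln_gt0//.
by rewrite natrM invfM mulrA.
Qed.

Lemma qnnD s t : qnn s -> qnn t -> qnn (s + t).
Proof.
move=> [a [b ->]] [c [d ->]]; exists (a * d.+1 + c * b.+1)%N, (b.+1 * d.+1).-1.
rewrite prednK ?muln_gt0// natrD !natrM.
have b0 : b.+1%:R != 0 :> R by rewrite pnatr_eq0.
have d0 : d.+1%:R != 0 :> R by rewrite pnatr_eq0.
by move: (b.+1%:R) (d.+1%:R) b0 d0 => B D b0 d0; field; rewrite d0 b0.
Qed.

Lemma qnnB s t : qnn s -> qnn t -> s <= t -> qnn (t - s).
Proof.
move=> [a [b ->]] [c [d ->]] st; exists (c * b.+1 - a * d.+1)%N, (b.+1 * d.+1).-1.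
have le : (a * d.+1 <= c * b.+1)%N.
  move: st; rewrite ler_pdivrMr ?ltr0n// mulrAC ler_pdivlMr ?ltr0n//.
  by rewrite -!natrM ler_nat.
rewrite prednK ?muln_gt0// natrB// !natrM.
have b0 : b.+1%:R != 0 :> R by rewrite pnatr_eq0.
have d0 : d.+1%:R != 0 :> R by rewrite pnatr_eq0.
by move: (b.+1%:R) (d.+1%:R) b0 d0 => B D b0 d0; field; rewrite d0 b0.
Qed.

Lemma trunc_natDl (n : nat) (x : R) : 0 <= x -> Num.trunc (n%:R + x) = (n + Num.trunc x)%N.
Proof.
move=> x0; apply: truncn_def; rewrite natrD lerD2l -addnS natrD ltrD2l.
by rewrite truncn_le x0 truncnS_gt.
Qed.

Section Multiplicative.
Variable c : R -> C.
Hypotheses (cD : forall s t, qnn s -> qnn t -> c (s + t) = c s * c t)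
  (c1 : forall s, qnn s -> normc (c s) <= 1) (c0 : c 1 != 0).

Lemma mult0 : c 0 = 1.
Proof. by apply: (mulIf c0); rewrite mul1r -cD ?add0r//; [exact: qnn0|exact: qnn1]. Qed.

Lemma multX s k : qnn s -> c (k%:R * s) = c s ^+ k.
Proof.
move=> qs; elim: k => [|k IH]; first by rewrite mul0r expr0 mult0.
rewrite exprSr -IH -cD//; last first.
  elim: (k) => [|k' [a [b ab]]]; first by rewrite mul0r; exact: qnn0.
  by rewrite -natr1 mulrDl mul1r; apply: qnnD => //; exists a, b.
by rewrite -natr1 mulrDl mul1r.
Qed.

Lemma mult_root s k : qnn s -> c (s / k.+1%:R) ^+ k.+1 = c s.
Proof.
move=> qs; rewrite -multX; last exact: qnn_div.
by rewrite mulrC divfK// pnatr_eq0.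
Qed.

(** As |c| <= 1, multiplicativity makes |c| nonincreasing. A bound |c(1/(k+1))| <= 1 - e for large k
    would give |c(1)| <= (1 - e)^(k+1), which tends to 0. *)
Lemma mult_near (e : R) : 0 < e -> exists2 d, 0 < d &
  forall s, qnn s -> s < d -> 1 - e < normc (c s).
Proof.
move=> e0; pose e' := Num.min e 1.
have e'0 : 0 < e' by rewrite lt_min e0 ltr01.
have e'1 : e' <= 1 by rewrite ge_min lexx orbT.
have e'01 : 0 <= 1 - e' < 1 by apply/andP; split; lra.
have nc : 0 < normc (c 1) / 2 by rewrite divr_gt0// normc_gt0.
have [k Hk] := geometric_small 1 e'01 nc.
have big : 1 - e' < normc (c (1 / k.+1%:R)).
  rewrite ltNge; apply/negP => le.
  have /andP[e1 e2] := e'01.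
  have h : normc (c 1) <= (1 - e') ^+ k.+1.
    rewrite -(mult_root k qnn1) normcX; apply: lerXn2r; rewrite ?nnegrE ?normc_ge0//.
  have h2 : (1 - e') ^+ k.+1 <= (1 - e') ^+ k.
    by rewrite exprS ler_piMl ?exprn_ge0// ltW.
  move: Hk; rewrite mul1r; move: h h2 nc; lra.
exists (1 / k.+1%:R); first by rewrite divr_gt0// ltr0n.
move=> s qs sd; have qk : qnn (1 / k.+1%:R) by apply: qnn_div; exact: qnn1.
have qd := qnnB qs qk (ltW sd).
have E : c (1 / k.+1%:R) = c s * c (1 / k.+1%:R - s).
  by rewrite -cD// addrCA subrr addr0.
have : normc (c (1 / k.+1%:R)) <= normc (c s).
  by rewrite E Normc.normcM ler_piMr ?normc_ge0 ?c1.
have : e' <= e by rewrite ge_min lexx.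
move: big; lra.
Qed.

(** The modulus is thus |c(1)|^s: only the phase of c can behave wildly in s. *)
Lemma mult_norm s : qnn s -> normc (c s) = expR (s * ln (normc (c 1))).
Proof.
move=> qs; have nc : 0 < normc (c 1) by rewrite normc_gt0.
have [a [b sab]] := qs.
apply/eqP; rewrite -(eqrXn2 (n := b.+1)) ?normc_ge0 ?expR_ge0//; apply/eqP.
rewrite -normcX -multX// sab mulrC divfK ?pnatr_eq0//.
rewrite -[X in c X]mulr1 multX; last exact: qnn1.
rewrite normcX -expRM_natl mulrA mulrCA divff ?pnatr_eq0// mulr1.
by rewrite expRM_natl lnK.
Qed.
End Multiplicative.

Definition near_one (Q : R -> cpair) := forall r e : R, r < 1 -> 0 < e -> exists2 d, 0 < d &
  forall s, qnn s -> s < d -> forall z, normc z <= r ->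
    normc ((Q s).1 z - 1) <= e /\ normc ((Q s).2 z - 1) <= e.

(** Right multiplication by a pair close to the unit moves x little, uniformly in x: the outer
    factor costs e, the shifted argument costs e times the Lipschitz constant. *)
Lemma conv_near (x y : cpair) (r e : R) z : schur2 x -> schur2 y -> r < 1 -> normc z <= r ->
  normc (y.1 z - 1) <= e -> normc (y.2 z - 1) <= e ->
  normc ((conv x y).1 z - x.1 z) <= (1 + 8 * ((1 - r) ^+ 2)^-1) * e /\
  normc ((conv x y).2 z - x.2 z) <= (1 + 8 * ((1 - r) ^+ 2)^-1) * e.
Proof.
move=> [sx1 sx2] [sy1 sy2] r1 zr h1 h2.
have z1 := le_lt_trans zr r1; have zy := schur_zh sy2 z1.
have L0 : 0 <= 8 * ((1 - r) ^+ 2)^-1 by rewrite mulr_ge0// invr_ge0 sqr_ge0.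
have gen (f k : C -> C) : schur f -> normc (k z - 1) <= e ->
    normc (k z * f (z * y.2 z) - f z) <= (1 + 8 * ((1 - r) ^+ 2)^-1) * e.
  move=> sf hk; have -> : k z * f (z * y.2 z) - f z =
    (k z - 1) * f (z * y.2 z) + (f (z * y.2 z) - f z) by ring.
  apply: le_trans (normcD _ _) _; rewrite [leRHS]mulrDl mul1r; apply: lerD.
    rewrite Normc.normcM; apply: le_trans hk; rewrite ler_piMr ?normc_ge0//.
    by apply: schur_le1 => //; exact: le_lt_trans zy z1.
  apply: le_trans (schur_lip sf (le_trans zy zr) zr r1) _; rewrite ler_wpM2l//.
  have -> : z * y.2 z - z = z * (y.2 z - 1) by ring.
  by rewrite Normc.normcM; apply: le_trans h2; rewrite ler_piMl ?normc_ge0// ltW.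
by split; apply: gen.
Qed.

Lemma clim_close (U : set_system nat) (FU : ProperFilter U) (u v : nat -> C) l :
  clim U u l -> (forall e, 0 < e -> U [set j | normc (u j - v j) <= e]) -> clim U v l.
Proof.
move=> cu uv e e0; have e2 : 0 < e / 2 by rewrite divr_gt0.
apply: (filterS _ (filterI (cu _ e2) (uv _ e2))) => j [/= h1 h2].
apply: le_lt_trans (normc_triangle _ (u j) _) _; rewrite normc_dist.
by rewrite [e]splitr ler_ltD.
Qed.

(* A semigroup indexed by the nonnegative rationals that is continuous at 0
   extends to the nonnegative reals: compactness provides the limits, continuity
   at 0 makes them independent of the approximating rationals. *)
Lemma semigroup_extension (Q : R -> cpair) :
  (forall s, qnn s -> schur2 (Q s)) ->
  (forall s t, qnn s -> qnn t -> eqD (Q (s + t)) (conv (Q s) (Q t))) ->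
  near_one Q ->
  exists S : R -> cpair, [/\ forall t, schur2 (S t),
    forall s t, 0 <= s -> 0 <= t -> eqD (S (s + t)) (conv (S s) (S t)),
    eqD (S 0) (Q 0), eqD (S 1) (Q 1) &
    forall (z : C) (e : R), normc z < 1 -> 0 < e -> exists2 d, 0 < d &
      forall s t, 0 <= s -> 0 <= t -> `|s - t| < d ->
        normc ((S s).1 z - (S t).1 z) <= e /\ normc ((S s).2 z - (S t).2 z) <= e].
Proof.
move=> sQ QD nQ.
have oo : ProperFilter (\oo : set_system nat) by exact: eventually_filter.
have [U [FU ooU]] := ultraFilterLemma oo.
have PU : ProperFilter U := @ultra_proper _ _ FU.
pose q j (t : R) : R := (Num.trunc (t * j.+1%:R))%:R / j.+1%:R.
have qq j t : qnn (q j t) by exists (Num.trunc (t * j.+1%:R)), j.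
have exS t : exists x, schur2 x /\ lim2 U (fun j => Q (q j t)) x.
  by have [x sx lx] := lim2_exists FU (fun j => sQ _ (qq j t)); exists x.
have [S HS] := choice exS.
have qle j t : 0 <= t -> q j t <= t.
  move=> t0; rewrite /q ler_pdivrMr ?ltr0n// truncn_le.
  by rewrite mulr_ge0 ?ler0n.
have addS s t : 0 <= s -> 0 <= t -> eqD (S (s + t)) (conv (S s) (S t)).
  move=> s0 t0; have [sst lst] := HS (s + t).
  have l2 : lim2 U (fun j => conv (Q (q j s)) (Q (q j t))) (conv (S s) (S t)).
    apply: (lim2_conv PU) (HS s).2 (HS t).2; last exact: (HS t).1.
      by move=> j; exact: sQ.
    by move=> j; exact: sQ.
  apply: (lim2_unique PU _ l2).
  (* The floors for s and t add up to the floor for s + t with a defect of 0 or 1, so d is 0 or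
     1/(j+1); continuity at 0 then makes it disappear in the limit. *)
  have dj j : exists d, [/\ qnn d, d <= j.+1%:R^-1 & q j (s + t) = q j s + q j t + d].
    pose a := s * j.+1%:R; pose b := t * j.+1%:R.
    have a0 : 0 <= a by rewrite mulr_ge0 ?ler0n.
    have b0 : 0 <= b by rewrite mulr_ge0 ?ler0n.
    have /andP[a1 a2] := truncn_itv a0; have /andP[b1 b2] := truncn_itv b0.
    pose ra := a - (Num.trunc a)%:R; pose rb := b - (Num.trunc b)%:R.
    have ra0 : 0 <= ra by rewrite subr_ge0.
    have rb0 : 0 <= rb by rewrite subr_ge0.
    have rab0 : 0 <= ra + rb by exact: addr_ge0.
    have abE : (s + t) * j.+1%:R = (Num.trunc a + Num.trunc b)%:R + (ra + rb).
      by rewrite mulrDl natrD /ra /rb -/a -/b; ring.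
    exists ((Num.trunc (ra + rb))%:R / j.+1%:R); split.
    - by exists (Num.trunc (ra + rb)), j.
    - rewrite -[leRHS]mul1r ler_pM2r ?invr_gt0 ?ltr0n// (ler_nat _ _ 1) -ltnS.
      rewrite (truncn_lt_nat _ rab0).
      have ra1 : ra < 1 by rewrite ltrBlDl natr1.
      have rb1 : rb < 1 by rewrite ltrBlDl natr1.
      by lra.
    - by rewrite /q abE (trunc_natDl _ rab0) !natrD -/a -/b !mulrDl.
  have [d Hd] := choice dj.
  have lst' : lim2 U (fun j => Q (q j s + q j t)) (S (s + t)).
    move=> z z1; have [l1 l2'] := lst z z1.
    have cl e : 0 < e -> U [set j | normc ((Q (q j (s + t))).1 z - (Q (q j s + q j t)).1 z) <= e /\
        normc ((Q (q j (s + t))).2 z - (Q (q j s + q j t)).2 z) <= e].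
      move=> e0; pose L := 1 + 8 * ((1 - normc z) ^+ 2)^-1.
      have L0 : 0 < L by rewrite ltr_wpDr// mulr_ge0// invr_ge0 sqr_ge0.
      have [de de0 Hde] := nQ (normc z) (e / L) z1 (divr_gt0 e0 L0).
      have ev : U [set j | j.+1%:R^-1 < de].
        apply: ooU; have /cvgrPdist_lt /(_ _ de0) := @cvg_invS R; apply: filterS => j /=.
        by rewrite sub0r normrN ger0_norm ?invr_ge0 ?ler0n.
      apply: (filterS _ ev) => j /= jde; have [qd dle qE] := Hd j.
      have [e1 e2] := Hde _ qd (le_lt_trans dle jde) z (lexx _).
      have [E1 E2] := QD _ _ (qnnD (qq j s) (qq j t)) qd z z1.
      rewrite qE E1 E2.
      have := conv_near (sQ _ (qnnD (qq j s) (qq j t))) (sQ _ qd) z1 (lexx _) e1 e2.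
      by rewrite -/L [L * _]mulrC divfK ?gt_eqF.
    split; [apply: (clim_close PU l1)|apply: (clim_close PU l2')] => e e0;
      by apply: (filterS _ (cl e e0)) => j [].
  apply: (eq_lim2 PU _ lst'); apply: filterE => j /=; exact: QD.
have nS r e : r < 1 -> 0 < e -> exists2 d, 0 < d & forall t, 0 <= t -> t < d ->
    forall z, normc z <= r -> normc ((S t).1 z - 1) <= e /\ normc ((S t).2 z - 1) <= e.
  move=> r1 e0; have [d d0 Hd] := nQ r e r1 e0; exists d => // t t0 td z zr.
  have [l1 l2] := (HS t).2 z (le_lt_trans zr r1).
  have hj j := Hd _ (qq j t) (le_lt_trans (qle j t t0) td) z zr.
  split.
    by apply: (clim_le PU (climB PU l1 (clim_cst PU 1))); apply: filterE => j; exact: (hj j).1.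
  by apply: (clim_le PU (climB PU l2 (clim_cst PU 1))); apply: filterE => j; exact: (hj j).2.
(* At t = 0 and t = 1 the approximating rationals are t itself, so the limit keeps the value of
   Q. *)
have fixS t : (forall j, q j t = t) -> eqD (S t) (Q t).
  move=> qt; apply: (lim2_unique PU (HS t).2).
  have -> : (fun j => Q (q j t)) = fun=> Q t by apply/funext => j; rewrite qt.
  by move=> z z1; split; exact: clim_cst.
exists S; split => //.
- by move=> t; exact: (HS t).1.
- by apply: fixS => j; rewrite /q mul0r truncn0 mul0r.
- by apply: fixS => j; rewrite /q mul1r natrK divff// pnatr_eq0.
move=> z e z1 e0; pose L := 1 + 8 * ((1 - normc z) ^+ 2)^-1.
have L0 : 0 < L by rewrite ltr_wpDr// mulr_ge0// invr_ge0 sqr_ge0.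
have [d d0 Hd] := nS (normc z) (e / L) z1 (divr_gt0 e0 L0); exists d => //.
have main s t : 0 <= s -> s <= t -> t - s < d ->
    normc ((S t).1 z - (S s).1 z) <= e /\ normc ((S t).2 z - (S s).2 z) <= e.
  move=> s0 st tsd; have ts0 : 0 <= t - s by rewrite subr_ge0.
  have [e1 e2] := Hd _ ts0 tsd z (lexx _).
  have [E1 E2] := addS s (t - s) s0 ts0 z z1.
  rewrite [s + (t - s)]addrC subrK in E1 E2; rewrite E1 E2.
  have := conv_near (HS s).1 (HS (t - s)).1 z1 (lexx _) e1 e2.
  by rewrite -/L [L * _]mulrC divfK ?gt_eqF.
move=> s t s0 t0 st; have [le|lt] := leP s t.
  have [|h1 h2] := main s t s0 le; first by rewrite distrC ger0_norm ?subr_ge0 in st.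
  by split; rewrite normc_dist.
have [|h1 h2] := main t s t0 (ltW lt); last by split.
by rewrite ger0_norm ?subr_ge0 ?ltW in st.
Qed.
End RationalSemigroups.

(** * Embedding an infinitely divisible Schur pair into a continuous semigroup *)

Section RootSemigroup.
Variable R : realType.
Local Notation C := R[i].
Local Notation cpair := (cpair R).

(** E(t) is a^t for a fixed choice of the argument of a. *)
Lemma complex_one_parameter (a : C) : a != 0 -> exists E : R -> C,
  [/\ E 0 = 1, E 1 = a, forall s t, E (s + t) = E s * E t,
    forall t, normc (E t) = expR (t * ln (normc a)) &
    forall e, 0 < e -> exists2 d, 0 < d & forall t, 0 <= t -> t < d -> normc (E t - 1) <= e].
Proof.
move=> a0; have na : 0 < normc a by rewrite normc_gt0.
have u1 : normc (a * (((normc a)^-1)%:C)%C) = 1.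
  by rewrite Normc.normcM normcR ger0_norm ?invr_ge0 ?normc_ge0// divff// gt_eqF.
have [th thE] := cis_arg u1.
pose E (t : R) : C := (expR (t * ln (normc a)))%:C%C * cis (t * th).
have E0 : E 0 = 1 by rewrite /E !mul0r expR0 cis0 mulr1.
exists E; split => //.
- rewrite /E !mul1r lnK ?posrE// -thE mulrCA -rmorphM divff ?mulr1//.
  by rewrite gt_eqF.
- by move=> s t; rewrite /E !mulrDl expRD cisD rmorphM /= mulrACA.
- by move=> t; rewrite /E Normc.normcM normc_cis mulr1 normcR ger0_norm// expR_ge0.
move=> e e0.
have cl (c : R) : continuous (fun t : R => t * c).
  by move=> t; apply: continuousM; [move=> ?|exact: cst_continuous].
have ce : continuous (fun t : R => expR (t * ln (normc a))).
  by move=> t; apply: (continuous_comp (cl _ t)); exact: continuous_expR.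
have cc : continuous (fun t : R => cos (t * th)).
  by move=> t; apply: (continuous_comp (cl _ t)); exact: continuous_cos.
have cs : continuous (fun t : R => sin (t * th)).
  by move=> t; apply: (continuous_comp (cl _ t)); exact: continuous_sin.
have ReE t : complex.Re (E t) = expR (t * ln (normc a)) * cos (t * th).
  by rewrite /E ReM /= mul0r subr0.
have ImE t : complex.Im (E t) = expR (t * ln (normc a)) * sin (t * th).
  by rewrite /E ImM /= mul0r addr0.
have cE : clim (nbhs (0 : R)) E (E 0).
  apply: clim_ReIm.
    have -> : (fun t => complex.Re (E t)) =
        fun t => expR (t * ln (normc a)) * cos (t * th) by exact/funext.
    by rewrite ReE; exact: (continuousM (ce 0) (cc 0)).
  have -> : (fun t => complex.Im (E t)) =
      fun t => expR (t * ln (normc a)) * sin (t * th) by exact/funext.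
  by rewrite ImE; exact: (continuousM (ce 0) (cs 0)).
have /nbhs_ballP[d d0 Hd] := cE e e0; exists d => // t t0 td.
rewrite -E0; apply: ltW; apply: Hd.
by rewrite /ball /= sub0r normrN ger0_norm.
Qed.

(* If the root semigroup spins, commuting with rotations of arbitrarily large
   order kills every nonconstant Taylor coefficient. *)
Lemma spinning_constant (F : C -> C) (c : R -> C) (k h : R -> C -> C) (X2 : C -> C) (e0 : R) :
  schur F -> schur X2 -> 0 < e0 ->
  (forall s, qnn s -> schur (k s) /\ schur (h s)) ->
  (forall s, qnn s -> c s = h s 0) ->
  (forall s j, qnn s -> c (s / j.+1%:R) ^+ j.+1 = c s) ->
  (forall s z, qnn s -> normc z < 1 -> k s z * F (z * h s z) = F z * k s (z * X2 z)) ->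
  (forall e, 0 < e -> exists2 d, 0 < d & forall s, qnn s -> s < d ->
     1 - e < normc (k s 0) /\ 1 - e < normc (h s 0)) ->
  (forall d, 0 < d -> exists s, [/\ qnn s, s < d & e0 <= normc (c s - 1)]) ->
  forall z, normc z < 1 -> F z = F 0.
Proof.
move=> sF sX e00 skh cE cr comm mod spin.
have [//|[k1 [d [B [kp d0 B0 HF]]]]] := schur_dichotomy sF; exfalso.
case: k1 kp HF => // k0 _ HF.
have hl := @half_lt1 R.
suff : d * (e0%:C)%C = 0.
  move/eqP; rewrite mulf_eq0 (negPf d0) /= => /eqP/(congr1 (@Normc.normc R)).
  by rewrite normcR normc0 gtr0_norm// => E; rewrite E ltxx in e00.
(* With d z^(k0+1) the leading term of F - F(0), it suffices that e0 d z^(k0+1) is O(z^(k0+2)). This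
   will follow from F(la z) being close to F(z) although la^(k0+1) is at distance e0 from 1. *)
apply: (@monomial_bound _ _ k0.+1 (2 * B) 1) => //; first by rewrite mulr_ge0.
move=> z _ z2; have z1 := le_lt_trans z2 hl.
(* The total is 36 = 4 + 32: the commutation relation costs 2 eta0, doubled on dividing by ka of
   modulus at least 1/2, and replacing z h_s(z) by la z costs the Lipschitz constant 32. *)
apply/ler_addgt0Pr => e ep; pose eta0 := Num.min (e / 36) (1 / 2).
have et0 : 0 < eta0 by rewrite lt_min divr_gt0//=; lra.
have et1 : eta0 <= 1 / 2 by rewrite ge_min lexx orbT.
have et2 : eta0 <= e / 36 by rewrite ge_min lexx.
have [dn dn0 Hn] := schur_near hl et0.
have m0 : 0 < Num.min dn (1 / 2) by rewrite lt_min dn0/=; lra.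
have [dm dm0 Hm] := mod _ m0.
have [s0 [qs0 s0d far]] := spin _ dm0.
(* Dividing by k0 + 1 keeps s small, while the (k0+1)-st power of la is c(s0), the value known to
   stay away from 1. *)
pose s := s0 / k0.+1%:R; have qs : qnn s by exact: qnn_div.
have sd : s < dm.
  apply: le_lt_trans s0d; rewrite /s ler_pdivrMr ?ltr0n// ler_peMr ?(qnn_ge0 qs0)//.
  by rewrite ler1n.
have [sk sh] := skh s qs; have [mk mh] := Hm s qs sd.
have dn' : Num.min dn (1 / 2) <= dn by rewrite ge_min lexx.
have dh' : Num.min dn (1 / 2) <= 1 / 2 by rewrite ge_min lexx orbT.
have nk w : normc w <= 1 / 2 -> normc (k s w - k s 0) <= eta0 by apply: Hn => //; lra.
have nh w : normc w <= 1 / 2 -> normc (h s w - h s 0) <= eta0 by apply: Hn => //; lra.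
have zX := schur_zh sX z1; have zh := schur_zh sh z1.
set ka := k s 0 in mk nk *; set la := h s 0 in mh nh *.
have la1 : normc la <= 1 by apply: schur_le1; rewrite ?normc0.
have F1 w : normc w < 1 -> normc (F w) <= 1 by exact: schur_le1.
have zla : normc (la * z) <= normc z by rewrite Normc.normcM ler_piMl ?normc_ge0.
have step : normc (F (la * z) - F z) <= 36 * eta0.
  have b1 : normc (ka * (F (z * h s z) - F z)) <= 2 * eta0.
    have -> : ka * (F (z * h s z) - F z) =
        F z * (k s (z * X2 z) - ka) - (k s z - ka) * F (z * h s z).
      rewrite [RHS](_ : _ = ka * (F (z * h s z) - F z) +
        (F z * k s (z * X2 z) - k s z * F (z * h s z))); last by ring.
      by rewrite comm// subrr addr0.
    apply: le_trans (normcB _ _) _; rewrite !Normc.normcM mulr_natl mulr2n; apply: lerD.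
      apply: le_trans (nk (z * X2 z) _); last exact: le_trans zX z2.
      by rewrite ler_piMl ?normc_ge0 ?F1.
    apply: le_trans (nk z z2); rewrite ler_piMr ?normc_ge0 ?F1//.
    exact: le_lt_trans zh z1.
  have b2 : normc (F (z * h s z) - F z) <= 4 * eta0.
    move: b1; rewrite Normc.normcM; have := normc_ge0 (F (z * h s z) - F z).
    by nra.
  have b3 : normc (F (la * z) - F (z * h s z)) <= 32 * eta0.
    apply: le_trans (schur_lip sF (le_trans zla z2) (le_trans zh z2) hl) _.
    rewrite (_ : 8 * _ = 32); last by field.
    rewrite ler_pM2l//; have -> : la * z - z * h s z = z * (la - h s z) by ring.
    rewrite Normc.normcM normc_dist; apply: le_trans (nh z z2).
    by rewrite ler_piMl ?normc_ge0// ltW.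
  by apply: le_trans (normc_triangle _ (F (z * h s z)) _) _; lra.
have laX : la ^+ k0.+1 = c s0 by rewrite /la -cE// /s cr.
have t1 := HF z z2; have t2 := HF (la * z) (le_trans zla z2).
have t2' : normc (F (la * z) - F 0 - d * (la * z) ^+ k0.+1) <= B * normc z ^+ k0.+2.
  apply: le_trans t2 _; rewrite ler_wpM2l//; apply: lerXn2r; rewrite ?nnegrE ?normc_ge0//.
have E : d * z ^+ k0.+1 * (c s0 - 1) = (F (la * z) - F z) -
    (F (la * z) - F 0 - d * (la * z) ^+ k0.+1) + (F z - F 0 - d * z ^+ k0.+1).
  by rewrite exprMn laX; ring.
have tot : normc (d * z ^+ k0.+1 * (c s0 - 1)) <= 36 * eta0 + 2 * B * normc z ^+ k0.+2.
  rewrite E; apply: le_trans (normcD _ _) _; apply: le_trans (lerD (normcB _ _) (lexx _)) _.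
  by move: step t1 t2'; lra.
have low : normc (d * (e0%:C)%C * z ^+ k0.+1) <= normc (d * z ^+ k0.+1 * (c s0 - 1)).
  rewrite !Normc.normcM mulrAC normcR (gtr0_norm e00) ler_wpM2l ?mulr_ge0 ?normc_ge0//.
move: low tot et2; lra.
Qed.

(** Continuity is stated at each z with a modulus independent of s and t, the form from which
    [weak_cont_hfun] produces weak continuity. *)
Theorem root_semigroup (x : cpair) : schur2 x -> x.1 0 != 0 -> x.2 0 != 0 ->
  (forall n, (1 < n)%N -> exists y, schur2 y /\ eqD (cpw y n) x) ->
  exists S : R -> cpair, [/\ forall t, 0 <= t -> schur2 (S t),
    forall s t, 0 <= s -> 0 <= t -> eqD (S (s + t)) (conv (S s) (S t)),
    eqD (S 0) (cone R), eqD (S 1) x &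
    forall (z : C) (e : R), normc z < 1 -> 0 < e -> exists2 d, 0 < d &
      forall s t, 0 <= s -> 0 <= t -> `|s - t| < d ->
        normc ((S s).1 z - (S t).1 z) <= e /\ normc ((S s).2 z - (S t).2 z) <= e].
Proof.
move=> sx x10 x20 roots.
have n0 : normc (0 : C) < 1 by rewrite normc0.
have oo : ProperFilter (\oo : set_system nat) by exact: eventually_filter.
have [U [FU ooU]] := ultraFilterLemma oo.
have PU : ProperFilter U := @ultra_proper _ _ FU.
have roots' n : exists y, schur2 y /\ eqD (cpw y n`!) x.
  (* As 0! = 1! = 1, x is its own root there; from n = 2 on, n! is at least 2 and the hypothesis
     applies. *)
  case: n => [|[|n]]; [by exists x; rewrite /= /conv /= ; split => // z z1; rewrite /= !mulr1..|].
  apply: roots; rewrite (leq_trans (n := 2`!))//; exact: leq_fact.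
have [y Hy] := choice roots'.
pose K (t : R) n := Num.trunc (t * (n`!)%:R).
have exP t : exists p, schur2 p /\ lim2 U (fun n => cpw (y n) (K t n)) p.
  have [p sp lp] := lim2_exists FU (fun n => schur2_pw (K t n) (Hy n).1).
  by exists p.
have [P HP] := choice exP.
have sP t : schur2 (P t) := (HP t).1.
(* Only s has to be rational: s n! is then an integer for n beyond its denominator and splits off
   the floor of (s + t) n! exactly. *)
have PD s t : qnn s -> 0 <= t -> eqD (P (s + t)) (conv (P s) (P t)).
  move=> [a [b sab]] t0; apply: (lim2_unique PU (HP (s + t)).2).
  apply: (eq_lim2 PU) (lim2_conv PU (fun n => schur2_pw (K s n) (Hy n).1)
    (fun n => schur2_pw (K t n) (Hy n).1) (sP t) (HP s).2 (HP t).2).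
  have big : U [set n | (b < n)%N] by apply: ooU; exists b.+1.
  apply: (filterS _ big) => n /= bn; rewrite -cpwD.
  have /dvdnP[m nm] : (b.+1 %| n`!)%N by apply: dvdn_fact; rewrite bn.
  have sn : s * (n`!)%:R = (a * m)%:R.
    by rewrite sab nm !natrM mulrA mulrAC divfK ?pnatr_eq0.
  have t0' : 0 <= t * (n`!)%:R by rewrite mulr_ge0 ?ler0n.
  by rewrite /K mulrDl sn trunc_natDl// natrK.
have P1 : eqD (P 1) x.
  apply: (lim2_unique PU (HP 1).2) => z z1.
  by split; apply: (eq_clim PU) (clim_cst PU _); apply: filterE => n /=;
    rewrite /K mul1r natrK; have [_ /(_ z z1)[]] := Hy n.
have P0 : eqD (P 0) (cone R).
  apply: (lim2_unique PU (HP 0).2) => z z1.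
  by split; apply: (eq_clim PU) (clim_cst PU _); apply: filterE => n /=;
    rewrite /K mul0r truncn0.
pose a s := (P s).1 0; pose la s := (P s).2 0.
have aD s t : qnn s -> qnn t -> a (s + t) = a s * a t.
  move=> qs qt; have [E _] := PD s t qs (qnn_ge0 qt) 0 n0.
  by rewrite /a E /conv /= mul0r mulrC.
have laD s t : qnn s -> qnn t -> la (s + t) = la s * la t.
  move=> qs qt; have [_ E] := PD s t qs (qnn_ge0 qt) 0 n0.
  by rewrite /la E /conv /= mul0r mulrC.
have a1 s : qnn s -> normc (a s) <= 1 by move=> _; apply: schur_le1 (sP s).1 n0.
have la1 s : qnn s -> normc (la s) <= 1 by move=> _; apply: schur_le1 (sP s).2 n0.
have aE : a 1 = x.1 0 by have [] := P1 0 n0.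
have laE : la 1 = x.2 0 by have [] := P1 0 n0.
have a10 : a 1 != 0 by rewrite aE.
have la10 : la 1 != 0 by rewrite laE.
have [Ea [Ea0 Ea1 EaD Ean Eac]] := complex_one_parameter a10.
have [El [El0 El1 ElD Eln Elc]] := complex_one_parameter la10.
have lna : ln (normc (a 1)) <= 0 by apply: ln_le0; apply: a1; exact: qnn1.
have lnl : ln (normc (la 1)) <= 0 by apply: ln_le0; apply: la1; exact: qnn1.
have Ea_le t : 0 <= t -> normc (Ea t) <= 1.
  by move=> t0; rewrite Ean -[leRHS]expR0 ler_expR mulr_ge0_le0.
have El_le t : 0 <= t -> normc (El t) <= 1.
  by move=> t0; rewrite Eln -[leRHS]expR0 ler_expR mulr_ge0_le0.
(* The alternative is whether la(s), the value at 0 of the second component, tends to 1; its modulus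
   does so anyway. *)
have [caseA|caseB] := pselect (forall e, 0 < e -> exists2 d, 0 < d &
  forall s, qnn s -> s < d -> normc (la s - 1) < e).
  have as0 s : qnn s -> a s != 0.
    by move=> qs; rewrite -normc_gt0 (mult_norm aD a10 qs) expR_gt0.
  (* The phase of a(s) is exchanged for that of the continuous group Ea. The factor is unimodular
     and multiplicative in s, leaves the second component alone, and equals 1 at s = 1, so the
     semigroup law and the endpoint survive. *)
  pose Q s : cpair := (fun z => Ea s / a s * (P s).1 z, (P s).2).
  have un s : qnn s -> normc (Ea s / a s) = 1.
    move=> qs; rewrite Normc.normcM Normc.normcV Ean (mult_norm aD a10 qs).
    by rewrite divff// gt_eqF// expR_gt0.
  have sQ s : qnn s -> schur2 (Q s).
    move=> qs; split; last exact: (sP s).2.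
    by apply: schurM (sP s).1; apply: schur_cst; rewrite un.
  have QD s t : qnn s -> qnn t -> eqD (Q (s + t)) (conv (Q s) (Q t)).
    move=> qs qt z z1; have [E1 E2] := PD s t qs (qnn_ge0 qt) z z1.
    rewrite /Q /conv /= E1 E2 /conv /= EaD aD//; split => //.
    by rewrite invfM; ring.
  have nQ : near_one Q.
    move=> r e r1 e0; have e2 : 0 < e / 2 by rewrite divr_gt0.
    have [d1 d10 H1] := schur_near r1 e2.
    have [d2 d20 H2] := mult_near aD a1 a10 d10.
    have [d3 d30 H3] := mult_near laD la1 la10 d10.
    have [d4 d40 H4] := Eac _ e2; have [d5 d50 H5] := caseA _ e2.
    exists (Num.min (Num.min d2 d3) (Num.min d4 d5)); first by rewrite !lt_min d20 d30 d40 d50.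
    move=> s qs; rewrite !lt_min => /andP[/andP[s2 s3] /andP[s4 s5]] z zr.
    have Q0 : (Q s).1 0 = Ea s by rewrite /Q /= -/(a s) divfK ?as0.
    split.
      apply: le_trans (normc_triangle _ ((Q s).1 0) _) _; rewrite [e]splitr; apply: lerD.
        apply: (H1 _ (sQ s qs).1) zr; rewrite Q0 Ean -(mult_norm aD a10 qs); exact: H2.
      by rewrite Q0; apply: H4 => //; exact: qnn_ge0.
    apply: le_trans (normc_triangle _ ((Q s).2 0) _) _; rewrite [e]splitr; apply: lerD.
      by apply: (H1 _ (sQ s qs).2) zr; exact: H3.
    by apply: ltW; exact: H5.
  have [S [sS SD S0 S1 Sc]] := semigroup_extension sQ QD nQ.
  exists S; split => //.
  - apply: eqD_trans S0 _ => z z1; have [E1 E2] := P0 z z1.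
    have a0 : a 0 = 1 := mult0 aD a10.
    by rewrite /Q /= E1 E2 /= Ea0 a0 divr1 mulr1.
  - apply: eqD_trans S1 _ => z z1; have [E1 E2] := P1 z z1.
    by rewrite /Q /= E1 E2 Ea1 divff// mul1r.
have [e0 e00 spin] : exists2 e, 0 < e &
    forall d, 0 < d -> exists s, [/\ qnn s, s < d & e <= normc (la s - 1)].
  apply: contrapT => H; apply: caseB => e e0; apply: contrapT => K'; apply: H; exists e => // d d0.
  apply: contrapT => H; apply: K'; exists d => // s qs sd; rewrite ltNge; apply/negP => h.
  by apply: H; exists s.
have mod e : 0 < e -> exists2 d, 0 < d & forall s, qnn s -> s < d ->
    [/\ 1 - e < normc ((P s).1 0) & 1 - e < normc ((P s).2 0)].
  move=> ep; have [d1 d10 H1] := mult_near aD a1 a10 ep.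
  have [d2 d20 H2] := mult_near laD la1 la10 ep.
  exists (Num.min d1 d2); first by rewrite lt_min d10.
  by move=> s qs; rewrite lt_min => /andP[s1 s2]; split; [exact: H1|exact: H2].
(* P(1 + s) = P(s + 1) makes P(s) commute with x; this is the only relation the spinning argument
   needs between them. *)
have comm s z : qnn s -> normc z < 1 ->
    (P s).1 z * x.1 (z * (P s).2 z) = x.1 z * (P s).1 (z * x.2 z) /\
    (P s).2 z * x.2 (z * (P s).2 z) = x.2 z * (P s).2 (z * x.2 z).
  move=> qs z1.
  have [A1 A2] := PD 1 s (qnn1 R) (qnn_ge0 qs) z z1; have [B1 B2] := PD s 1 qs ler01 z z1.
  rewrite addrC in B1 B2; rewrite A1 in B1; rewrite A2 in B2.
  have [X1 X2] := P1 z z1; have [Y1 Y2] := P1 _ (le_lt_trans (schur_zh (sP s).2 z1) z1).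
  by move: B1 B2; rewrite /conv /= X1 X2 Y1 Y2.
have lar s j : qnn s -> la (s / j.+1%:R) ^+ j.+1 = la s.
  by move=> qs; exact: mult_root.
have cst1 z : normc z < 1 -> x.1 z = x.1 0.
  apply: (@spinning_constant x.1 la (fun s => (P s).1) (fun s => (P s).2) x.2 e0) => //.
  - exact: sx.1.
  - exact: sx.2.
  - by move=> s _; split; [exact: (sP s).1|exact: (sP s).2].
  - by move=> s w qs w1; have [] := comm s w qs w1.
have cst2 z : normc z < 1 -> x.2 z = x.2 0.
  apply: (@spinning_constant x.2 la (fun s => (P s).2) (fun s => (P s).2) x.2 e0) => //.
  - exact: sx.2.
  - exact: sx.2.
  - by move=> s _; split; exact: (sP s).2.
  - by move=> s w qs w1; have [] := comm s w qs w1.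
  - by move=> e ep; have [d d0 H] := mod e ep; exists d => // s qs /(H s qs)[].
(* Both components of x are constants now, and constant pairs multiply componentwise. *)
exists (fun t : R => ((fun _ : C => Ea t), (fun _ : C => El t)) : cpair); split => //.
- by move=> t t0; split; apply: schur_cst; [exact: Ea_le|exact: El_le].
- by move=> s t _ _ z _; rewrite /conv /= EaD ElD; split; rewrite mulrC.
- by move=> z z1 /=; rewrite Ea1 El1 aE laE cst1// cst2.
move=> z e _ ep; have [d1 d10 H1] := Eac e ep; have [d2 d20 H2] := Elc e ep.
exists (Num.min d1 d2); first by rewrite lt_min d10.
have main (E : R -> C) d s t : (forall s t, E (s + t) = E s * E t) ->
    (forall t, 0 <= t -> normc (E t) <= 1) ->
    (forall t, 0 <= t -> t < d -> normc (E t - 1) <= e) ->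
    0 <= s -> s <= t -> t - s < d -> normc (E t - E s) <= e.
  move=> ED E1 Ec s0 st ts; have ts0 : 0 <= t - s by rewrite subr_ge0.
  have -> : E t - E s = E s * (E (t - s) - 1) by rewrite mulrBr mulr1 -ED [s + _]addrC subrK.
  by rewrite Normc.normcM; apply: le_trans (Ec _ ts0 ts); rewrite ler_piMl ?normc_ge0 ?E1.
move=> s t s0 t0; rewrite lt_min; have [st|ts] := leP s t.
  rewrite distrC ger0_norm ?subr_ge0// => /andP[h1 h2] /=.
  by split; rewrite normc_dist; [exact: (main Ea d1)|exact: (main El d2)].
rewrite ger0_norm ?subr_ge0 ?(ltW ts)// => /andP[h1 h2] /=.
by split; [apply: (main Ea d1) => //|apply: (main El d2) => //]; exact: ltW.
Qed.
End RootSemigroup.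

(** * Haar measure, weak continuity, and the passage between measures and Schur pairs *)

Section HaarMeasure.
Variable R : realType.
Local Notation C := R[i].
Implicit Types mu nu : PM R.

Lemma tint_meq mu nu f : meq mu nu -> tint mu f = tint nu f.
Proof. by move=> H; congr fine; apply: eq_measure_integral => A mA _; exact: H. Qed.

Lemma cint_meq mu nu g : meq mu nu -> cint mu g = cint nu g.
Proof. by move=> H; apply: complex_ext; rewrite ?Re_cint ?Im_cint (tint_meq _ H). Qed.

Lemma meq_hfun mu nu : onT mu -> onT nu ->
  (forall z, normc z < 1 -> hfun mu z = hfun nu z) -> meq mu nu.
Proof.
move=> m1 n1 H; apply: meq_tint => // f cf; apply: tint_uniq => //.
apply: (moment_uniq m1 n1 ltr01) => z _ z2; apply: H.
exact: le_lt_trans z2 (@half_lt1 R).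
Qed.

Lemma rot_circle (a b : R) : a ^+ 2 + b ^+ 2 = 1 -> Defs.rot a b @^-1` circle R = circle R.
Proof.
move=> ab; apply/seteqP; split => [[x y]|[x y]]; rewrite /circle /Defs.rot /= => H.
  move: H; rewrite (_ : _ + _ = (a ^+ 2 + b ^+ 2) * (x ^+ 2 + y ^+ 2)); last by ring.
  by rewrite ab mul1r.
rewrite (_ : _ + _ = (a ^+ 2 + b ^+ 2) * (x ^+ 2 + y ^+ 2)); last by ring.
by rewrite ab H mulr1.
Qed.

Lemma measurable_rot (a b : R) : measurable_fun [set: R * R] (Defs.rot a b).
Proof.
apply/measurable_fun_pairP; split.
  by apply: measurable_funB; apply: measurable_funM.
by apply: measurable_funD; apply: measurable_funM.
Qed.

Lemma rotated_measure mu (a b : R) : onT mu -> a ^+ 2 + b ^+ 2 = 1 ->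
  exists nu, [/\ onT nu, forall A, nu A = mu (Defs.rot a b @^-1` A) &
    forall f, tcont f -> tcont (fun p => f (Defs.rot a b p)) ->
      tint nu f = tint mu (fun p => f (Defs.rot a b p))].
Proof.
move=> m1 ab; have mX := @measurable_rot a b.
pose X : {mfun (R * R)%type >-> (R * R)%type} :=
  @mfun_Sub _ _ (R * R)%type (R * R)%type (Defs.rot a b) (mem_set mX).
pose nu : PM R := distribution mu X.
have nuE A : nu A = mu (Defs.rot a b @^-1` A) by [].
have nu1 : onT nu by rewrite /onT nuE rot_circle.
exists nu; split => // f cf cfr.
have mfc : measurable_fun [set: R * R] (f \_ (circle R)).
  by apply/(measurable_restrictT _ (@measurable_circle R)); exact: measurable_tcont.
have -> : tint nu f = tint nu (f \_ (circle R)).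
  by apply: eq_tint => p pc; rewrite patchT// mem_set.
have rc p : circle R p -> circle R (Defs.rot a b p).
  by move=> pc; have : (Defs.rot a b @^-1` circle R) p by rewrite rot_circle.
have E2 p : circle R p -> (f \_ (circle R)) (Defs.rot a b p) = f (Defs.rot a b p).
  by move=> pc; rewrite patchT// mem_set//; exact: rc.
rewrite /tint /Rintegral /nu /= /distribution integral_pushforward; first last.
- exact: measurable_circle.
- rewrite [X @^-1` _]rot_circle//.
  have := tint_integrable mu cfr; apply: eq_integrable; first exact: measurable_circle.
  by move=> p /set_mem pc /=; rewrite E2.
- exact/measurable_EFinP.
- exact: mX.
congr fine; rewrite [X @^-1` _]rot_circle//.
by apply: eq_integral => p /set_mem pc /=; rewrite E2.
Qed.

Lemma zeta_rot (a b : R) p : zeta (Defs.rot a b p) = (a +i* b)%C * zeta p.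
Proof. by case: p => x y; apply: complex_ext; rewrite ?ReM ?ImM //= addrC. Qed.

Lemma moment_rot mu nu (a b : R) n :
  (forall f, tcont f -> tcont (fun p => f (Defs.rot a b p)) ->
      tint nu f = tint mu (fun p => f (Defs.rot a b p))) ->
  moment nu n = (a +i* b)%C ^+ n * moment mu n.
Proof.
move=> H; have [cr ci] := ccontX n (ccont_zeta R).
have cz : ccont (fun p => zeta (Defs.rot a b p) ^+ n).
  apply: eq_ccont (ccontM (ccont_cst ((a +i* b)%C ^+ n)) (ccontX n (ccont_zeta R))) => p _.
  by rewrite zeta_rot exprMn.
have [crr cri] := cz.
rewrite /moment -cintZ; last exact: ccontX (ccont_zeta R).
transitivity (cint mu (fun p => zeta (Defs.rot a b p) ^+ n)).
  by apply: complex_ext; rewrite ?Re_cint ?Im_cint H.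
by apply: eq_cint => p _; rewrite zeta_rot exprMn.
Qed.

Lemma moment0 mu : onT mu -> moment mu 0 = 1.
Proof.
by move=> m1; rewrite -[RHS](cint_cst 1 m1); apply: eq_cint => p _; rewrite expr0.
Qed.

(** A rotation multiplies the n-th moment by an n-th power, so vanishing moments are preserved and
    the rotated measure has the same moments. *)
Lemma haar_of_moments mu : onT mu -> (forall n, moment mu n.+1 = 0) -> is_haar mu.
Proof.
move=> m1 H; split => // a b ab.
have [nu [n1 nuE Hnu]] := rotated_measure m1 ab.
suff nm : meq nu mu by move=> A mA; rewrite -nuE; exact: nm.
apply: meq_tint => // f cf; apply: tint_uniq => // -[|n]; first by rewrite !moment0.
by rewrite (moment_rot n.+1 Hnu) H mulr0.
Qed.

(** Invariance under the rotation by -1 already makes the first moment equal to its opposite. *)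
Lemma haar_hfun0 mu : is_haar mu -> hfun mu 0 = 0.
Proof.
move=> [m1 H]; have ab : (-1 : R) ^+ 2 + 0 ^+ 2 = 1 by rewrite sqrrN expr1n expr0n addr0.
have [nu [n1 nuE Hnu]] := rotated_measure m1 ab.
have nm : meq nu mu by move=> A mA; rewrite nuE; exact: (H _ _ ab).
have := moment_rot 1 Hnu; rewrite {1}/moment (cint_meq _ nm) -/(moment mu 1) moment1 expr1.
rewrite (_ : ((-1) +i* 0)%C = -1 :> C); last by apply: complex_ext; rewrite /= ?oppr0.
rewrite mulN1r => /eqP; rewrite -subr_eq0 opprK -mulr2n mulrn_eq0 /=.
by move/eqP.
Qed.

Lemma cpw_at0 (y : cpair R) n : (cpw y n).1 0 = y.1 0 ^+ n /\ (cpw y n).2 0 = y.2 0 ^+ n.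
Proof.
elim: n => [|n [IH1 IH2]]; first by rewrite !expr0.
by rewrite /= mul0r IH1 IH2 !exprS.
Qed.

Lemma schur_lin (h : C -> C) z : schur h -> h 0 = 0 -> normc z <= 1 / 2 ->
  normc (h z) <= 32 * normc z.
Proof.
move=> sh h0 z2; have n0 : normc (0 : C) <= 1 / 2 by rewrite normc0; lra.
have := schur_lip sh z2 n0 (@half_lt1 R); rewrite h0 !subr0 => H; apply: le_trans H _.
by rewrite (_ : 8 * _ = 32)//; field.
Qed.

(** If the base vanishes at 0, each of the n factors is at most 32 |z|, since the inner arguments
    never exceed |z| in modulus. *)
Lemma cpw_small (y : cpair R) n z : schur2 y -> normc z <= 1 / 2 ->
  (y.1 0 = 0 -> normc ((cpw y n).1 z) <= (32 * normc z) ^+ n) /\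
  (y.2 0 = 0 -> normc ((cpw y n).2 z) <= (32 * normc z) ^+ n).
Proof.
move=> [s1 s2]; elim: n z => [|n IH] z z2; first by split=> _; rewrite expr0 [X in normc X](_ : _ = 1) ?normc1.
have z1 := le_lt_trans z2 (@half_lt1 R); have zy := schur_zh s2 z1.
have [IH1 IH2] := IH (z * y.2 z) (le_trans zy z2).
have mono : (32 * normc (z * y.2 z)) ^+ n <= (32 * normc z) ^+ n.
  by apply: lerXn2r; rewrite ?nnegrE ?mulr_ge0 ?normc_ge0// ler_pM2l.
split => y0; rewrite /= Normc.normcM exprS; apply: ler_pM; rewrite ?normc_ge0//.
- exact: schur_lin.
- exact: le_trans (IH1 y0) mono.
- exact: schur_lin.
- exact: le_trans (IH2 y0) mono.
Qed.

(** On |z| <= 1/64 the bound is at most 2^-n for every n > 1, so h vanishes near 0 and all moments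
    of positive order are 0. *)
Lemma vanishing_haar mu : onT mu ->
  (forall n z, (1 < n)%N -> normc z <= 1 / 2 -> normc (hfun mu z) <= (32 * normc z) ^+ n) ->
  is_haar mu.
Proof.
move=> m1 H; apply: haar_of_moments => //.
have r0 : 0 < 1 / 64 :> R by lra.
apply: (moment_eq0 m1 r0) => z zr z2.
apply/eqP; rewrite -normc_eq0 eq_le normc_ge0 andbT.
have h01 : 0 <= (1 / 2 : R) < 1 by apply/andP; split; lra.
apply: (geometric_le0 h01 (B := 1)) => k; rewrite mul1r.
apply: le_trans (H k.+2 z _ z2) _ => //.
apply: (@le_trans _ _ ((1 / 2) ^+ k.+2)).
  apply: lerXn2r; rewrite ?nnegrE ?mulr_ge0 ?normc_ge0//; lra.
by apply: ler_wiXn2l; rewrite ?leqW//; lra.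
Qed.

Lemma cinf_div_roots mu nu : onT mu -> onT nu -> cinf_div mu nu ->
  forall n, (1 < n)%N -> exists y : cpair R, schur2 y /\ eqD (cpw y n) (hfun mu, hfun nu).
Proof.
move=> m1 n1 H n n2; have [a [b [a1 [b1 ab]]]] := H n n2.
exists (hfun a, hfun b); split.
  by split; [exists a|exists b].
have := cpow_cpw a1 b1 m1 n1 ab; rewrite prednK ?(ltnW n2)// => E; exact: eqD_sym.
Qed.

(** h(0) is the n-th power of the value at 0 of an n-th root. If it is 0, all the roots vanish at 0
    and [cpw_small] applies for every n. *)
Lemma cinf_div_nonzero mu nu : onT mu -> onT nu -> cinf_div mu nu ->
  (~ is_haar mu -> hfun mu 0 != 0) /\ (~ is_haar nu -> hfun nu 0 != 0).
Proof.
move=> m1 n1 D; have rt := cinf_div_roots m1 n1 D.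
have n0 : normc (0 : C) < 1 by rewrite normc0.
have key (i : bool) : (if i then hfun mu 0 else hfun nu 0) = 0 ->
    is_haar (if i then mu else nu).
  move=> h0; apply: vanishing_haar => [|n z n2 z2]; first by case: (i).
  have [y [sy E]] := rt n n2; have z1 := le_lt_trans z2 (@half_lt1 R).
  have [E1 E2] := E 0 n0; have [F1 F2] := cpw_at0 y n; have [G1 G2] := E z z1.
  rewrite /= in E1 E2 G1 G2.
  have [S1 S2] := cpw_small n sy z2.
  have n0' : n != 0%N by case: (n) n2.
  case: i h0 => h0.
    rewrite /= -G1; apply: S1; apply/eqP; move/eqP : F1; rewrite E1 /= h0 eq_sym expf_eq0.
    by move=> /andP[].
  rewrite /= -G2; apply: S2; apply/eqP; move/eqP : F2; rewrite E2 /= h0 eq_sym expf_eq0.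
  by move=> /andP[].
by split=> nH; apply/eqP => h0; apply: nH; [exact: (key true)|exact: (key false)].
Qed.

(** If continuity failed at t0, some t_j tending to t0 would keep the integral of f at distance e. A
    weak limit of m(t_j) has the same h as m(t0), hence the same integrals: a contradiction. *)
Lemma weak_cont_hfun (m : R -> PM R) : (forall t, 0 <= t -> onT (m t)) ->
  (forall (z : C) (e : R), normc z < 1 -> 0 < e -> exists2 d, 0 < d &
      forall s t, 0 <= s -> 0 <= t -> `|s - t| < d ->
        normc (hfun (m s) z - hfun (m t) z) <= e) ->
  weak_cont m.
Proof.
move=> m1 H f cf; apply/subspace_continuousP => t0; rewrite /= in_itv /= andbT => t00.
apply/cvgrPdist_lt => e e0; rewrite near_withinE.
apply: contrapT => nH.
have seq j : exists t, [/\ 0 <= t, `|t0 - t| < j.+1%:R^-1 &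
    e <= `|tint (m t0) f - tint (m t) f|].
  apply: contrapT => nE; apply: nH; apply/nbhs_ballP; exists j.+1%:R^-1 => /=.
    by rewrite invr_gt0 ltr0n.
  move=> t bt; rewrite in_itv /= andbT => tt0; rewrite ltNge; apply/negP => le.
  by apply: nE; exists t.
have [t Ht] := choice seq.
have oo : ProperFilter (\oo : set_system nat) by exact: eventually_filter.
have [U [FU ooU]] := ultraFilterLemma oo.
have PU : ProperFilter U := @ultra_proper _ _ FU.
have mt1 j : onT (m (t j)) by apply: m1; have [] := Ht j.
have [mu [mu1 Hmu]] := weak_compactness FU mt1.
have hE z : normc z < 1 -> hfun mu z = hfun (m t0) z.
  move=> z1; apply: (clim_unique PU (hfun_clim PU mt1 mu1 Hmu z1)) => eps eps0.
  have eps2 : 0 < eps / 2 by rewrite divr_gt0.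
  have [d d0 Hd] := H z (eps / 2) z1 eps2.
  have ev : U [set j | j.+1%:R^-1 < d].
    apply: ooU; have /cvgrPdist_lt /(_ _ d0) := @cvg_invS R; apply: filterS => j /=.
    by rewrite sub0r normrN ger0_norm ?invr_ge0 ?ler0n.
  apply: (filterS _ ev) => j /= jd; have [tj0 tjd _] := Ht j.
  apply: (@le_lt_trans _ _ (eps / 2)); last by lra.
  by apply: Hd => //; rewrite distrC; exact: lt_trans tjd jd.
have E : tint mu f = tint (m t0) f.
  apply: tint_uniq => //; first exact: m1.
  apply: (moment_uniq mu1 (m1 _ t00) ltr01) => z _ z2; apply: hE.
  exact: le_lt_trans z2 (@half_lt1 R).
have /cvgrPdist_lt /(_ _ e0) lim := Hmu f cf.
have [j /= hj] := filter_ex lim; have [_ _ far] := Ht j.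
by move: far; rewrite -E leNgt hj.
Qed.

(** The Dirac mass as an element of [PM], whereas [delta1] is only a set function. *)
Definition dirac1 : PM R := \d_((1, 0) : (R * R)%type).

Lemma dirac1_onT : onT dirac1.
Proof. by rewrite /onT /dirac1 /= diracE mem_set//; exact: circle10. Qed.

Lemma tint_dirac1 f : tcont f -> tint dirac1 f = f (1, 0).
Proof.
move=> cf; rewrite /tint /Rintegral integral_dirac; first last.
- by apply/measurable_EFinP; exact: measurable_tcont.
- exact: measurable_circle.
by rewrite diracE mem_set ?mul1e//; exact: circle10.
Qed.

Lemma hfun_dirac1 z : normc z < 1 -> hfun dirac1 z = 1.
Proof.
move=> z1; have [cr ci] := ccont_zkernel z1.
have zeta1 : zeta ((1, 0) : R * R) = 1 by [].
have K : Kf dirac1 z = 1 / (1 - z).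
  by apply: complex_ext; rewrite ?Re_cint ?Im_cint tint_dirac1// zeta1 mulr1.
have n0 := sub1c_neq0 z1.
rewrite hfunE; [|exact: dirac1_onT|by []].
by rewrite K; field; rewrite n0 subrK oner_eq0.
Qed.

Lemma cmconv_meq (mu1 nu1 mu2 nu2 mu nu mu' nu' : PM R) : meq mu mu' -> meq nu nu' ->
  cmconv mu1 nu1 mu2 nu2 mu nu -> cmconv mu1 nu1 mu2 nu2 mu' nu'.
Proof.
move=> mm nn H z z1; have [h1 h2] := H z z1.
by rewrite -h1 -h2 /Defs.eta /psi !(cint_meq _ mm) !(cint_meq _ nn).
Qed.

Lemma semigroup_cpow (m n : R -> PM R) N k : cm_semigroup m n -> (0 < N)%N ->
  cpow k (m (1 / N%:R)) (n (1 / N%:R)) (m (k.+1%:R / N%:R)) (n (k.+1%:R / N%:R)).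
Proof.
move=> [mT [mD _]] N0; elim: k => [|k IH]; first by split.
have p j : 0 <= j%:R / N%:R :> R by rewrite divr_ge0 ?ler0n.
exists (m (k.+1%:R / N%:R)), (n (k.+1%:R / N%:R)).
have [a b] := mT _ (p k.+1); do 3 (split => //).
have := mD _ _ (p k.+1) (p 1%N).
by rewrite -mulrDl natr1.
Qed.

(** If h vanished at 0 for t = 1, multiplicativity would make it vanish at 0 for every t = 1/N,
    against weak continuity at t = 0 where the value is 1. *)
Lemma semigroup_nonzero (m n : R -> PM R) : cm_semigroup m n ->
  meq (m 0) (@delta1 R) -> meq (n 0) (@delta1 R) ->
  hfun (m 1) 0 != 0 /\ hfun (n 1) 0 != 0.
Proof.
move=> [mT [mD [mc nc]]] m0 n0.
have c0 : normc (0 : C) < 1 by rewrite normc0.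
have D s t : 0 <= s -> 0 <= t ->
    hfun (m (s + t)) 0 = hfun (m t) 0 * hfun (m s) 0 /\
    hfun (n (s + t)) 0 = hfun (n t) 0 * hfun (n s) 0.
  move=> s0 t0; have [a1 a2] := mT s s0; have [b1 b2] := mT t t0.
  have [d1 d2] := mT _ (addr_ge0 s0 t0).
  have [h1 h2] := (cmconv_hfunP a1 a2 b1 b2 d1 d2).1 (mD s t s0 t0) 0 c0.
  by rewrite h1 h2 !mul0r.
have gen (p : R -> PM R) : (forall t, 0 <= t -> onT (p t)) -> weak_cont p ->
    meq (p 0) (@delta1 R) ->
    (forall s t, 0 <= s -> 0 <= t -> hfun (p (s + t)) 0 = hfun (p t) 0 * hfun (p s) 0) ->
    hfun (p 1) 0 != 0.
  move=> pT pc p0 pD; apply/eqP => H1.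
  have frac N : hfun (p (1 / N.+1%:R)) 0 = 0.
    have np j : 0 <= j%:R / N.+1%:R :> R by rewrite divr_ge0 ?ler0n.
    have X k : hfun (p (k.+1%:R / N.+1%:R)) 0 = hfun (p (1 / N.+1%:R)) 0 ^+ k.+1.
      elim: k => [|k IH]; first by rewrite expr1.
      by rewrite exprS -IH -pD ?np//= ?(np 1%N)// -mulrDl natr1.
    have := X N; rewrite divff ?pnatr_eq0// H1 => /esym/eqP; rewrite expf_eq0.
    by move/andP => [_ /eqP].
  (* The first coordinate integrates to the real part of h(0): it gives 0 at each 1/(N+1) but 1 at t
     = 0. *)
  have := pc (fun q => q.1) (@tcont_fst R) => /subspace_continuousP /(_ 0).
  rewrite /= in_itv /= lexx => /(_ isT) /cvgrPdist_lt /(_ 1 ltr01).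
  rewrite near_withinE => /nbhs_ballP[d d0 Hd].
  pose N := Num.trunc d^-1.
  have Nd : 1 / N.+1%:R < d.
    by rewrite mul1r invf_plt ?posrE ?ltr0n//; exact: truncnS_gt.
  have := Hd (1 / N.+1%:R); rewrite /ball /= sub0r normrN ger0_norm ?divr_ge0 ?ler0n//.
  rewrite in_itv /= divr_ge0 ?ler0n//= => /(_ Nd isT).
  rewrite -[X in `|_ - X|]/(tint (p (1 / N.+1%:R)) (fun q => q.1)).
  rewrite -[X in `|X - _|]/(tint (p 0) (fun q => q.1)).
  have -> : tint (p (1 / N.+1%:R)) (fun q => q.1) = 0.
    by have := congr1 (@complex.Re R) (frac N); rewrite hfun0 Re_cint.
  have -> : tint (p 0) (fun q => q.1) = 1.
    transitivity (tint dirac1 (fun q => q.1)); first by apply: tint_meq; exact: p0.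
    exact: (tint_dirac1 (@tcont_fst R)).
  by rewrite subr0 normr1 ltxx.
split; apply: gen => //.
- by move=> t /mT[].
- by move=> s t s0 t0; have [] := D s t s0 t0.
- by move=> t /mT[].
- by move=> s t s0 t0; have [] := D s t s0 t0.
Qed.
End HaarMeasure.

Theorem theorem5p3 (R : realType) (mu nu : PM R) :
  onT mu -> onT nu ->
  ((cinf_div mu nu /\ ~ is_haar mu /\ ~ is_haar nu) <->
   (exists m n : R -> PM R, cm_semigroup m n /\
      meq (m 0) (@delta1 R) /\ meq (n 0) (@delta1 R) /\
      meq (m 1) mu /\ meq (n 1) nu)).
Proof.
move=> mu1 nu1; split=> [[D [Hm Hn]]|[m [n [sg [m0 [n0 [m1 n1]]]]]]]; last first.
  have [a0 b0] := semigroup_nonzero sg m0 n0.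
  have hE (p q : PM R) : meq p q -> hfun p 0 = hfun q 0.
    by move=> pq; rewrite !hfun0 (cint_meq _ pq).
  split; last first.
    split=> /haar_hfun0 h; first by rewrite (hE _ _ m1) h eqxx in a0.
    by rewrite (hE _ _ n1) h eqxx in b0.
  move=> [//|[//|N]] _; have [mT [mD _]] := sg.
  have Np : 0 <= 1 / N.+2%:R :> R by rewrite divr_ge0 ?ler0n.
  have Nk : 0 <= N.+1%:R / N.+2%:R :> R by rewrite divr_ge0 ?ler0n.
  have [a b] := mT _ Np; have [c d] := mT _ Nk.
  exists (m (1 / N.+2%:R)), (n (1 / N.+2%:R)); do 2 (split => //).
  (* The last factor is split off because (m 1, n 1) agrees with (mu, nu) only on measurable sets;
     [cmconv_meq] changes the endpoint in that last product. *)
  exists (m (N.+1%:R / N.+2%:R)), (n (N.+1%:R / N.+2%:R)); do 3 (split => //).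
    exact: semigroup_cpow.
  apply: (cmconv_meq m1 n1); have := mD _ _ Nk Np.
  by rewrite -mulrDl natr1 divff// pnatr_eq0.
have [nzm nzn] := cinf_div_nonzero mu1 nu1 D.
have sx : schur2 (hfun mu, hfun nu) by split; [exists mu|exists nu].
have [S [sS SD S0 S1 Sc]] :=
  root_semigroup sx (nzm Hm) (nzn Hn) (cinf_div_roots mu1 nu1 D).
(* Semigroups are indexed by all reals, so negative times receive an arbitrary measure on the
   circle. *)
have exm t : exists p : PM R, onT p /\ (0 <= t -> forall z, normc z < 1 -> (S t).1 z = hfun p z).
  have [t0|t0] := leP 0 t; last by exists (dirac1 R); split => //; exact: dirac1_onT.
  by have [[p [p1 pE]] _] := sS t t0; exists p.
have exn t : exists p : PM R, onT p /\ (0 <= t -> forall z, normc z < 1 -> (S t).2 z = hfun p z).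
  have [t0|t0] := leP 0 t; last by exists (dirac1 R); split => //; exact: dirac1_onT.
  by have [_ [p [p1 pE]]] := sS t t0; exists p.
have [m Mm] := choice exm; have [n Mn] := choice exn.
have m1 t : onT (m t) := (Mm t).1; have n1 t : onT (n t) := (Mn t).1.
have mE t z : 0 <= t -> normc z < 1 -> hfun (m t) z = (S t).1 z.
  by move=> t0 z1; rewrite (Mm t).2.
have nE t z : 0 <= t -> normc z < 1 -> hfun (n t) z = (S t).2 z.
  by move=> t0 z1; rewrite (Mn t).2.
exists m, n; split; [|split; [|split; [|split]]].
- split; first by move=> t _; split.
  split.
    move=> s t s0 t0; apply/cmconv_hfunP => // z z1.
    have zh := le_lt_trans (normc_zhfun (n1 t) z1) z1.
    have [E1 E2] := SD s t s0 t0 z z1.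
    by rewrite !mE ?nE ?addr_ge0// -?nE.
  split; apply: weak_cont_hfun => // z e z1 e0; have [d d0 Hd] := Sc z e z1 e0;
    exists d => // s t s0 t0 st; have [h1 h2] := Hd s t s0 t0 st.
    by rewrite !mE.
  by rewrite !nE.
- apply: (meq_hfun (nu := dirac1 R)) => //; first exact: dirac1_onT.
  by move=> z z1; rewrite hfun_dirac1// mE//; have [] := S0 z z1.
- apply: (meq_hfun (nu := dirac1 R)) => //; first exact: dirac1_onT.
  by move=> z z1; rewrite hfun_dirac1// nE//; have [] := S0 z z1.
- by apply: meq_hfun => // z z1; rewrite mE ?ler01//; have [] := S1 z z1.
- by apply: meq_hfun => // z z1; rewrite nE ?ler01//; have [] := S1 z z1.
Qed.
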